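(* A curve $\gamma\in\mathcal L\mathbb S^3(-\mathbf 1,\mathbf k)$ is convex if and only if its left part $\gamma_l\in\mathcal L\mathbb S^2(-\mathbf 1)$ is convex.
   Context: For $n\in\{2,3\}$, a smooth curve $\gamma:[0,1]\to\mathbb S^n\subset\mathbb R^{n+1}$ is locally convex if $\det(\gamma(t),\gamma'(t),\dots,\gamma^{(n)}(t))>0$ for all $t\in[0,1]$; its Frenet frame $\mathcal F_\gamma(t)\in SO_{n+1}$ is the orthogonal matrix obtained by Gram–Schmidt orthonormalization of $(\gamma(t),\gamma'(t),\dots,\gamma^{(n)}(t))$. A smooth curve $\gamma:[0,1]\to\mathbb S^n$ is convex (globally convex) if every hyperplane $H\subset\mathbb R^{n+1}$ through the origin intersects the image of $\gamma$ in at most $n$ points counted with multiplicity. Here endpoints of the curve are not counted, and for $t\in(0,1)$ with $\gamma(t)\in H$ the multiplicity is the smallest $k\ge1$ such that $\gamma^{(j)}(t)\in H$ for $0\le j\le k-1$ and $\gamma^{(k)}(t)\notin H$. $\mathbb H$ denotes the quaternions with basis $\mathbf 1,\mathbf i,\mathbf j,\mathbf k$, and $\mathbb S^3$ is identified with the unit quaternions. $\mathrm{Spin}_3\simeq\mathbb S^3$ with covering $\Pi_3:\mathbb S^3\to SO_3$, $\Pi_3(z)h=zh\bar z$ for $h\in\mathrm{Im}\,\mathbb H\simeq\mathbb R^3$ (basis $\mathbf i,\mathbf j,\mathbf k$); $\mathrm{Spin}_4\simeq\mathbb S^3\times\mathbb S^3$ with covering $\Pi_4(z_l,z_r)q=z_lq\bar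 z_r$ for $q\in\mathbb H\simeq\mathbb R^4$ (basis $\mathbf 1,\mathbf i,\mathbf j,\mathbf k$). If $\mathcal F_\gamma(0)=I$, the lifted Frenet frame $\tilde{\mathcal F}_\gamma:[0,1]\to\mathrm{Spin}_{n+1}$ is the continuous lift of $\mathcal F_\gamma$ starting at the unit element. $\mathcal L\mathbb S^2(z)$ (resp. $\mathcal L\mathbb S^3(z_l,z_r)$) is the set of locally convex curves in $\mathbb S^2$ (resp. $\mathbb S^3$) with $\mathcal F_\gamma(0)=I$ and $\tilde{\mathcal F}_\gamma(1)=z$ (resp. $(z_l,z_r)$). Left part: for $\gamma\in\mathcal L\mathbb S^3(z_l,z_r)$ write $\tilde{\mathcal F}_\gamma(t)=(\tilde\Gamma_l(t),\tilde\Gamma_r(t))\in\mathbb S^3\times\mathbb S^3$; the left part of $\gamma$ is $\gamma_l(t)=\Pi_3(\tilde\Gamma_l(t))e_1$, which is a curve in $\mathcal L\mathbb S^2(z_l)$. *)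

(* Defs.v *)
From HB Require Import structures.
From mathcomp Require Import all_boot all_order all_algebra.
From mathcomp Require Import all_classical all_reals all_analysis.

Set Implicit Arguments.
Unset Strict Implicit.
Unset Printing Implicit Defensive.

Import Order.TTheory GRing.Theory Num.Theory.
Import numFieldNormedType.Exports.

Local Open Scope classical_set_scope.
Local Open Scope ring_scope.

Section Curves.
Context {R : realType} {n : nat}.

(* R^(n+1) is the space of column vectors.  A curve [0,1] -> R^(n+1) is
   represented by a function on R of which only the restriction to [0,1]
   matters: every definition below is insensitive to its values elsewhere. *)
Implicit Types (f g : R -> 'cV[R]_n.+1) (t : R).

Definition dot (u v : 'cV[R]_n.+1) : R := \sum_i u i 0 * v i 0.

Definition l2norm (u : 'cV[R]_n.+1) : R := Num.sqrt (dot u u).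

Definition on_sphere (u : 'cV[R]_n.+1) : Prop := l2norm u = 1.

Definition diffquot f t (s : R) : 'cV[R]_n.+1 := (s - t)^-1 *: (f s - f t).

(* Differentiability and derivative relative to the interval [0,1]: the
   ordinary notions at interior points, the one-sided ones at 0 and 1. *)
Definition derivable01 f t : Prop :=
  cvg (diffquot f t s @[s --> within `[0, 1] t^']).

Definition derive01 f t : 'cV[R]_n.+1 :=
  lim (diffquot f t s @[s --> within `[0, 1] t^']).

Definition derive01n (k : nat) f : R -> 'cV[R]_n.+1 := iter k derive01 f.

Definition smooth01 f : Prop :=
  forall (k : nat) t, t \in `[0, 1] -> derivable01 (derive01n k f) t.

Definition smooth_sphere_curve g : Prop :=
  smooth01 g /\ forall t, t \in `[0, 1] -> on_sphere (g t).

Definition jet_mx g t : 'M[R]_n.+1 := \matrix_(i, j) derive01n j g t i 0.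

Definition locally_convex g : Prop :=
  smooth_sphere_curve g /\ forall t, t \in `[0, 1] -> 0 < \det (jet_mx g t).

Definition normalize (u : 'cV[R]_n.+1) : 'cV[R]_n.+1 := (l2norm u)^-1 *: u.

(* The list of the first [k] vectors obtained from [v 0, v 1, ...]. *)
Fixpoint gram_schmidt (v : nat -> 'cV[R]_n.+1) (k : nat) : seq 'cV[R]_n.+1 :=
  if k is k'.+1 then
    let es := gram_schmidt v k' in
    rcons es (normalize (v k' - \sum_(e <- es) dot (v k') e *: e))
  else [::].

(* The orthonormalized vectors are the columns of the frame. *)
Definition frenet_frame g t : 'M[R]_n.+1 :=
  \matrix_(i, j) (gram_schmidt (fun k => derive01n k g t) n.+1)`_j i 0.

(* A hyperplane through the origin is { v | dot a v = 0 } with [a != 0].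
   [contact a g t k]: the multiplicity at [t] of the intersection is [k]. *)
Definition contact (a : 'cV[R]_n.+1) g t (k : nat) : Prop :=
  [/\ (1 <= k)%N,
      forall j : nat, (j < k)%N -> dot a (derive01n j g t) = 0
    & dot a (derive01n k g t) != 0].

(* [s] enumerates the interior parameters at which the curve meets the
   hyperplane and [m] gives their multiplicities; in particular there are
   finitely many of them and none has infinite multiplicity. *)
Definition convex_curve g : Prop :=
  smooth_sphere_curve g /\
  forall a : 'cV[R]_n.+1, a != 0 ->
    exists (s : seq R) (m : R -> nat),
      [/\ uniq s,
          forall t, (t \in s) <-> (0 < t < 1 /\ dot a (g t) = 0),
          forall t, t \in s -> contact a g t (m t)
        & (\sum_(t <- s) m t <= n)%N].

End Curves.

Section Quaternions.
Context {R : realType}.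

(* a + b i + c j + d k is the column vector (a, b, c, d). *)
Definition quat (a b c d : R) : 'cV[R]_4 := \col_i [:: a; b; c; d]`_i.

Definition qre (z : 'cV[R]_4) : R := z (inord 0) 0.
Definition qi (z : 'cV[R]_4) : R := z (inord 1) 0.
Definition qj (z : 'cV[R]_4) : R := z (inord 2) 0.
Definition qk (z : 'cV[R]_4) : R := z (inord 3) 0.

Definition qmul (x y : 'cV[R]_4) : 'cV[R]_4 :=
  quat (qre x * qre y - qi x * qi y - qj x * qj y - qk x * qk y)
       (qre x * qi y + qi x * qre y + qj x * qk y - qk x * qj y)
       (qre x * qj y - qi x * qk y + qj x * qre y + qk x * qi y)
       (qre x * qk y + qi x * qj y - qj x * qi y + qk x * qre y).

Definition qconj (z : 'cV[R]_4) : 'cV[R]_4 :=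
  quat (qre z) (- qi z) (- qj z) (- qk z).

Definition qone : 'cV[R]_4 := quat 1 0 0 0.
Definition qkk : 'cV[R]_4 := quat 0 0 0 1.

(* R^3 identified with the imaginary quaternions. *)
Definition im_quat (h : 'cV[R]_3) : 'cV[R]_4 :=
  quat 0 (h (inord 0) 0) (h (inord 1) 0) (h (inord 2) 0).
Definition im_part (z : 'cV[R]_4) : 'cV[R]_3 :=
  \col_i [:: qi z; qj z; qk z]`_i.

Definition Pi3 (z : 'cV[R]_4) : 'M[R]_3 :=
  \matrix_(i, j) im_part (qmul (qmul z (im_quat (delta_mx j 0))) (qconj z)) i 0.

Definition Pi4 (z : 'cV[R]_4 * 'cV[R]_4) : 'M[R]_4 :=
  \matrix_(i, j) qmul (qmul z.1 (delta_mx j 0)) (qconj z.2) i 0.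

End Quaternions.

Section LiftedFrames.
Context {R : realType}.

(* [G] is, on [0,1], the continuous lift of the Frenet frame of [g] to the
   spin group (unit quaternions, resp. pairs of them) starting at the unit. *)
Definition lifted_frame3 (g : R -> 'cV[R]_3) (G : R -> 'cV[R]_4) : Prop :=
  [/\ {within `[0, 1], continuous G},
      forall t : R, t \in `[0, 1] -> on_sphere (G t),
      forall t : R, t \in `[0, 1] -> Pi3 (G t) = frenet_frame g t
    & G 0 = qone].

Definition lifted_frame4 (g : R -> 'cV[R]_4)
    (G : R -> 'cV[R]_4 * 'cV[R]_4) : Prop :=
  [/\ {within `[0, 1], continuous G},
      forall t : R, t \in `[0, 1] -> on_sphere (G t).1 /\ on_sphere (G t).2,
      forall t : R, t \in `[0, 1] -> Pi4 (G t) = frenet_frame g t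
    & G 0 = (qone, qone)].

Definition LS2 (z : 'cV[R]_4) (g : R -> 'cV[R]_3) : Prop :=
  [/\ locally_convex g, frenet_frame g 0 = 1%:M
    & exists G, lifted_frame3 g G /\ G 1 = z].

Definition LS3 (zl zr : 'cV[R]_4) (g : R -> 'cV[R]_4) : Prop :=
  [/\ locally_convex g, frenet_frame g 0 = 1%:M
    & exists G, lifted_frame4 g G /\ G 1 = (zl, zr)].

(* For [G] the lifted frame of a curve in S^3. *)
Definition left_part (G : R -> 'cV[R]_4 * 'cV[R]_4) (t : R) : 'cV[R]_3 :=
  Pi3 (G t).1 *m delta_mx 0 0.

End LiftedFrames.

(* Main.v *)
(** Let z, w be the two factors of the lifted frame of gamma, so that the frame has
columns e_0 = gamma, e_1, e_2, e_3 equal to z conj(w), z i conj(w), z j conj(w),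
z k conj(w), and the left part gamma_l has the frame (gamma_l, t_l, n_l) = Pi3 z.
Both convexity conditions are equivalent to

  (D)  <gamma_l, k> > 0 and <n_l, i> > 0 on ]0,1[.

If gamma_l is convex then <gamma_l(t), n_l(s)> > 0 for t <> s, and s -> 0, t -> 0
give (D) up to equality; equality at an interior time forces the frame to be the
identity there, and then <gamma_l, j> has three zeros.  If gamma is convex, the
covectors -e_3(s), e_2(s), -e_1(s), e_0(s) evaluated along the frame have positive
leading minors on ]0,s[.  The lower factor of their LU decomposition has a
logarithmic derivative that is positive and supported on the subdiagonal, which
bounds all its minors from below; letting s -> 1 shows that the entries of gamma
and certain minors of the frame are nonnegative, and (D) follows.

Conversely (D) makes gamma_l disconjugate: dividing successively by the positive
functions <gamma_l, k> and <n_l, i>, every linear form in gamma_l becomes a chain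
of derivatives ending in a constant, so by Rolle it has at most two zeros.  For
gamma the same argument needs the three lower left minors m1, m2, m3 of the frame
to be positive.  To get this, replace w(t) by w(x) e^((theta(t) - theta(x)) k) for
t >= x, where theta' = c_2 / 2; this keeps z and (D), is explicit for x = 0, and is
w for x = 1.  At the least x for which positivity fails, a first zero of a minor
at a time t < 1 is impossible because the other minors cross it with the wrong
sign, and at t = 1 because the frame would be plus or minus the identity there. *)

Require Import Defs.
From mathcomp Require Import all_boot all_order all_algebra.
From mathcomp Require Import all_classical all_reals all_analysis.
From mathcomp Require Import ring lra.

Import Order.TTheory GRing.Theory Num.Theory.
Import numFieldNormedType.Exports.

Set Implicit Arguments.
Unset Strict Implicit.
Unset Printing Implicit Defensive.

Local Open Scope classical_set_scope.
Local Open Scope ring_scope.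

(** * Calculus on the line *)

(** Condition (D) sees only z, while the minors of gamma also involve w. The two factors share just
    c_2, since z' = z((c_1 + c_3)i + c_2 k)/2 and w' = w((c_3 - c_1)i + c_2 k)/2. Turning w about k
    alone after time x amounts to replacing c_1 and c_3 there by their mean: their sum, hence z, is
    kept and all curvatures stay positive, so the total positivity arguments apply to every member
    of the family. The price is a corner at t = x. The covectors -e_3(s), e_2(s), -e_1(s), e_0(s)
    are dictated by the end of the curve: for z = -1 and w = k they become 1, i, j, k at s = 1.
    Their leading minors at a fixed time may degenerate in that limit, so the bounds are cleared of
    these denominators first. Nothing is known outside [0,1], and the lift is only assumed
    continuous. Hence derivatives relative to [0,1], paths extended by constants, and an equation
    for z recovered from the products of its coordinates, which are affine in the left frame. *)

Section Calculus.
Context {R : realType}.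
Implicit Types (f g : R -> R) (a b t x : R).

Definition dv f t (d : R) := is_derive t (1 : R) f d.
Definition ct {T : topologicalType} (f : T -> R) (t : T) := {for t, continuous f}.

Lemma dv_eq f t d d' : dv f t d -> d = d' -> dv f t d'.
Proof. by move=> h <-. Qed.

Lemma dv_cst (c : R) t : dv (fun=> c) t 0.
Proof. exact: is_derive_cst. Qed.

Lemma dvD f g t d e : dv f t d -> dv g t e -> dv (fun s => f s + g s) t (d + e).
Proof. by move=> hf hg; exact: (@is_deriveD _ _ _ f g t 1 d e hf hg). Qed.

Lemma dvN f t d : dv f t d -> dv (fun s => - f s) t (- d).
Proof. by move=> hf; exact: (@is_deriveN _ _ _ f t 1 d hf). Qed.

Lemma dvB f g t d e : dv f t d -> dv g t e -> dv (fun s => f s - g s) t (d - e).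
Proof. by move=> hf hg; exact: (@is_deriveB _ _ _ f g t 1 d e hf hg). Qed.

Lemma dvM f g t d e : dv f t d -> dv g t e ->
  dv (fun s => f s * g s) t (d * g t + f t * e).
Proof.
move=> hf hg; have h := @is_deriveM _ _ f g t 1 d e hf hg.
by apply: dv_eq h _; rewrite /GRing.scale /=; ring.
Qed.

Lemma dv_ct f t d : dv f t d -> ct f t.
Proof.
move=> [h _]; apply: differentiable_continuous.
exact/derivable1_diffP.
Qed.

Lemma dv_comp f g t d e : dv g t e -> dv f (g t) d ->
  dv (fun s => f (g s)) t (d * e).
Proof.
by move=> hg hf; exact: (@is_derive1_comp _ f g t d e hf hg).
Qed.

Lemma dvV f t d : f t != 0 -> dv f t d -> dv (fun s => (f s)^-1) t (- d / f t ^+ 2).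
Proof.
move=> f0 hf; apply: dv_eq (is_deriveV f0 hf) _.
by rewrite /GRing.scale /=; field.
Qed.

Lemma dv_div f g t d e : g t != 0 -> dv f t d -> dv g t e ->
  dv (fun s => f s / g s) t ((d * g t - f t * e) / g t ^+ 2).
Proof.
move=> g0 hf hg; apply: dv_eq (dvM hf (dvV g0 hg)) _.
by field.
Qed.

Lemma dv_sqrt f t d : 0 < f t -> dv f t d ->
  dv (fun s => Num.sqrt (f s)) t (d / (2 * Num.sqrt (f t))).
Proof.
move=> f0 hf; apply: dv_eq (dv_comp hf (is_derive1_sqrt f0)) _.
have : Num.sqrt (f t) != 0 by rewrite sqrtr_eq0 -ltNge.
by move=> h; field.
Qed.

Lemma dv_sin f t d : dv f t d -> dv (fun s => sin (f s)) t (cos (f t) * d).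
Proof. by move=> hf; apply: (dv_comp hf); exact: is_derive_sin. Qed.

Lemma dv_cos f t d : dv f t d -> dv (fun s => cos (f s)) t (- sin (f t) * d).
Proof. by move=> hf; apply: (dv_comp hf); exact: is_derive_cos. Qed.

Lemma dv_ext f g t d : (\forall s \near t, f s = g s) -> dv f t d -> dv g t d.
Proof.
exact: near_eq_is_derive.
Qed.

Lemma dv_uniq f t d e : dv f t d -> dv f t e -> d = e.
Proof. by move=> [_ <-] [_ <-]. Qed.

Lemma ct_cst (T : topologicalType) (c : R) (t : T) : ct (fun=> c) t.
Proof. exact: cst_continuous. Qed.

Lemma ctD (T : topologicalType) (f g : T -> R) (t : T) : ct f t -> ct g t -> ct (fun s => f s +
  g s) t.
Proof. by move=> hf hg; exact: continuousD. Qed.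

Lemma ctN (T : topologicalType) (f : T -> R) (t : T) : ct f t -> ct (fun s => - f s) t.
Proof. by move=> hf; exact: continuousN. Qed.

Lemma ctB (T : topologicalType) (f g : T -> R) (t : T) : ct f t -> ct g t -> ct (fun s =>
  f s - g s) t.
Proof. by move=> hf hg; exact: continuousB. Qed.

Lemma ctM (T : topologicalType) (f g : T -> R) (t : T) : ct f t -> ct g t -> ct (fun s =>
  f s * g s) t.
Proof. by move=> hf hg; exact: continuousM. Qed.

Lemma ctV (T : topologicalType) (f : T -> R) (t : T) : f t != 0 -> ct f t -> ct (fun s =>
  (f s)^-1) t.
Proof. by move=> f0 hf; exact: continuousV. Qed.

Lemma ct_div (T : topologicalType) (f g : T -> R) (t : T) : g t != 0 -> ct f t -> ct g t ->
  ct (fun s => f s / g s) t.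
Proof. by move=> g0 hf hg; apply: ctM => //; exact: ctV. Qed.

Lemma ct_comp (T U : topologicalType) (f : U -> R) (g : T -> U) (t : T) :
  {for t, continuous g} -> ct f (g t) -> ct (fun s => f (g s)) t.
Proof. by move=> hg hf; exact: continuous_comp. Qed.

Lemma ct_id t : ct id t. Proof. by move=> ?. Qed.

Lemma ct_pos f t : ct f t -> 0 < f t ->
  exists2 h : R, 0 < h & forall s, `|s - t| < h -> 0 < f s.
Proof.
move=> cf ft; have : \forall s \near t, 0 < f s.
  by have := cf; rewrite /ct => /cvgr_gt; apply.
move=> /nbhs_ballP[h /= h0 H]; exists h => // s sh; apply: H.
by rewrite /ball /= distrC.
Qed.

Lemma ct_itv f a b : (forall t, a <= t <= b -> ct f t) -> {within `[a, b], continuous f}.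
Proof.
move=> h; apply: continuous_in_subspaceT => t /set_mem /=.
by rewrite in_itv /=; exact: h.
Qed.

Lemma ivt_zero f a b : a <= b -> (forall t, a <= t <= b -> ct f t) ->
  f a <= 0 -> 0 <= f b -> exists2 t, a <= t <= b & f t = 0.
Proof.
move=> ab cf fa fb; have [|c] := @IVT R f a b 0 ab (ct_itv cf).
  by rewrite ge_min le_max fa fb !orbT.
by rewrite in_itv /= => ? ?; exists c.
Qed.

Let mono0 f a b : a < b -> (forall t, a <= t <= b -> ct f t) ->
  (forall t, a < t < b -> exists2 d, dv f t d & 0 < d) -> f a < f b.
Proof.
move=> ab cf df.
have dfE t : a < t < b -> dv f t ('D_1 f t).
  by move=> /df[d [h1 <-] _]; split.
have [c cab fE] := @MVT R f (fun t => 'D_1 f t) a b ab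
  (fun t (h : t \in `]a, b[) => dfE t h) (ct_itv cf).
have [d dh d0] := df c cab.
rewrite -subr_gt0 fE mulr_gt0 ?subr_gt0//.
by rewrite (dv_uniq (dfE _ cab) dh).
Qed.

Let wmono0 f a b : a < b -> (forall t, a <= t <= b -> ct f t) ->
  (forall t, a < t < b -> exists2 d, dv f t d & 0 <= d) -> f a <= f b.
Proof.
move=> ab cf df.
have dfE t : a < t < b -> dv f t ('D_1 f t).
  by move=> /df[d [h1 <-] _]; split.
have [c cab fE] := @MVT R f (fun t => 'D_1 f t) a b ab
  (fun t (h : t \in `]a, b[) => dfE t h) (ct_itv cf).
have [d dh d0] := df c cab.
rewrite -subr_ge0 fE mulr_ge0 ?subr_ge0 ?(ltW ab)//.
by rewrite (dv_uniq (dfE _ cab) dh).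
Qed.

(* The paths of the deformation argument have a corner, so the monotonicity
   lemmas allow one exceptional point [x]. *)
Lemma mono x f a b : a < b -> (forall t, a <= t <= b -> ct f t) ->
  (forall t, a < t < b -> t != x -> exists2 d, dv f t d & 0 < d) -> f a < f b.
Proof.
move=> ab cf df; have [/andP[ax xb]|nx] := boolP (a < x < b).
- apply: (@lt_trans _ _ (f x)); apply: mono0 => //.
  + by move=> t /andP[h1 h2]; apply: cf; rewrite h1 (le_trans h2)// ltW.
  + by move=> t /andP[h1 h2]; apply: df; rewrite ?lt_eqF// h1 (lt_trans h2).
  + by move=> t /andP[h1 h2]; apply: cf; rewrite h2 andbT (le_trans _ h1)// ltW.
  + by move=> t /andP[h1 h2]; apply: df; rewrite ?gt_eqF// h2 andbT (lt_trans ax).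
- by apply: mono0 => // t tab; apply: df => //; apply: contraNneq nx => <-.
Qed.

Lemma wmono x f a b : a <= b -> (forall t, a <= t <= b -> ct f t) ->
  (forall t, a < t < b -> t != x -> exists2 d, dv f t d & 0 <= d) -> f a <= f b.
Proof.
rewrite le_eqVlt => /predU1P[->//|ab] cf df.
have [/andP[ax xb]|nx] := boolP (a < x < b).
- apply: (@le_trans _ _ (f x)); apply: wmono0 => //.
  + by move=> t /andP[h1 h2]; apply: cf; rewrite h1 (le_trans h2)// ltW.
  + by move=> t /andP[h1 h2]; apply: df; rewrite ?lt_eqF// h1 (lt_trans h2).
  + by move=> t /andP[h1 h2]; apply: cf; rewrite h2 andbT (le_trans _ h1)// ltW.
  + by move=> t /andP[h1 h2]; apply: df; rewrite ?gt_eqF// h2 andbT (lt_trans ax).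
- by apply: wmono0 => // t tab; apply: df => //; apply: contraNneq nx => <-.
Qed.

Lemma dec x f a b : a < b -> (forall t, a <= t <= b -> ct f t) ->
  (forall t, a < t < b -> t != x -> exists2 d, dv f t d & d < 0) -> f b < f a.
Proof.
move=> ab cf df; rewrite -ltrN2; apply: (@mono x (fun t => - f t)) => //.
- by move=> t h; apply/ctN/cf.
- move=> t h1 h2; have [d hd d0] := df t h1 h2.
  by exists (- d); [exact: dvN|rewrite oppr_gt0].
Qed.

Lemma wdec x f a b : a <= b -> (forall t, a <= t <= b -> ct f t) ->
  (forall t, a < t < b -> t != x -> exists2 d, dv f t d & d <= 0) -> f b <= f a.
Proof.
move=> ab cf df; rewrite -lerN2; apply: (@wmono x (fun t => - f t)) => //.
- by move=> t h; apply/ctN/cf.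
- move=> t h1 h2; have [d hd d0] := df t h1 h2.
  by exists (- d); [exact: dvN|rewrite oppr_ge0].
Qed.

Lemma dv_const f a b : a <= b -> (forall t, a <= t <= b -> ct f t) ->
  (forall t, a < t < b -> dv f t 0) -> f a = f b.
Proof.
move=> ab cf df; apply/eqP; rewrite eq_le; apply/andP; split.
- by apply: (@wmono a) => // t /df h _; exists 0.
- by apply: (@wdec a) => // t /df h _; exists 0.
Qed.

Lemma dv_min f t d (h : R) : 0 < h ->
  (forall s, `|s - t| < h -> exists e, dv f s e) -> dv f t d -> f t = 0 ->
  (forall s, `|s - t| < h -> 0 <= f s) -> d = 0.
Proof.
move=> h0 df dft ft fp.
suff h' : is_derive t (1 : R) f 0 by exact: dv_uniq dft h'.
have hE s : s \in `]t - h, t + h[ -> `|s - t| < h.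
  by rewrite in_itv /= ltr_distl.
apply: (@derive1_at_min R f (t - h) (t + h) t).
- by lra.
- by move=> s /hE/df[e []].
- by rewrite in_itv /=; apply/andP; split; lra.
- by move=> s /hE/fp; rewrite ft.
Qed.

End Calculus.

(** * Monotonicity of unipotent flows *)

Ltac dvs := lazymatch goal with
  | |- dv (fun s => @?f s - @?g s) _ _ => apply: dvB; dvs
  | |- dv (fun s => @?f s + @?g s) _ _ => apply: dvD; dvs
  | |- dv (fun s => @?f s * @?g s) _ _ => apply: dvM; dvs
  | |- dv (fun s => - @?f s) _ _ => apply: dvN; dvs
  | |- _ => first [match goal with H : dv ?f _ _ |- dv ?f _ _ => exact H end
                 | eassumption | apply dv_cst]
  end.
Ltac cts := lazymatch goal with
  | |- ct (fun s => @?f s - @?g s) _ => apply: ctB; cts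
  | |- ct (fun s => @?f s + @?g s) _ => apply: ctD; cts
  | |- ct (fun s => @?f s * @?g s) _ => apply: ctM; cts
  | |- ct (fun s => - @?f s) _ => apply: ctN; cts
  | |- _ => first [match goal with H : ct ?f _ |- ct ?f _ => exact H end
                 | eassumption | apply ct_cst | solve [auto]]
  end.
Ltac dvr := eapply dv_eq; [dvs | cbv beta; ring].

Section Flow.
Context {R : realType}.
Implicit Types (a b t x : R).

(* Strictly lower entries of the unipotent factor of a matrix path in LU form;
   its logarithmic derivative is supported on the subdiagonal. *)
Record lower := Lower { l10 : R -> R; l21 : R -> R; l32 : R -> R;
                        l20 : R -> R; l31 : R -> R; l30 : R -> R }.

Definition lower_ct (L : lower) t :=
  [/\ ct (l10 L) t, ct (l21 L) t & ct (l32 L) t] /\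
  [/\ ct (l20 L) t, ct (l31 L) t & ct (l30 L) t].

(** In matrix form L' = L N, with the three positive numbers on the subdiagonal of N and zeros
    elsewhere. *)
Definition lower_dv (L : lower) t := exists n : R * R * R,
  [/\ 0 < n.1.1, 0 < n.1.2 & 0 < n.2] /\
  [/\ dv (l10 L) t n.1.1, dv (l21 L) t n.1.2 & dv (l32 L) t n.2] /\
  [/\ dv (l20 L) t (n.1.1 * l21 L t), dv (l31 L) t (n.1.2 * l32 L t) &
      dv (l30 L) t (n.1.1 * l31 L t)].

Definition flow x a b (L : lower) :=
  (forall t, a <= t <= b -> lower_ct L t) /\
  (forall t, a < t < b -> t != x -> lower_dv L t).

(** Minors of the unipotent matrix: [p12] and [p23] on the named rows and columns 0, 1; [w023] and
    [w123] on the named rows and columns 0, 1, 2. *)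
Definition p12 (L : lower) t := l10 L t * l21 L t - l20 L t.
Definition p23 (L : lower) t := l20 L t * l31 L t - l30 L t * l21 L t.
Definition w023 (L : lower) t := l21 L t * l32 L t - l31 L t.
Definition w123 (L : lower) t :=
  l10 L t * w023 L t - (l20 L t * l32 L t - l30 L t).

Definition lower_zero (L : lower) t :=
  [/\ l10 L t = 0, l21 L t = 0 & l32 L t = 0] /\
  [/\ l20 L t = 0, l31 L t = 0 & l30 L t = 0].

(** The matrix L(a)^-1 L(s) solves the same equation and starts at the identity, so its entries and
    minors are nonnegative; the inequalities are these facts written out in terms of L. Each
    difference has as derivative a positive coefficient times a difference already treated. *)
Lemma flow_ge x a b L s : flow x a b L -> a <= s <= b ->
  [/\ l10 L a <= l10 L s, l21 L a <= l21 L s & l32 L a <= l32 L s] /\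
  [/\ l20 L a + l21 L a * (l10 L s - l10 L a) <= l20 L s,
      l31 L a + l32 L a * (l21 L s - l21 L a) <= l31 L s,
      l30 L a + (l31 L a - l32 L a * l21 L a) * (l10 L s - l10 L a)
         + l32 L a * (l20 L s - l20 L a) <= l30 L s,
      p12 L a + l10 L a * (l21 L s - l21 L a) <= p12 L s &
      w023 L a + l21 L a * (l32 L s - l32 L a) <= w023 L s /\
      w123 L a - l20 L a * (l32 L s - l32 L a) + l10 L a * (w023 L s - w023 L a)
        <= w123 L s].
Proof.
move=> F /andP[as_ sb].
have main (f : R -> R) : (forall t, lower_ct L t -> ct f t) ->
    (forall t, a < t <= s -> lower_dv L t ->
     exists2 d, dv f t d & 0 <= d) -> forall r, a <= r <= s -> f a <= f r.
  move=> cf df r /andP[ar rs]; apply: (@wmono _ x) => //.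
  - move=> t /andP[t1 t2]; apply: cf; apply: F.1.
    by rewrite t1 (le_trans t2)// (le_trans rs).
  - move=> t /andP[t1 t2] tx; apply: df.
      by rewrite t1 (le_trans (ltW t2)).
    by apply: F.2 => //; rewrite t1 (lt_le_trans t2)// (le_trans rs).
have h10 : forall r, a <= r <= s -> l10 L a <= l10 L r.
  apply: main => [t [[]]//|t _ [n [[n1 n2 n3] [[d1 d2 d3] [d4 d5 d6]]]]].
  by exists n.1.1 => //; exact: ltW.
have h21 : forall r, a <= r <= s -> l21 L a <= l21 L r.
  apply: main => [t [[]]//|t _ [n [[n1 n2 n3] [[d1 d2 d3] [d4 d5 d6]]]]].
  by exists n.1.2 => //; exact: ltW.
have h32 : forall r, a <= r <= s -> l32 L a <= l32 L r.
  apply: main => [t [[]]//|t _ [n [[n1 n2 n3] [[d1 d2 d3] [d4 d5 d6]]]]].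
  by exists n.2 => //; exact: ltW.
have h20 r : a <= r <= s -> l20 L a + l21 L a * (l10 L r - l10 L a) <= l20 L r.
  move=> ars; suff : l20 L a - l21 L a * (l10 L a - l10 L a) <=
      l20 L r - l21 L a * (l10 L r - l10 L a) by lra.
  apply: (main (fun t => l20 L t - l21 L a * (l10 L t - l10 L a))) => //.
    by move=> t [[? ? ?] [? ? ?]]; cts.
  move=> t /andP[t1 t2] [n [[n1 n2 n3] [[d1 d2 d3] [d4 d5 d6]]]].
  exists (n.1.1 * (l21 L t - l21 L a)); first dvr.
  by apply: mulr_ge0; [exact: ltW|rewrite subr_ge0 h21// t2 ltW].
have h31 r : a <= r <= s -> l31 L a + l32 L a * (l21 L r - l21 L a) <= l31 L r.
  move=> ars; suff : l31 L a - l32 L a * (l21 L a - l21 L a) <=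
      l31 L r - l32 L a * (l21 L r - l21 L a) by lra.
  apply: (main (fun t => l31 L t - l32 L a * (l21 L t - l21 L a))) => //.
    by move=> t [[? ? ?] [? ? ?]]; cts.
  move=> t /andP[t1 t2] [n [[n1 n2 n3] [[d1 d2 d3] [d4 d5 d6]]]].
  exists (n.1.2 * (l32 L t - l32 L a)); first dvr.
  by apply: mulr_ge0; [exact: ltW|rewrite subr_ge0 h32// t2 ltW].
have h12 r : a <= r <= s -> p12 L a + l10 L a * (l21 L r - l21 L a) <= p12 L r.
  move=> ars; suff : p12 L a - l10 L a * (l21 L a - l21 L a) <=
      p12 L r - l10 L a * (l21 L r - l21 L a) by lra.
  apply: (main (fun t => p12 L t - l10 L a * (l21 L t - l21 L a))) => //.
    by move=> t [[? ? ?] [? ? ?]]; rewrite /p12; cts.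
  move=> t /andP[t1 t2] [n [[n1 n2 n3] [[d1 d2 d3] [d4 d5 d6]]]].
  exists (n.1.2 * (l10 L t - l10 L a)); first by rewrite /p12; dvr.
  by apply: mulr_ge0; [exact: ltW|rewrite subr_ge0 h10// t2 ltW].
have h023 r : a <= r <= s -> w023 L a + l21 L a * (l32 L r - l32 L a) <= w023 L r.
  move=> ars; suff : w023 L a - l21 L a * (l32 L a - l32 L a) <=
      w023 L r - l21 L a * (l32 L r - l32 L a) by lra.
  apply: (main (fun t => w023 L t - l21 L a * (l32 L t - l32 L a))) => //.
    by move=> t [[? ? ?] [? ? ?]]; rewrite /w023; cts.
  move=> t /andP[t1 t2] [n [[n1 n2 n3] [[d1 d2 d3] [d4 d5 d6]]]].
  exists (n.2 * (l21 L t - l21 L a)); first by rewrite /w023; dvr.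
  by apply: mulr_ge0; [exact: ltW|rewrite subr_ge0 h21// t2 ltW].
have ss : a <= s <= s by rewrite as_ lexx.
split; first by split; [exact: h10|exact: h21|exact: h32].
split; [exact: h20|exact: h31| |exact: h12|split; [exact: h023|]].
- suff : l30 L a - ((l31 L a - l32 L a * l21 L a) * (l10 L a - l10 L a)
         + l32 L a * (l20 L a - l20 L a)) <=
    l30 L s - ((l31 L a - l32 L a * l21 L a) * (l10 L s - l10 L a)
         + l32 L a * (l20 L s - l20 L a)) by lra.
  apply: (main (fun t => l30 L t - ((l31 L a - l32 L a * l21 L a) *
      (l10 L t - l10 L a) + l32 L a * (l20 L t - l20 L a)))) => //.
    by move=> t [[? ? ?] [? ? ?]]; cts.
  move=> t /andP[t1 t2] [n [[n1 n2 n3] [[d1 d2 d3] [d4 d5 d6]]]].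
  exists (n.1.1 * (l31 L t - (l31 L a + l32 L a * (l21 L t - l21 L a)))).
    by dvr.
  by apply: mulr_ge0; [exact: ltW|rewrite subr_ge0 h31// t2 ltW].
- suff : w123 L a - (- l20 L a * (l32 L a - l32 L a)
         + l10 L a * (w023 L a - w023 L a)) <=
    w123 L s - (- l20 L a * (l32 L s - l32 L a)
         + l10 L a * (w023 L s - w023 L a)) by lra.
  apply: (main (fun t => w123 L t - (- l20 L a * (l32 L t - l32 L a)
         + l10 L a * (w023 L t - w023 L a)))) => //.
    by move=> t [[? ? ?] [? ? ?]]; rewrite /w123 /w023; cts.
  move=> t /andP[t1 t2] [n [[n1 n2 n3] [[d1 d2 d3] [d4 d5 d6]]]].
  exists (n.2 * (p12 L t - (p12 L a + l10 L a * (l21 L t - l21 L a)))).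
    by rewrite /w123 /w023 /p12; dvr.
  by apply: mulr_ge0; [exact: ltW|rewrite subr_ge0 h12// t2 ltW].
Qed.

(** All quantities vanish at [a], and the derivative of each is a positive combination of ones shown
    positive before it; this fixes the order of treatment. *)
Lemma flow_pos x a b L s : flow x a b L -> lower_zero L a -> a < s <= b ->
  [/\ 0 < l10 L s, 0 < l21 L s & 0 < l32 L s] /\
  [/\ 0 < l20 L s, 0 < l31 L s, 0 < l30 L s, 0 < p12 L s &
      [/\ 0 < w023 L s, 0 < p23 L s & 0 < w123 L s]].
Proof.
move=> F [[z1 z2 z3] [z4 z5 z6]] /andP[as_ sb].
have main (f : R -> R) : (forall t, lower_ct L t -> ct f t) -> f a = 0 ->
    (forall t, a < t <= s -> lower_dv L t ->
     exists2 d, dv f t d & 0 < d) -> forall r, a < r <= s -> 0 < f r.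
  move=> cf fa df r /andP[ar rs]; rewrite -fa; apply: (@mono _ x) => //.
  - move=> t /andP[t1 t2]; apply: cf; apply: F.1.
    by rewrite t1 (le_trans t2)// (le_trans rs).
  - move=> t /andP[t1 t2] tx; apply: df.
      by rewrite t1 (le_trans (ltW t2)).
    by apply: F.2 => //; rewrite t1 (lt_le_trans t2)// (le_trans rs).
have h10 : forall r, a < r <= s -> 0 < l10 L r.
  apply: main => [t [[]]//|//|t _ [n [[n1 n2 n3] [[d1 d2 d3] [d4 d5 d6]]]]].
  by exists n.1.1.
have h21 : forall r, a < r <= s -> 0 < l21 L r.
  apply: main => [t [[]]//|//|t _ [n [[n1 n2 n3] [[d1 d2 d3] [d4 d5 d6]]]]].
  by exists n.1.2.
have h32 : forall r, a < r <= s -> 0 < l32 L r.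
  apply: main => [t [[]]//|//|t _ [n [[n1 n2 n3] [[d1 d2 d3] [d4 d5 d6]]]]].
  by exists n.2.
have h20 : forall r, a < r <= s -> 0 < l20 L r.
  apply: main => [t [_ []]//|//|t tas [n [[n1 n2 n3] [[d1 d2 d3] [d4 d5 d6]]]]].
  by eexists; [eassumption|rewrite mulr_gt0// h21].
have h31 : forall r, a < r <= s -> 0 < l31 L r.
  apply: main => [t [_ []]//|//|t tas [n [[n1 n2 n3] [[d1 d2 d3] [d4 d5 d6]]]]].
  by eexists; [eassumption|rewrite mulr_gt0// h32].
have h30 : forall r, a < r <= s -> 0 < l30 L r.
  apply: main => [t [_ []]//|//|t tas [n [[n1 n2 n3] [[d1 d2 d3] [d4 d5 d6]]]]].
  by eexists; [eassumption|rewrite mulr_gt0// h31].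
have h12 : forall r, a < r <= s -> 0 < p12 L r.
  apply: main => [t [[? ? ?] [? ? ?]]||t tas [n [[n1 n2 n3] [[d1 d2 d3] [d4 d5 d6]]]]].
  - by rewrite /p12; cts.
  - by rewrite /p12 z1 z4; ring.
  - exists (n.1.2 * l10 L t); first by rewrite /p12; dvr.
    by rewrite mulr_gt0// h10.
have h023 : forall r, a < r <= s -> 0 < w023 L r.
  apply: main => [t [[? ? ?] [? ? ?]]||t tas [n [[n1 n2 n3] [[d1 d2 d3] [d4 d5 d6]]]]].
  - by rewrite /w023; cts.
  - by rewrite /w023 z2 z5; ring.
  - exists (n.2 * l21 L t); first by rewrite /w023; dvr.
    by rewrite mulr_gt0// h21.
(* The minor on rows 2, 3 and columns 0, 2, which appears in the derivative of [p23]. *)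
have hq : forall r, a < r <= s -> 0 < l20 L r * l32 L r - l30 L r.
  apply: (main (fun r => l20 L r * l32 L r - l30 L r))
     => [t [[? ? ?] [? ? ?]]||t tas [n [[n1 n2 n3] [[d1 d2 d3] [d4 d5 d6]]]]].
  - by cts.
  - by rewrite z4 z6; ring.
  - exists (n.1.1 * w023 L t + n.2 * l20 L t); first by rewrite /w023; dvr.
    by rewrite addr_gt0// mulr_gt0// ?h023// h20.
have h23 : forall r, a < r <= s -> 0 < p23 L r.
  apply: main => [t [[? ? ?] [? ? ?]]||t tas [n [[n1 n2 n3] [[d1 d2 d3] [d4 d5 d6]]]]].
  - by rewrite /p23; cts.
  - by rewrite /p23 z4 z6; ring.
  - exists (n.1.2 * (l20 L t * l32 L t - l30 L t)); first by rewrite /p23; dvr.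
    by rewrite mulr_gt0// hq.
have h123 : forall r, a < r <= s -> 0 < w123 L r.
  apply: main => [t [[? ? ?] [? ? ?]]||t tas [n [[n1 n2 n3] [[d1 d2 d3] [d4 d5 d6]]]]].
  - by rewrite /w123 /w023; cts.
  - by rewrite /w123 z1 z4 z6; ring.
  - exists (n.2 * p12 L t); first by rewrite /w123 /w023 /p12; dvr.
    by rewrite mulr_gt0// h12.
have ss : a < s <= s by rewrite as_ lexx.
by split; split; auto; split; auto.
Qed.

Let dv_refl (f : R -> R) t d k : dv f (k - t) d -> dv (fun s => f (k - s)) t (- d).
Proof.
move=> df; apply: dv_eq (dv_comp (g := fun s =>
  k - s) (dvB (@dv_cst _ k t) (is_derive_id t 1)) df) _.
by ring.
Qed.

Let ct_refl (f : R -> R) t k : ct f (k - t) -> ct (fun s => f (k - s)) t.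
Proof.
move=> cf; refine (@ct_comp _ _ _ f (fun s => k - s) t _ cf).
exact (@ctB _ _ (fun=> k) (fun s => s) t (@ct_cst _ _ k t) (@ct_id _ t)).
Qed.

(* Time reversal combined with conjugation by diag(1, -1, 1, -1). *)
Lemma flow_neg x a b L s : flow x a b L -> lower_zero L b -> a <= s < b ->
  [/\ l10 L s < 0, l21 L s < 0 & l32 L s < 0] /\
  [/\ 0 < l20 L s, 0 < l31 L s, l30 L s < 0, 0 < p12 L s & 0 < w023 L s].
Proof.
move=> [cF dF] [[z1 z2 z3] [z4 z5 z6]] /andP[as_ sb].
pose k := a + b.
pose M := Lower (fun t => - l10 L (k - t)) (fun t => - l21 L (k - t))
  (fun t => - l32 L (k - t)) (fun t => l20 L (k - t)) (fun t => l31 L (k - t))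
  (fun t => - l30 L (k - t)).
have ks : k - (k - s) = s by ring.
have FM : flow (k - x) a b M.
  split=> t /andP[h1 h2].
    have /cF[[? ? ?] [? ? ?]] : a <= k - t <= b by rewrite /k; lra.
    by split; split; rewrite /=; try (apply: ctN); exact: ct_refl.
  move=> tx; have /dF : a < k - t < b by rewrite /k; lra.
  have xt : k - t != x by apply: contraNneq tx => <-; apply/eqP; ring.
  move=> /(_ xt)[n [? [[d1 d2 d3] [d4 d5 d6]]]]; exists n; split=> //.
  move/dv_refl/dvN: d1 => d1; move/dv_refl/dvN: d2 => d2.
  move/dv_refl/dvN: d3 => d3; move/dv_refl: d4 => d4; move/dv_refl: d5 => d5.
  move/dv_refl/dvN: d6 => d6.
  by split; split => /=; [apply: dv_eq d1 _|apply: dv_eq d2 _|apply: dv_eq d3 _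
    |apply: dv_eq d4 _|apply: dv_eq d5 _|apply: dv_eq d6 _]; ring.
have ZM : lower_zero M a.
  have ka : k - a = b by rewrite /k; ring.
  by split; split; rewrite /= ka ?z1 ?z2 ?z3 ?z4 ?z5 ?z6 ?oppr0.
have /(flow_pos FM ZM) : a < k - s <= b by rewrite /k; lra.
rewrite /p12 /w023 /= ks !oppr_gt0 !mulrNN.
by move=> [[? ? ?] [? ? ? ? [? _ _]]]; split; split.
Qed.

End Flow.

(** * Minors of a moving frame and the LU factorization *)

Section Rows.
Context {R : realType}.
Implicit Types (a b t x : R).

(* Coordinates of a fixed covector in the moving frame. *)
Record row := Row { r0 : R -> R; r1 : R -> R; r2 : R -> R; r3 : R -> R }.

Record coef := Coef { k1 : R -> R; k2 : R -> R; k3 : R -> R }.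

Implicit Types (A B C D E : row) (c : coef).

Definition row_ct A t := [/\ ct (r0 A) t, ct (r1 A) t, ct (r2 A) t & ct (r3 A) t].

(** The Frenet equations e_0' = c_1 e_1, e_1' = c_2 e_2 - c_1 e_0, e_2' = c_3 e_3 - c_2 e_1, e_3' =
    - c_3 e_2, paired with a constant covector. *)
Definition row_dv c A t :=
  [/\ dv (r0 A) t (k1 c t * r1 A t),
      dv (r1 A) t (k2 c t * r2 A t - k1 c t * r0 A t),
      dv (r2 A) t (k3 c t * r3 A t - k2 c t * r1 A t) &
      dv (r3 A) t (- (k3 c t * r2 A t))].

Definition sol c x a b A :=
  (forall t, a <= t <= b -> row_ct A t) /\
  (forall t, a < t < b -> t != x -> row_dv c A t).

Definition posc c x a b := forall t, a < t < b -> t != x ->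
  [/\ 0 < k1 c t, 0 < k2 c t & 0 < k3 c t].

Lemma sol_sub c x a b a' b' A : a <= a' -> b' <= b -> sol c x a b A -> sol c x a' b' A.
Proof.
move=> aa bb [cA dA]; split=> t /andP[h1 h2].
  by apply: cA; rewrite (le_trans aa)// (le_trans h2).
by apply: dA; rewrite (le_lt_trans aa)// (lt_le_trans h2).
Qed.

Lemma posc_sub c x a b a' b' : a <= a' -> b' <= b -> posc c x a b -> posc c x a' b'.
Proof.
move=> aa bb h t /andP[h1 h2].
by apply: h; rewrite (le_lt_trans aa)// (lt_le_trans h2).
Qed.

Definition rcomb (y0 y1 y2 y3 : R) A B C D : row :=
  Row (fun t => y0 * r0 A t + y1 * r0 B t + y2 * r0 C t + y3 * r0 D t)
      (fun t => y0 * r1 A t + y1 * r1 B t + y2 * r1 C t + y3 * r1 D t)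
      (fun t => y0 * r2 A t + y1 * r2 B t + y2 * r2 C t + y3 * r2 D t)
      (fun t => y0 * r3 A t + y1 * r3 B t + y2 * r3 C t + y3 * r3 D t).

Lemma sol_rcomb c x a b y0 y1 y2 y3 A B C D :
  sol c x a b A -> sol c x a b B -> sol c x a b C -> sol c x a b D ->
  sol c x a b (rcomb y0 y1 y2 y3 A B C D).
Proof.
move=> [cA dA] [cB dB] [cC dC] [cD dD]; split=> t h.
  have [? ? ? ?] := cA t h; have [? ? ? ?] := cB t h.
  have [? ? ? ?] := cC t h; have [? ? ? ?] := cD t h.
  by split; rewrite /=; cts.
move=> tx; have [? ? ? ?] := dA t h tx; have [? ? ? ?] := dB t h tx.
have [? ? ? ?] := dC t h tx; have [? ? ? ?] := dD t h tx.
by split; rewrite /=; dvr.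
Qed.

(** Plücker coordinates: the indices name the columns of the minor, the arguments its rows. [det4]
    is expanded along the last column. *)
Definition w01 A B t := r0 A t * r1 B t - r1 A t * r0 B t.
Definition w02 A B t := r0 A t * r2 B t - r2 A t * r0 B t.
Definition w12 A B t := r1 A t * r2 B t - r2 A t * r1 B t.
Definition w03 A B t := r0 A t * r3 B t - r3 A t * r0 B t.
Definition w13 A B t := r1 A t * r3 B t - r3 A t * r1 B t.
Definition W012 A B C t :=
  r0 A t * w12 B C t - r1 A t * w02 B C t + r2 A t * w01 B C t.
Definition W013 A B C t :=
  r0 A t * w13 B C t - r1 A t * w03 B C t + r3 A t * w01 B C t.
Definition det4 A B C D t :=
  r3 D t * W012 A B C t - r3 C t * W012 A B D t +
  r3 B t * W012 A C D t - r3 A t * W012 B C D t.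

Lemma w01_ct A B t : row_ct A t -> row_ct B t -> ct (w01 A B) t.
Proof. by move=> [? ? ? ?] [? ? ? ?]; rewrite /w01; cts. Qed.

Lemma W012_ct A B C t : row_ct A t -> row_ct B t -> row_ct C t -> ct (W012 A B C) t.
Proof.
move=> [? ? ? ?] [? ? ? ?] [? ? ? ?].
by rewrite /W012 /w12 /w02 /w01; cts.
Qed.

Lemma w01_dv c A B t : row_dv c A t -> row_dv c B t -> dv (w01 A B) t (k2 c t * w02 A B t).
Proof. by move=> [? ? ? ?] [? ? ? ?]; rewrite /w01 /w02; dvr. Qed.

Lemma W012_dv c A B C t : row_dv c A t -> row_dv c B t -> row_dv c C t ->
  dv (W012 A B C) t (k3 c t * W013 A B C t).
Proof.
move=> [? ? ? ?] [? ? ? ?] [? ? ? ?].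
by rewrite /W012 /W013 /w12 /w02 /w01 /w13 /w03; dvr.
Qed.

(** Entries of the unipotent lower factor of the matrix with rows A, B, C, D, as quotients of minors
    by its leading minors. *)
Definition LU A B C D : lower := Lower
  (fun t => r0 B t / r0 A t) (fun t => w01 A C t / w01 A B t)
  (fun t => W012 A B D t / W012 A B C t)
  (fun t => r0 C t / r0 A t) (fun t => w01 A D t / w01 A B t)
  (fun t => r0 D t / r0 A t).

Definition leading A B C D t :=
  [/\ 0 < r0 A t, 0 < w01 A B t, 0 < W012 A B C t & 0 < det4 A B C D t].

(** If M = L U and M' = M K with K tridiagonal, then L^-1 L' is the strictly lower part of U K U^-1.
    It lives on the subdiagonal, with entries c_i d_(i-1) d_(i+1) / d_i^2, where d_i is the i-th
    leading minor and d_0 = 1. *)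
Lemma LU_flow c x a b A B C D : posc c x a b ->
  sol c x a b A -> sol c x a b B -> sol c x a b C -> sol c x a b D ->
  (forall t, a <= t <= b -> leading A B C D t) -> flow x a b (LU A B C D).
Proof.
move=> pc [cA dA] [cB dB] [cC dC] [cD dD] ld; split=> t h.
  have [p1 p2 p3 p4] := ld t h.
  have [*] := cA t h; have [*] := cB t h.
  have [*] := cC t h; have [*] := cD t h.
  split; split; rewrite /=; apply: ct_div => //; rewrite ?(gt_eqF p1) ?(gt_eqF p2)
    ?(gt_eqF p3) //; do ?[apply: w01_ct | apply: W012_ct]; by split.
move=> tx; have [p1 p2 p3 p4] : leading A B C D t.
  by apply: ld; case/andP: h => ? ?; rewrite !ltW.
have [q1 q2 q3] := pc t h tx.
have n1 : r0 A t != 0 by rewrite gt_eqF.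
have n2 : w01 A B t != 0 by rewrite gt_eqF.
have n3 : W012 A B C t != 0 by rewrite gt_eqF.
have hA := dA t h tx; have hB := dB t h tx.
have hC := dC t h tx; have hD := dD t h tx.
have dAB := w01_dv hA hB; have dAC := w01_dv hA hC; have dAD := w01_dv hA hD.
have dABC := W012_dv hA hB hC; have dABD := W012_dv hA hB hD.
move: (hA) (hB) (hC) (hD) => [A0 _ _ _] [B0 _ _ _] [C0 _ _ _] [D0 _ _ _].
exists (k1 c t * w01 A B t / r0 A t ^+ 2,
  k2 c t * r0 A t * W012 A B C t / w01 A B t ^+ 2,
  k3 c t * w01 A B t * det4 A B C D t / W012 A B C t ^+ 2) => /=.
split; first by split; rewrite !(mulr_gt0, invr_gt0, exprn_gt0).
split; split.
- by apply: dv_eq (dv_div n1 B0 A0) _; rewrite /w01; field.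
- apply: dv_eq (dv_div n2 dAC dAB) _; congr (_ / _).
  by rewrite /W012 /w01 /w02 /w12; ring.
- apply: dv_eq (dv_div n3 dABD dABC) _; congr (_ / _).
  by rewrite /det4 /W013 /W012 /w01 /w02 /w12 /w03 /w13; ring.
- apply: dv_eq (dv_div n1 C0 A0) _; move: n2; rewrite /w01 => n2; field.
  by rewrite n1 n2.
- apply: dv_eq (dv_div n2 dAD dAB) _.
  have -> : k2 c t * w02 A D t * w01 A B t - w01 A D t * (k2 c t * w02 A B t) =
    k2 c t * r0 A t * W012 A B D t by rewrite /W012 /w01 /w02 /w12; ring.
  by field; rewrite n2 n3.
- apply: dv_eq (dv_div n1 D0 A0) _; move: n2; rewrite /w01 => n2; field.
  by rewrite n1 n2.
Qed.

(** A minor of L U in the first k columns is the same minor of L times the k-th leading minor. *)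
Lemma LU_minors A B C D t : leading A B C D t ->
  [/\ w01 A C t = w01 A B t * l21 (LU A B C D) t,
      w01 A D t = w01 A B t * l31 (LU A B C D) t,
      w01 B C t = w01 A B t * p12 (LU A B C D) t &
      w01 C D t = w01 A B t * p23 (LU A B C D) t] /\
  [/\ W012 A B D t = W012 A B C t * l32 (LU A B C D) t,
      W012 A C D t = W012 A B C t * w023 (LU A B C D) t &
      W012 B C D t = W012 A B C t * w123 (LU A B C D) t].
Proof.
move=> [p1 p2 p3 _].
have n1 : r0 A t != 0 by rewrite gt_eqF.
have n2 : w01 A B t != 0 by rewrite gt_eqF.
have n3 : W012 A B C t != 0 by rewrite gt_eqF.
rewrite /p12 /p23 /w123 /w023 /=; split; split.
- by field.
- by field.
- by move: n2; rewrite /w01 => n2; field; rewrite n1 n2.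
- by move: n2; rewrite /w01 => n2; field; rewrite n1 n2.
- by field.
- by move: n2 n3; rewrite /W012 /w12 /w02 /w01 => n2 n3; field; rewrite n2 n3.
- move: n2 n3; rewrite /W012 /w12 /w02 /w01 => n2 n3; field.
  by rewrite n1 n2 n3.
Qed.

Definition upper A B C D t :=
  [/\ r0 B t = 0, r0 C t = 0 & r0 D t = 0] /\
  [/\ r1 C t = 0, r1 D t = 0 & r2 D t = 0].

Lemma LU_zero A B C D t : upper A B C D t -> lower_zero (LU A B C D) t.
Proof.
move=> [[h1 h2 h3] [h4 h5 h6]].
by split; split; rewrite /= /W012 /w01 /w02 /w12 ?h1 ?h2 ?h3 ?h4 ?h5 ?h6; ring.
Qed.

Lemma rows_pos c x a b A B C D s : posc c x a b ->
  sol c x a b A -> sol c x a b B -> sol c x a b C -> sol c x a b D ->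
  (forall t, a <= t <= b -> leading A B C D t) -> upper A B C D a ->
  a < s <= b -> [/\ 0 < r0 D s, 0 < w01 C D s & 0 < W012 B C D s].
Proof.
move=> pc sA sB sC sD ld up sab.
have F := LU_flow pc sA sB sC sD ld.
have [_ [_ _ h30 _ [_ h23 h123]]] := flow_pos F (LU_zero up) sab.
have lds : leading A B C D s by apply: ld; case/andP: sab => /ltW -> ->.
have [[_ _ _ ->] [_ _ ->]] := LU_minors lds.
have [p1 p2 p3 _] := lds.
split; rewrite ?mulr_gt0//.
by move: h30; rewrite /= pmulr_lgt0// invr_gt0.
Qed.

Lemma rows_neg c x a b A B C D s : posc c x a b ->
  sol c x a b A -> sol c x a b B -> sol c x a b C -> sol c x a b D ->
  (forall t, a <= t <= b -> leading A B C D t) -> upper A B C D b ->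
  a <= s < b ->
  [/\ r0 D s < 0, 0 < r0 C s & w01 A C s < 0] /\
  [/\ 0 < w01 A D s, 0 < w01 B C s & 0 < W012 A C D s].
Proof.
move=> pc sA sB sC sD ld up sab.
have F := LU_flow pc sA sB sC sD ld.
have [[h10 h21 h32] [h20 h31 h30 h12 h023]] := flow_neg F (LU_zero up) sab.
have lds : leading A B C D s by apply: ld; case/andP: sab => -> /ltW ->.
have [[-> -> -> _] [_ -> _]] := LU_minors lds.
have [p1 p2 p3 _] := lds.
split; split.
- by move: h30; rewrite /= pmulr_llt0// invr_gt0.
- by move: h20; rewrite /= pmulr_lgt0// invr_gt0.
- by rewrite pmulr_rlt0.
- by rewrite mulr_gt0.
- by rewrite mulr_gt0.
- by rewrite mulr_gt0.
Qed.

End Rows.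

(** * Counting zeros along a chain of derivatives *)

Section Chain.
Context {R : realType}.
Implicit Types (F : nat -> R -> R) (n : nat) (t : R) (s : seq R).

(** Length of the initial run of zeros in F 0 t, ..., F n t, hence at most n + 1; it stands for the
    order of vanishing of [F 0] at t. *)
Fixpoint mult F n t : nat :=
  if F 0%N t == 0 then (if n is n'.+1 then mult (fun k => F k.+1) n' t else 0).+1
  else 0%N.

(** The factor between the derivative of [F k] and [F k.+1] is left existential because Rolle's
    argument uses only its sign. The last clause excludes zeros of infinite order. *)
Definition chain F n :=
  [/\ forall k t, (k < n)%N -> 0 < t < 1 -> exists2 d, dv (F k) t (d * F k.+1 t) & 0 < d,
      exists c, forall t, 0 < t < 1 -> F n t = c &
      forall t, 0 < t < 1 -> exists2 k, (k <= n)%N & F k t != 0].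

Lemma multS F n t : mult F n.+1 t =
  if F 0%N t == 0 then (mult (fun k => F k.+1) n t).+1 else 0%N.
Proof. by []. Qed.

Lemma mult_trunc F n t k : (k <= n)%N -> F k t != 0 -> mult F n.+1 t = mult F n t.
Proof.
elim: n F k => [|n IH] F k.
  by rewrite leqn0 => /eqP-> /negbTE h; rewrite /= h.
case: k => [_ /negbTE h|k kn h]; first by rewrite /= h.
by rewrite (multS F n.+1) (multS F n) (IH _ k).
Qed.

(** A vanishing last term makes the previous one constant, so the chain may stop one step
    earlier. *)
Lemma chain_trunc F n : chain F n.+1 -> (forall t, 0 < t < 1 -> F n.+1 t = 0) -> chain F n.
Proof.
move=> [dF _ nF] z; split.
- by move=> k t kn; apply: dF; rewrite ltnS ltnW.
- exists (F n (1 / 2)) => t t01; have dF0 u : 0 < u < 1 -> dv (F n) u 0.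
    by move=> u01; have [d + _] := dF n u (ltnSn n) u01; rewrite z// mulr0.
  have main a b : 0 < a < 1 -> 0 < b < 1 -> a <= b -> F n a = F n b.
    move=> /andP[a0 a1] /andP[b0 b1] ab; apply: (@dv_const R (F n)) => // u /andP[h1 h2].
      by apply: dv_ct (dF0 u _); rewrite (lt_le_trans a0)// (le_lt_trans h2).
    by apply: dF0; rewrite (lt_trans a0)// (lt_trans h2).
  have h : 0 < (1 / 2 : R) < 1 by lra.
  by have [|/ltW] := leP t (1 / 2) => ?; [|apply/esym]; exact: main.
- move=> t t01; have [k kn Fk] := nF t t01; exists k => //.
  by move: kn; rewrite leq_eqVlt => /predU1P[E|//]; rewrite E z ?eqxx in Fk.
Qed.

Lemma chain_shift F n c : chain F n.+1 -> c != 0 -> (forall t, 0 < t < 1 -> F n.+1 t = c) ->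
  chain (fun k => F k.+1) n.
Proof.
move=> [dF cF nF] c0 z; split => // [k t kn|t t01]; first exact: dF.
by exists n => //; rewrite z.
Qed.

Lemma chain_rolle F n (x y : R) : chain F n.+1 -> 0 < x -> x < y -> y < 1 ->
  F 0%N x = 0 -> F 0%N y = 0 -> exists2 u, x < u < y & F 1%N u = 0.
Proof.
move=> [dF _ _] x0 xy y1 Fx Fy.
have dF0 u : x <= u <= y -> exists2 d, dv (F 0%N) u (d * F 1%N u) & 0 < d.
  by move=> /andP[h1 h2]; apply: dF => //; rewrite (lt_le_trans x0)// (le_lt_trans h2).
have [| |u] := @Rolle R (F 0%N) x y xy _ _ (etrans Fx (esym Fy)).
- move=> u; rewrite in_itv /= => /andP[h1 h2].
  by have [|d []] := dF0 u _; first by rewrite !ltW.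
- by apply: ct_itv => u /dF0[d /dv_ct].
- rewrite in_itv /= => /andP[h1 h2] du; exists u; first by rewrite h1.
  have [|d dF1 d0] := dF0 u _; first by rewrite !ltW.
  by have /eqP := dv_uniq dF1 du; rewrite mulf_eq0 gt_eqF//= => /eqP.
Qed.

(** Each listed zero loses one unit of multiplicity in the derived chain, while each gap between
    neighbours contains, by Rolle, a new zero that gives at least one unit back. So the total drops
    by at most one. *)
Lemma chain_interlace F n (x : R) s : chain F n.+1 -> sorted <%R (x :: s) ->
  all (fun t => (0 < t < 1) && (F 0%N t == 0)) (x :: s) ->
  exists2 s', sorted <%R (x :: s') && all (fun t => 0 < t < 1) (x :: s') &
   (\sum_(t <- x :: s) mult F n.+1 t <=
    (\sum_(t <- x :: s') mult (fun k => F k.+1) n t).+1)%N.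
Proof.
move=> cF; elim: s x => [|y s IH] x.
  move=> _ /= /andP[/andP[x01 Fx] _]; exists [::]; first by rewrite /= x01.
  by rewrite !big_seq1 /= Fx.
rewrite [sorted _ _]/= => /andP[xy ys]; rewrite [all _ _]/= => /andP[/andP[x01 Fx] ays].
have [s' /andP[srt al] le] := IH y ys ays.
have /andP[/andP[/andP[y0 y1] Fy] _] := ays.
have [u /andP[xu uy] Fu] :=
  chain_rolle cF (proj1 (andP x01)) xy y1 (eqP Fx) (eqP Fy).
exists (u :: y :: s').
  rewrite /= xu uy x01 (lt_trans (proj1 (andP x01)) xu) (lt_trans uy y1) y0 y1 /=.
  by move: srt al => /= -> /andP[_ ->].
rewrite big_cons [X in (_ <= X.+1)%N]big_cons [X in (_ <= (_ + X).+1)%N]big_cons.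
rewrite (multS F n x) Fx.
have : (0 < mult (fun k => F k.+1) n u)%N.
  by case: (n) => [|n'] /=; rewrite Fu eqxx.
move: le; rewrite -/(mult _ _ _) => le mu.
rewrite !addSn ltnS leq_add2l; apply: (leq_trans le); rewrite -add1n.
by rewrite leq_add2r.
Qed.

Lemma chain_bound F n s : chain F n -> sorted <%R s -> all (fun t => 0 < t < 1) s ->
  (\sum_(t <- s) mult F n t <= n)%N.
Proof.
elim: n F s => [|n IH] F s cF srt al.
  case: cF => _ _ nF; rewrite big_seq big1// => t /(allP al)/nF[k].
  by rewrite leqn0 => /eqP-> /negbTE /= ->.
have [_ [c cE] nF] := cF; have [c0|c0] := eqVneq c 0.
  have z t : 0 < t < 1 -> F n.+1 t = 0 by move=> t01; rewrite cE.
  have cF' := chain_trunc cF z; rewrite (@leq_trans n)//.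
  rewrite (_ : \sum_(t <- s) _ = \sum_(t <- s) mult F n t)%N; first exact: IH.
  apply: eq_big_seq => t /(allP al) t01.
  by case: cF' => _ _ /(_ t t01)[k kn]; exact: mult_trunc.
have cF' := chain_shift cF c0 cE.
(* Points where [F 0] does not vanish contribute nothing; they are dropped because interlacing needs
   a list of zeros. *)
rewrite (bigID (fun t => F 0%N t == 0)) /= [X in (_ + X)%N]big1 ?addn0; last first.
  by move=> t /negbTE ->.
rewrite -big_filter; set s1 := [seq _ <- _ | _].
have srt1 : sorted <%R s1 by apply: sorted_filter => //; exact: lt_trans.
have al1 : all (fun t => (0 < t < 1) && (F 0%N t == 0)) s1.
  by apply/allP => t; rewrite mem_filter => /andP[-> /(allP al) ->].
case: s1 srt1 al1 => [|x s1] srt1 al1; first by rewrite big_nil.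
have [s' /andP[srt' al'] le] := chain_interlace cF srt1 al1.
by apply: (leq_trans le); rewrite ltnS; exact: IH.
Qed.

(** A duplicate-free list of points of Z of maximal length already exhausts Z. *)
Lemma finite_enum (Z : R -> Prop) n :
  (forall s, uniq s -> (forall t, t \in s -> Z t) -> (size s <= n)%N) ->
  exists2 s, uniq s & forall t, t \in s <-> Z t.
Proof.
move=> bd; pose P k := `[< exists s, [/\ uniq s, forall t, t \in s -> Z t & size s = k] >].
have [|k|k /asboolP[s [us sZ sk]] kmax] := @ex_maxnP P n.
- by exists 0%N; apply/asboolP; exists [::].
- by move=> /asboolP[s [us sZ <-]]; exact: bd.
exists s => // t; split; first exact: sZ.
move=> Zt; apply: contrapT => /negP ts.
have /kmax : P k.+1.
  apply/asboolP; exists (t :: s); split=> /=; rewrite ?ts ?sk//.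
  by move=> u; rewrite inE => /predU1P[->|/sZ].
by rewrite ltnn.
Qed.

Lemma mult_gt0 F n t : F 0%N t = 0 -> (0 < mult F n t)%N.
Proof. by move=> F0; case: n => [|n] /=; rewrite F0 eqxx. Qed.

Lemma mult_zero F n t j : (j < mult F n t)%N -> F j t = 0.
Proof.
elim: n F j => [|n IH] F j /=; case: eqP => // F0.
  by rewrite ltnS leqn0 => /eqP->.
by case: j => [//|j]; rewrite ltnS => /IH.
Qed.

Lemma mult_neq0 F n t : (exists2 k, (k <= n)%N & F k t != 0) ->
  F (mult F n t) t != 0 /\ (mult F n t <= n)%N.
Proof.
elim: n F => [|n IH] F [k kn Fk].
  by move: kn Fk; rewrite leqn0 => /eqP-> Fk; rewrite /= (negbTE Fk).
rewrite multS; have [F0|F0] := eqVneq (F 0%N t) 0; last by [].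
case: k kn Fk => [|k] kn Fk; first by rewrite F0 eqxx in Fk.
by have [] := IH (fun k => F k.+1) (ex_intro2 _ _ k kn Fk).
Qed.

Lemma chain_count F n : chain F n -> exists s,
  [/\ uniq s, forall t, (t \in s) <-> (0 < t < 1 /\ F 0%N t = 0) &
      (\sum_(t <- s) mult F n t <= n)%N].
Proof.
move=> cF.
have bd s : uniq s -> (forall t, t \in s -> 0 < t < 1 /\ F 0%N t = 0) ->
    (\sum_(t <- s) mult F n t <= n)%N.
  move=> us sZ; rewrite -(perm_big _ (permEl (perm_sort <=%R s))).
  apply: chain_bound => //.
    by rewrite lt_sorted_uniq_le sort_uniq us sort_le_sorted.
  by apply/allP => t; rewrite mem_sort => /sZ[].
have [|s us sE] := @finite_enum (fun t => 0 < t < 1 /\ F 0%N t = 0) n.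
  move=> s us sZ; apply: (leq_trans _ (bd s us sZ)).
  rewrite -sum1_size big_seq [X in (_ <= X)%N]big_seq; apply: leq_sum => t /sZ[_ F0].
  exact: mult_gt0.
exists s; split => //; apply: bd => // t /sE //.
Qed.

(** The chain and the successive derivatives of the linear form differ by a triangular change, so
    they need to vanish together only once all lower terms vanish. *)
Lemma convex_of_chain n (g : R -> 'cV[R]_n.+1) (a : 'cV[R]_n.+1) F :
  chain F n ->
  (forall t j, 0 < t < 1 -> (j <= n)%N -> (forall i, (i < j)%N -> F i t = 0) ->
    (F j t == 0) = (dot a (derive01n j g t) == 0)) ->
  exists (s : seq R) (m : R -> nat),
      [/\ uniq s,
          forall t, (t \in s) <-> (0 < t < 1 /\ dot a (g t) = 0),
          forall t, t \in s -> contact a g t (m t)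
        & (\sum_(t <- s) m t <= n)%N].
Proof.
move=> cF E; have [s [us sE sn]] := chain_count cF.
exists s, (mult F n); split => //.
  move=> t; rewrite sE; split => -[t01 h]; split => //; apply/eqP; move/eqP: h;
  by rewrite (E t 0%N).
move=> t /sE[t01 F0]; have [_ _ /(_ t t01) nz] := cF.
have [Fm mn] := mult_neq0 nz.
have z j : (j < mult F n t)%N -> F j t = 0 by exact: mult_zero.
split; first exact: mult_gt0.
- move=> j jm; apply/eqP; rewrite -E ?z ?eqxx//; first exact/ltnW/(leq_trans jm).
  by move=> i ij; apply: z; exact: ltn_trans jm.
- by rewrite -E.
Qed.

End Chain.

(** * Chains of Wronskian quotients *)

Section Wronskians.
Context {R : realType}.
Implicit Types (t : R) (A B C D J K : @row R) (c : @coef R).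

Lemma det4_dv c A B C D t : row_dv c A t -> row_dv c B t -> row_dv c C t ->
  row_dv c D t -> dv (det4 A B C D) t 0.
Proof.
move=> [? ? ? ?] [? ? ? ?] [? ? ? ?] [? ? ? ?].
by rewrite /det4 /W012 /w12 /w02 /w01; dvr.
Qed.

Lemma constant01 (f : R -> R) : (forall t, 0 < t < 1 -> dv f t 0) ->
  exists y : R, forall t, 0 < t < 1 -> f t = y.
Proof.
move=> df; exists (f (1 / 2)) => t t01.
have main a b : 0 < a < 1 -> 0 < b < 1 -> a <= b -> f a = f b.
  move=> /andP[a0 a1] /andP[b0 b1] ab; apply: dv_const => // u /andP[h1 h2].
    by apply: dv_ct (df u _); rewrite (lt_le_trans a0)// (le_lt_trans h2).
  by apply: df; rewrite (lt_trans a0)// (lt_trans h2).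
have h : 0 < (1 / 2 : R) < 1 by lra.
by have [|/ltW] := leP t (1 / 2) => ?; [|apply/esym]; exact: main.
Qed.

(** The Polya factorization of the Frenet system along the solutions D, C, B, applied to A. The
    order of the arguments in each numerator is the one for which consecutive terms are related by a
    positive factor. *)
Definition wchain4 A B C D (k : nat) (t : R) : R :=
  match k with
  | 0%N => r0 A t / r0 D t
  | 1%N => w01 D A t / w01 C D t
  | 2%N => W012 A C D t / W012 B C D t
  | _ => det4 C D B A t
  end.

(** Once the coordinates of A before the j-th vanish, the j-th numerator is the j-th coordinate of A
    times one of the positive minors of B, C, D. *)
Lemma wchain4_eq0 A B C D t j : (j <= 3)%N ->
  0 < r0 D t -> 0 < w01 C D t -> 0 < W012 B C D t ->
  (forall i, (i < j)%N -> wchain4 A B C D i t = 0) ->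
  (wchain4 A B C D j t == 0) = (nth 0 [:: r0 A t; r1 A t; r2 A t; r3 A t] j == 0) /\
  (forall i, (i < j)%N -> nth 0 [:: r0 A t; r1 A t; r2 A t; r3 A t] i = 0).
Proof.
move=> j3 D0 w0 W0.
have nD : r0 D t != 0 by rewrite gt_eqF.
have nw : w01 C D t != 0 by rewrite gt_eqF.
have nW : W012 B C D t != 0 by rewrite gt_eqF.
have e0 : (wchain4 A B C D 0 t == 0) = (r0 A t == 0).
  by rewrite /= mulf_eq0 invr_eq0 (negbTE nD) orbF.
have e1 : r0 A t = 0 -> (wchain4 A B C D 1 t == 0) = (r1 A t == 0).
  move=> A0; rewrite /= mulf_eq0 invr_eq0 (negbTE nw) orbF /w01 A0 mulr0 subr0.
  by rewrite mulf_eq0 (negbTE nD).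
have e2 : r0 A t = 0 -> r1 A t = 0 -> (wchain4 A B C D 2 t == 0) = (r2 A t == 0).
  move=> A0 A1; rewrite /= mulf_eq0 invr_eq0 (negbTE nW) orbF /W012 A0 A1 !mul0r.
  by rewrite subr0 add0r mulf_eq0 (negbTE nw) orbF.
have e3 : r0 A t = 0 -> r1 A t = 0 -> r2 A t = 0 ->
    (wchain4 A B C D 3 t == 0) = (r3 A t == 0).
  move=> A0 A1 A2; have -> : wchain4 A B C D 3 t = r3 A t * W012 B C D t.
    by rewrite /= /det4 /W012 /w01 /w02 /w12 A0 A1 A2; ring.
  by rewrite mulf_eq0 (negbTE nW) orbF.
case: j j3 => [|[|[|[|//]]]] _ z.
- by split.
- have A0 : r0 A t = 0 by apply/eqP; rewrite -e0 z.
  by split=> [|[|//]]; first exact: e1.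
- have A0 : r0 A t = 0 by apply/eqP; rewrite -e0 z.
  have A1 : r1 A t = 0 by apply/eqP; rewrite -e1// z.
  by split=> [|[|[|//]]]; first exact: e2.
- have A0 : r0 A t = 0 by apply/eqP; rewrite -e0 z.
  have A1 : r1 A t = 0 by apply/eqP; rewrite -e1// z.
  have A2 : r2 A t = 0 by apply/eqP; rewrite -e2// z.
  by split=> [|[|[|[|//]]]]; first exact: e3.
Qed.

Lemma wchain4_chain c x A B C D : x <= 0 -> posc c x 0 1 ->
  sol c x 0 1 A -> sol c x 0 1 B -> sol c x 0 1 C -> sol c x 0 1 D ->
  (forall t, 0 < t < 1 -> [/\ 0 < r0 D t, 0 < w01 C D t & 0 < W012 B C D t]) ->
  (forall t, 0 < t < 1 -> [|| r0 A t != 0, r1 A t != 0, r2 A t != 0 | r3 A t != 0]) ->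
  chain (wchain4 A B C D) 3.
Proof.
move=> x0 pc [_ sA] [_ sB] [_ sC] [_ sD] pos nz.
have tx t : 0 < t < 1 -> t != x.
  by move=> /andP[t0 _]; rewrite gt_eqF// (le_lt_trans x0).
split.
- move=> k t k3 t01; have [p1 p2 p3] := pos t t01.
  have [q1 q2 q3] := pc t t01 (tx t t01).
  have hA := sA t t01 (tx t t01); have hB := sB t t01 (tx t t01).
  have hC := sC t t01 (tx t t01); have hD := sD t t01 (tx t t01).
  have nD : r0 D t != 0 by rewrite gt_eqF.
  have nw : w01 C D t != 0 by rewrite gt_eqF.
  have nW : W012 B C D t != 0 by rewrite gt_eqF.
  case: k k3 => [|[|[|//]]] _.
  + exists (k1 c t * w01 C D t / r0 D t ^+ 2); last first.
      by rewrite !(mulr_gt0, invr_gt0, exprn_gt0).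
    case: hA hD => [a0 _ _ _] [d0 _ _ _].
    apply: dv_eq (dv_div nD a0 d0) _ => /=; move: nw; rewrite /w01 => nw.
    by field; rewrite nD nw.
  + exists (k2 c t * r0 D t * W012 B C D t / w01 C D t ^+ 2); last first.
      by rewrite !(mulr_gt0, invr_gt0, exprn_gt0).
    apply: dv_eq (dv_div nw (w01_dv hD hA) (w01_dv hC hD)) _ => /=.
    have -> : k2 c t * w02 D A t * w01 C D t - w01 D A t * (k2 c t * w02 C D t) =
      k2 c t * r0 D t * W012 A C D t by rewrite /W012 /w01 /w02 /w12; ring.
    by field; rewrite nw nW.
  + exists (k3 c t * w01 C D t / W012 B C D t ^+ 2); last first.
      by rewrite !(mulr_gt0, invr_gt0, exprn_gt0).
    apply: dv_eq (dv_div nW (W012_dv hA hC hD) (W012_dv hB hC hD)) _ => /=.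
    rewrite [RHS]mulrAC; congr (_ / _).
    by rewrite /det4 /W013 /W012 /w01 /w02 /w12 /w03 /w13; ring.
- apply: (@constant01 (wchain4 A B C D 3)) => t t01.
  have tx' := tx t t01; rewrite /=; apply: det4_dv; [exact: sC|exact: sD|exact: sB|exact: sA].
- move=> t t01; have [p1 p2 p3] := pos t t01.
  apply: contrapT => /forall2NP h.
  have z k : (k <= 3)%N -> wchain4 A B C D k t = 0.
    by move=> k3; have [//|/negP] := h k; rewrite negbK => /eqP.
  have [e e'] := @wchain4_eq0 A B C D t 3 isT p1 p2 p3 (fun i i3 => z i (ltnW i3)).
  have := nz t t01; rewrite (e' 0%N isT : r0 A t = 0) (e' 1%N isT : r1 A t = 0).
  rewrite (e' 2%N isT : r2 A t = 0) eqxx /=.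
  by move: e; rewrite z// eqxx /= => <-.
Qed.

Definition row_dv3 (q p : R -> R) A t :=
  [/\ dv (r0 A) t (q t * r1 A t), dv (r1 A) t (p t * r2 A t - q t * r0 A t) &
      dv (r2 A) t (- (p t * r1 A t))].

Lemma w01_dv3 q p A B t : row_dv3 q p A t -> row_dv3 q p B t ->
  dv (w01 A B) t (p t * w02 A B t).
Proof. by move=> [? ? ?] [? ? ?]; rewrite /w01 /w02; dvr. Qed.

Lemma W012_dv3 q p A B C t : row_dv3 q p A t -> row_dv3 q p B t ->
  row_dv3 q p C t -> dv (W012 A B C) t 0.
Proof.
move=> [? ? ?] [? ? ?] [? ? ?].
by rewrite /W012 /w12 /w02 /w01; dvr.
Qed.

Definition wchain3 A C D (k : nat) (t : R) : R :=
  match k with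
  | 0%N => r0 A t / r0 D t
  | 1%N => w01 D A t / w01 C D t
  | _ => W012 A C D t
  end.

Lemma wchain3_eq0 A C D t j : (j <= 2)%N ->
  0 < r0 D t -> 0 < w01 C D t ->
  (forall i, (i < j)%N -> wchain3 A C D i t = 0) ->
  (wchain3 A C D j t == 0) = (nth 0 [:: r0 A t; r1 A t; r2 A t] j == 0) /\
  (forall i, (i < j)%N -> nth 0 [:: r0 A t; r1 A t; r2 A t] i = 0).
Proof.
move=> j3 D0 w0.
have nD : r0 D t != 0 by rewrite gt_eqF.
have nw : w01 C D t != 0 by rewrite gt_eqF.
have e0 : (wchain3 A C D 0 t == 0) = (r0 A t == 0).
  by rewrite /= mulf_eq0 invr_eq0 (negbTE nD) orbF.
have e1 : r0 A t = 0 -> (wchain3 A C D 1 t == 0) = (r1 A t == 0).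
  move=> A0; rewrite /= mulf_eq0 invr_eq0 (negbTE nw) orbF /w01 A0 mulr0 subr0.
  by rewrite mulf_eq0 (negbTE nD).
have e2 : r0 A t = 0 -> r1 A t = 0 -> (wchain3 A C D 2 t == 0) = (r2 A t == 0).
  move=> A0 A1; rewrite /= /W012 A0 A1 !mul0r.
  by rewrite subr0 add0r mulf_eq0 (negbTE nw) orbF.
case: j j3 => [|[|[|//]]] _ z.
- by split.
- have A0 : r0 A t = 0 by apply/eqP; rewrite -e0 z.
  by split=> [|[|//]]; first exact: e1.
- have A0 : r0 A t = 0 by apply/eqP; rewrite -e0 z.
  have A1 : r1 A t = 0 by apply/eqP; rewrite -e1// z.
  by split=> [|[|[|//]]]; first exact: e2.
Qed.

Lemma wchain3_chain q p A C D : (forall t, 0 < t < 1 -> 0 < q t /\ 0 < p t) ->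
  (forall t, 0 < t < 1 -> [/\ row_dv3 q p A t, row_dv3 q p C t & row_dv3 q p D t]) ->
  (forall t, 0 < t < 1 -> 0 < r0 D t /\ 0 < w01 C D t) ->
  (forall t, 0 < t < 1 -> [|| r0 A t != 0, r1 A t != 0 | r2 A t != 0]) ->
  chain (wchain3 A C D) 2.
Proof.
move=> pc sol3 pos nz; split.
- move=> k t k3 t01; have [p1 p2] := pos t t01; have [q1 q2] := pc t t01.
  have [hA hC hD] := sol3 t t01.
  have nD : r0 D t != 0 by rewrite gt_eqF.
  have nw : w01 C D t != 0 by rewrite gt_eqF.
  case: k k3 => [|[|//]] _.
  + exists (q t * w01 C D t / r0 D t ^+ 2); last first.
      by rewrite !(mulr_gt0, invr_gt0, exprn_gt0).
    case: hA hD => [a0 _ _] [d0 _ _].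
    apply: dv_eq (dv_div nD a0 d0) _ => /=; move: nw; rewrite /w01 => nw.
    by field; rewrite nD nw.
  + exists (p t * r0 D t / w01 C D t ^+ 2); last first.
      by rewrite !(mulr_gt0, invr_gt0, exprn_gt0).
    apply: dv_eq (dv_div nw (w01_dv3 hD hA) (w01_dv3 hC hD)) _ => /=.
    rewrite [RHS]mulrAC; congr (_ / _).
    by rewrite /W012 /w01 /w02 /w12; ring.
- apply: (@constant01 (wchain3 A C D 2)) => t t01.
  by have [hA hC hD] := sol3 t t01; exact: W012_dv3 hA hC hD.
- move=> t t01; have [p1 p2] := pos t t01.
  apply: contrapT => /forall2NP h.
  have z k : (k <= 2)%N -> wchain3 A C D k t = 0.
    by move=> k3; have [//|/negP] := h k; rewrite negbK => /eqP.
  have [e e'] := @wchain3_eq0 A C D t 2 isT p1 p2 (fun i i3 => z i (ltnW i3)).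
  have := nz t t01; rewrite (e' 0%N isT : r0 A t = 0) (e' 1%N isT : r1 A t = 0).
  by rewrite eqxx /=; move: e; rewrite z// eqxx /= => <-.
Qed.

End Wronskians.

(** * Quaternionic frames *)

Section Quat.
Context {R : realType}.

Record quatn := Qn { qa : R; qb : R; qc : R; qd : R }.

Implicit Types z w : quatn.

Definition nrm z := qa z ^+ 2 + qb z ^+ 2 + qc z ^+ 2 + qd z ^+ 2.

(* [mulc z w] is the quaternion product of [z] and the conjugate of [w]. *)
Definition mulc z w := Qn
  (qa z * qa w + qb z * qb w + qc z * qc w + qd z * qd w)
  (qb z * qa w - qa z * qb w - qc z * qd w + qd z * qc w)
  (qc z * qa w - qa z * qc w + qb z * qd w - qd z * qb w)
  (qd z * qa w - qa z * qd w - qb z * qc w + qc z * qb w).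

Definition muli z := Qn (- qb z) (qa z) (qd z) (- qc z).
Definition mulj z := Qn (- qc z) (- qd z) (qa z) (qb z).
Definition mulk z := Qn (- qd z) (qc z) (- qb z) (qa z).

Definition comp (i : nat) z :=
  match i with 0%N => qa z | 1%N => qb z | 2%N => qc z | _ => qd z end.

(* Row [i] of the matrix whose columns are z w', z i w', z j w', z k w', where
   w' is the conjugate of w. *)
Definition qrow (i : nat) (z w : R -> quatn) : row := Row
  (fun t => comp i (mulc (z t) (w t))) (fun t => comp i (mulc (muli (z t)) (w t)))
  (fun t => comp i (mulc (mulj (z t)) (w t))) (fun t => comp i (mulc (mulk (z t)) (w t))).

Definition ctq {T : topologicalType} (z : T -> quatn) (t : T) :=
  [/\ ct (fun s => qa (z s)) t, ct (fun s => qb (z s)) t,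
      ct (fun s => qc (z s)) t & ct (fun s => qd (z s)) t].

Lemma mulc_ct (T : topologicalType) (f g : T -> quatn) t : ctq f t -> ctq g t ->
  ctq (fun s => mulc (f s) (g s)) t.
Proof. by move=> [? ? ? ?] [? ? ? ?]; split; rewrite /=; cts. Qed.

Lemma muli_ct (T : topologicalType) (f : T -> quatn) t : ctq f t ->
  ctq (fun s => muli (f s)) t.
Proof. by move=> [? ? ? ?]; split; rewrite /=; cts. Qed.

Lemma mulj_ct (T : topologicalType) (f : T -> quatn) t : ctq f t ->
  ctq (fun s => mulj (f s)) t.
Proof. by move=> [? ? ? ?]; split; rewrite /=; cts. Qed.

Lemma mulk_ct (T : topologicalType) (f : T -> quatn) t : ctq f t ->
  ctq (fun s => mulk (f s)) t.
Proof. by move=> [? ? ? ?]; split; rewrite /=; cts. Qed.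

Lemma comp_ct (T : topologicalType) i (f : T -> quatn) t : ctq f t ->
  ct (fun s => comp i (f s)) t.
Proof. by move=> [? ? ? ?]; case: i => [|[|[|]]]. Qed.

Lemma qrow_ct i (z w : R -> quatn) t : ctq z t -> ctq w t -> row_ct (qrow i z w) t.
Proof.
move=> hz hw; have hi := muli_ct hz; have hj := mulj_ct hz; have hk := mulk_ct hz.
by split; apply: comp_ct; apply: mulc_ct.
Qed.

Definition dvq (z : R -> quatn) (t : R) (d : quatn) :=
  [/\ dv (fun s => qa (z s)) t (qa d), dv (fun s => qb (z s)) t (qb d),
      dv (fun s => qc (z s)) t (qc d) & dv (fun s => qd (z s)) t (qd d)].

(* z (p i + q k) / 2 *)
Definition spin (p q : R) z := Qn
  (- (q * qd z + p * qb z) / 2) ((p * qa z + q * qc z) / 2)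
  ((p * qd z - q * qb z) / 2) ((q * qa z - p * qc z) / 2).

(** A column z h conj(w) has derivative z(v h - h v')conj(w) with v = (p i + q k)/2 and v' = (r i +
    q k)/2. The common k-part cancels for h = 1, k and doubles for h = i, j, which leaves exactly
    the Frenet form. *)
Lemma qrow_dv i (z w : R -> quatn) t (p q r : R) :
  dvq z t (spin p q (z t)) -> dvq w t (spin r q (w t)) ->
  row_dv (Coef (fun=> (p - r) / 2) (fun=> q) (fun=> (p + r) / 2)) (qrow i z w) t.
Proof.
move=> [? ? ? ?] [? ? ? ?]; have R2 : (2 : R) != 0 by rewrite pnatr_eq0.
by case: i => [|[|[|i]]]; split; rewrite /= ; (eapply dv_eq; [dvs|]); rewrite /=; field.
Qed.

(** The matrix is a rotation scaled so that M M^T = [nrm z * nrm w]; its cofactors are therefore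
    that number times its entries. The sign belongs to row 0 and column 3. *)
Lemma qrow_W012 z w : W012 (qrow 1 (fun=> z) (fun=> w)) (qrow 2 (fun=> z) (fun=> w))
   (qrow 3 (fun=> z) (fun=> w)) 0 = - qa (mulc (mulk z) w) * (nrm z * nrm w).
Proof. by rewrite /W012 /w01 /w02 /w12 /nrm /=; ring. Qed.

Definition gram (x y : quatn) := qa x * qa y + qb x * qb y + qc x * qc y + qd x * qd y.

Lemma gram_mulc x y w : gram (mulc x w) (mulc y w) = gram x y * nrm w.
Proof. by rewrite /gram /nrm /=; ring. Qed.

Lemma gram_frame z :
  [/\ gram z (muli z) = 0, gram z (mulj z) = 0 & gram z (mulk z) = 0] /\
  [/\ gram (muli z) (mulj z) = 0, gram (muli z) (mulk z) = 0 &
      gram (mulj z) (mulk z) = 0] /\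
  [/\ gram z z = nrm z, gram (muli z) (muli z) = nrm z,
      gram (mulj z) (mulj z) = nrm z & gram (mulk z) (mulk z) = nrm z].
Proof. by split; [|split]; split; rewrite /gram /nrm /=; ring. Qed.

Lemma qrow_gram i z w : (i <= 3)%N ->
  let A := qrow i (fun=> z) (fun=> w) in
  r0 A 0 ^+ 2 + r1 A 0 ^+ 2 + r2 A 0 ^+ 2 + r3 A 0 ^+ 2 = nrm z * nrm w.
Proof. by case: i => [|[|[|[|//]]]] _; rewrite /nrm /=; ring. Qed.

Definition qone' := Qn 1 0 0 0.
Definition qopp z := Qn (- qa z) (- qb z) (- qc z) (- qd z).

(* conj(k) w k *)
Definition mirror w := Qn (qa w) (- qb w) (- qc w) (qd w).

Lemma nrm_mirror w : nrm (mirror w) = nrm w.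
Proof. by rewrite /nrm /=; ring. Qed.

End Quat.

(** * Boundary contacts of the positive cone *)

Section Touch.
Context {R : realType}.
Implicit Types (s t x h : R) (E : @row R) (f : R -> R).

(** An explicit radius instead of a filter, so that sample points can be placed by linear
    arithmetic. *)
Definition nr t (P : R -> Prop) := exists2 h : R, 0 < h & forall s : R, t - h < s < t + h -> P s.

Lemma nr_ct f t : ct f t -> 0 < f t -> nr t (fun s => 0 < f s).
Proof.
move=> cf /(ct_pos cf)[h h0 H]; exists h => // s sh; apply: H.
by rewrite ltr_distl.
Qed.

Lemma nr_I t P Q : nr t P -> nr t Q -> nr t (fun s => P s /\ Q s).
Proof.
move=> [h h0 H] [k k0 K]; have [hk|kh] := leP h k.
  by exists h => // s sh; split; [exact: H|apply: K; lra].
by exists k => // s sh; split; [apply: H; lra|exact: K].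
Qed.

Lemma nr_imp t (P Q : R -> Prop) : (forall s, P s -> Q s) -> nr t P -> nr t Q.
Proof. by move=> PQ [h h0 H]; exists h => // s /H/PQ. Qed.

Lemma nr_itv t h : 0 < h -> nr t (fun s => t - h < s < t + h).
Proof. by move=> h0; exists h. Qed.

Lemma ct_le_left f t : ct f t -> nr t (fun s => s < t -> f s <= 0) -> f t <= 0.
Proof.
move=> cf fs; rewrite leNgt; apply/negP => /(nr_ct cf) fp.
have [h h0 H] := nr_I fs fp.
have /H[a b] : t - h < t - h / 2 < t + h by lra.
by have := a ltac:(lra); lra.
Qed.

Lemma ct_le_right f t : ct f t -> nr t (fun s => t < s -> f s <= 0) -> f t <= 0.
Proof.
move=> cf fs; rewrite leNgt; apply/negP => /(nr_ct cf) fp.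
have [h h0 H] := nr_I fs fp.
have /H[a b] : t - h < t + h / 2 < t + h by lra.
by have := a ltac:(lra); lra.
Qed.

Lemma nr_incr x f t : nr t (fun s => ct f s /\
    (s != x -> exists2 d, dv f s d & 0 < d)) ->
  nr t (fun s => (s < t -> f s < f t) /\ (t < s -> f t < f s)).
Proof.
move=> [h h0 H]; exists h => // s sh; split => st.
- apply: (@mono _ x) => // [u uh|u uh ux]; first by apply: (H u _).1; lra.
  by apply: (H u _).2 => //; lra.
- apply: (@mono _ x) => // [u uh|u uh ux]; first by apply: (H u _).1; lra.
  by apply: (H u _).2 => //; lra.
Qed.

Lemma nr_decr x f t : nr t (fun s => ct f s /\
    (s != x -> exists2 d, dv f s d & d < 0)) ->
  nr t (fun s => (s < t -> f t < f s) /\ (t < s -> f s < f t)).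
Proof.
move=> H; have : nr t (fun s => (s < t -> - f s < - f t) /\ (t < s -> - f t < - f s)).
  apply: (@nr_incr x (fun s => - f s)); apply: nr_imp H => s [cf H]; split; first exact: ctN.
  by move=> /H[d df d0]; exists (- d); [exact: dvN|rewrite oppr_gt0].
by apply: nr_imp => s; rewrite !ltrN2.
Qed.

Definition colprod (E0 E1 E2 E3 : @row R) (f g : @row R -> R -> R) t :=
  f E0 t * g E0 t + f E1 t * g E1 t + f E2 t * g E2 t + f E3 t * g E3 t.

Definition orthc (E0 E1 E2 E3 : @row R) t :=
  [/\ colprod E0 E1 E2 E3 r0 r0 t = 1, colprod E0 E1 E2 E3 r1 r1 t = 1,
      colprod E0 E1 E2 E3 r2 r2 t = 1 & colprod E0 E1 E2 E3 r3 r3 t = 1] /\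
  [/\ colprod E0 E1 E2 E3 r0 r1 t = 0, colprod E0 E1 E2 E3 r0 r2 t = 0 &
      colprod E0 E1 E2 E3 r0 r3 t = 0] /\
  [/\ colprod E0 E1 E2 E3 r1 r2 t = 0, colprod E0 E1 E2 E3 r1 r3 t = 0 &
      colprod E0 E1 E2 E3 r2 r3 t = 0].

Lemma qrow_orthc (z w : R -> @quatn R) t : nrm (z t) = 1 -> nrm (w t) = 1 ->
  orthc (qrow 0 z w) (qrow 1 z w) (qrow 2 z w) (qrow 3 z w) t.
Proof.
move=> nz nw.
have [[a1 a2 a3] [[b1 b2 b3] [c0 c1 c2 c3]]] := gram_frame (z t).
have H u v : gram (mulc u (w t)) (mulc v (w t)) = gram u v.
  by rewrite gram_mulc nw mulr1.
split; [|split]; split; rewrite /colprod /=.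
- by have := H (z t) (z t); rewrite c0 nz /gram.
- by have := H (muli (z t)) (muli (z t)); rewrite c1 nz /gram.
- by have := H (mulj (z t)) (mulj (z t)); rewrite c2 nz /gram.
- by have := H (mulk (z t)) (mulk (z t)); rewrite c3 nz /gram.
- by have := H (z t) (muli (z t)); rewrite a1 /gram.
- by have := H (z t) (mulj (z t)); rewrite a2 /gram.
- by have := H (z t) (mulk (z t)); rewrite a3 /gram.
- by have := H (muli (z t)) (mulj (z t)); rewrite b1 /gram.
- by have := H (muli (z t)) (mulk (z t)); rewrite b2 /gram.
- by have := H (mulj (z t)) (mulk (z t)); rewrite b3 /gram.
Qed.

(* The covector dual to a column of the frame at time [t]. *)
Definition atrow (E0 E1 E2 E3 : @row R) t (f : @row R -> R -> R) : row :=
  rcomb (f E0 t) (f E1 t) (f E2 t) (f E3 t) E0 E1 E2 E3.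

Lemma row_ct_rcomb t y0 y1 y2 y3 A B C D : row_ct A t -> row_ct B t ->
  row_ct C t -> row_ct D t -> row_ct (rcomb y0 y1 y2 y3 A B C D) t.
Proof.
by move=> [? ? ? ?] [? ? ? ?] [? ? ? ?] [? ? ? ?]; split; rewrite /=; cts.
Qed.

Lemma det4_ct A B C D t : row_ct A t -> row_ct B t -> row_ct C t -> row_ct D t ->
  ct (det4 A B C D) t.
Proof.
move=> [? ? ? ?] [? ? ? ?] [? ? ? ?] [? ? ? ?].
by rewrite /det4 /W012 /w12 /w02 /w01; cts.
Qed.

Lemma leading_near A B C D t : row_ct A t -> row_ct B t -> row_ct C t ->
  row_ct D t -> leading A B C D t -> nr t (leading A B C D).
Proof.
move=> cA cB cC cD [p1 p2 p3 p4].
have [a0 _ _ _] := cA.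
have h1 := nr_ct a0 p1; have h2 := nr_ct (w01_ct cA cB) p2.
have h3 := nr_ct (W012_ct cA cB cC) p3; have h4 := nr_ct (det4_ct cA cB cC cD) p4.
by apply: nr_imp (nr_I (nr_I h1 h2) (nr_I h3 h4)) => s [[? ?] [? ?]]; split.
Qed.

(** By orthonormality the four dual rows form the identity matrix at [t]; this is the initial
    condition for [rows_pos] and [rows_neg] on the two sides of [t]. *)
Lemma atrow_id E0 E1 E2 E3 t : orthc E0 E1 E2 E3 t ->
  let G := atrow E0 E1 E2 E3 t in
  upper (G r0) (G r1) (G r2) (G r3) t /\ leading (G r0) (G r1) (G r2) (G r3) t /\
  [/\ r0 (G r0) t = 1, r1 (G r0) t = 0 & r2 (G r0) t = 0].
Proof.
move=> [[e00 e11 e22 e33] [[e01 e02 e03] [e12 e13 e23]]] G.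
have h : [/\ r0 (G r0) t = 1, r1 (G r1) t = 1, r2 (G r2) t = 1 & r3 (G r3) t = 1].
  by split.
have h1 : [/\ r1 (G r0) t = 0, r2 (G r0) t = 0, r3 (G r0) t = 0 & r2 (G r1) t = 0] by split.
have h2 : r3 (G r1) t = 0 /\ r3 (G r2) t = 0 by split.
have h3 : upper (G r0) (G r1) (G r2) (G r3) t.
  split; split; rewrite /=.
  - by rewrite -[RHS]e01 /colprod; ring.
  - by rewrite -[RHS]e02 /colprod; ring.
  - by rewrite -[RHS]e03 /colprod; ring.
  - by rewrite -[RHS]e12 /colprod; ring.
  - by rewrite -[RHS]e13 /colprod; ring.
  - by rewrite -[RHS]e23 /colprod; ring.
split; first exact: h3.
split; last by case: h h1 => ? _ _ _ [? ? _ _]; split.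
case: h3 => -[u1 u2 u3] [u4 u5 u6]; case: h => a1 a2 a3 a4; case: h1 => b1 b2 b3 b4.
case: h2 => c1 c2.
rewrite /leading /det4 /W012 /w12 /w02 /w01 u1 u2 u3 u4 u5 u6 a1 a2 a3 a4 b1 b2 b3 b4 c1 c2.
by split; rewrite ?(mulr0, mul0r, subr0, addr0, mulr1, add0r) ltr01.
Qed.

Variables (c : @coef R) (x t h : R) (E0 E1 E2 E3 : @row R).
Hypotheses (h0 : 0 < h) (pc : posc c x (t - h) (t + h)).
Ltac hlra := have ? := h0; lra.
Hypotheses (s0 : sol c x (t - h) (t + h) E0) (s1 : sol c x (t - h) (t + h) E1).
Hypotheses (s2 : sol c x (t - h) (t + h) E2) (s3 : sol c x (t - h) (t + h) E3).
Hypothesis orth : orthc E0 E1 E2 E3 t.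

Let G := atrow E0 E1 E2 E3 t.

Let sG (f : @row R -> R -> R) : sol c x (t - h) (t + h) (G f).
Proof. exact: sol_rcomb. Qed.

Let tth : t - h <= t <= t + h.
Proof. by rewrite lerBlDr lerDl andbb ltW. Qed.

Let lead_near : nr t (leading (G r0) (G r1) (G r2) (G r3)).
Proof.
have [_ [ld _]] := atrow_id orth.
by apply: leading_near ld; apply: (sG _).1.
Qed.

Lemma frame_right : nr t (fun s => t < s ->
  [/\ 0 < r0 (G r3) s, 0 < w01 (G r2) (G r3) s & 0 < W012 (G r1) (G r2) (G r3) s]).
Proof.
have [up _] := atrow_id orth.
have [k k0 H] := nr_I lead_near (nr_itv t h0).
exists k => // s sk ts.
have hs : s <= t + h by have [_] := H s sk; hlra.
apply: (rows_pos (A := G r0) (c := c) (x := x) (a := t) (b := s)).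
- by apply: posc_sub pc; hlra.
- by apply: sol_sub (sG _); hlra.
- by apply: sol_sub (sG _); hlra.
- by apply: sol_sub (sG _); hlra.
- by apply: sol_sub (sG _); hlra.
- by move=> u us; apply: (H u _).1; hlra.
- exact: up.
- by rewrite ts lexx.
Qed.

Lemma frame_left : nr t (fun s => s < t ->
  [/\ r0 (G r3) s < 0, 0 < r0 (G r2) s & w01 (G r0) (G r2) s < 0] /\
  [/\ 0 < w01 (G r0) (G r3) s, 0 < w01 (G r1) (G r2) s &
      0 < W012 (G r0) (G r2) (G r3) s]).
Proof.
have [up _] := atrow_id orth.
have [k k0 H] := nr_I lead_near (nr_itv t h0).
exists k => // s sk ts.
have hs : t - h <= s by have [_] := H s sk; hlra.
apply: (rows_neg (A := G r0) (c := c) (x := x) (a := s) (b := t)).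
- by apply: posc_sub pc; hlra.
- by apply: sol_sub (sG _); hlra.
- by apply: sol_sub (sG _); hlra.
- by apply: sol_sub (sG _); hlra.
- by apply: sol_sub (sG _); hlra.
- by move=> u us; apply: (H u _).1; hlra.
- exact: up.
- by rewrite ts lexx.
Qed.

Hypothesis row3 : r0 E3 t ^+ 2 + r1 E3 t ^+ 2 + r2 E3 t ^+ 2 + r3 E3 t ^+ 2 = 1.
Hypothesis m1 : forall s, t - h < s < t + h -> 0 <= r0 E3 s /\ 0 <= w01 E2 E3 s.
Hypothesis m1l : forall s, t - h < s < t -> 0 < r0 E3 s.
Hypothesis m1t : r0 E3 t = 0.

Let near_ct A : sol c x (t - h) (t + h) A -> nr t (row_ct A).
Proof. by move=> [cA _]; exists h => // s sh; apply: cA; hlra. Qed.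

Let near_dv A : sol c x (t - h) (t + h) A ->
  nr t (fun s => s != x -> row_dv c A s /\ [/\ 0 < k1 c s, 0 < k2 c s & 0 < k3 c s]).
Proof. by move=> [_ dA]; exists h => // s sh sx; split; [exact: dA|exact: pc]. Qed.

Let ctE A : sol c x (t - h) (t + h) A -> row_ct A t.
Proof. by move=> [+ _]; apply. Qed.

(** [r0 E3] has a minimum at [t], but [t] may be the corner, where no derivative is available. A
    nonzero value would instead make [r0 E3] strictly monotone through [t]. *)
Lemma touch_e13 : r1 E3 t = 0.
Proof.
have [k k0 Hk] := nr_itv t h0.
have [_ c1 _ _] := ctE s3.
have mn : nr t (fun s => 0 <= r0 E3 s).
  by exists h => // s /m1[].
have [p|n|//] := ltgtP 0 (r1 E3 t).
- have := nr_I (nr_ct c1 p) (nr_I (near_ct s3) (near_dv s3)) => H.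
  have /nr_incr H' : nr t (fun s => ct (r0 E3) s /\
      (s != x -> exists2 d, dv (r0 E3) s d & 0 < d)).
    apply: nr_imp H => s [p' [[? _ _ _] dE]]; split=> // /dE[[d _ _ _] [q _ _]].
    by eexists; [exact: d|rewrite mulr_gt0].
  have [d d0 Hd] := nr_I mn H'.
  have /Hd[a [b _]] : t - d < t - d / 2 < t + d by hlra.
  by have := b _; rewrite m1t; hlra.
- have n' : 0 < - r1 E3 t by rewrite oppr_gt0.
  have := nr_I (nr_ct (ctN c1) n') (nr_I (near_ct s3) (near_dv s3)) => H.
  have /nr_decr H' : nr t (fun s => ct (r0 E3) s /\
      (s != x -> exists2 d, dv (r0 E3) s d & d < 0)).
    apply: nr_imp H => s [p' [[? _ _ _] dE]]; split=> // /dE[[d _ _ _] [q _ _]].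
    by eexists; [exact: d|rewrite pmulr_rlt0// -oppr_gt0].
  have [d d0 Hd] := nr_I mn H'.
  have /Hd[a [_ b]] : t - d < t + d / 2 < t + d by hlra.
  by have := b _; rewrite m1t; hlra.
Qed.

(** Otherwise the fourth row at [t] is (0, 0, 0, 1) up to sign, so it is plus or minus the covector
    dual to the last column, whose first coordinate changes sign at [t]. *)
Lemma touch_e23_neq0 : r2 E3 t != 0.
Proof.
apply/eqP => e23; have e13 := touch_e13.
have e33 : r3 E3 t ^+ 2 = 1 by rewrite -row3 m1t e13 e23; ring.
have [[_ _ _ c33] _] := orth.
have z (a b d : R) : a * a + b * b + d * d = 0 -> [/\ a = 0, b = 0 & d = 0].
  by move=> e; split; nra.
have [y0 y1 y2] : [/\ r3 E0 t = 0, r3 E1 t = 0 & r3 E2 t = 0].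
  by apply: z; move: c33 e33; rewrite /colprod expr2; hlra.
have GE s : r0 (G r3) s = r3 E3 t * r0 E3 s.
  by rewrite /= y0 y1 y2; ring.
have mn : nr t (fun s => 0 <= r0 E3 s) by exists h => // s /m1[].
have [d d0 Hd] := nr_I mn (nr_I frame_left frame_right).
have /Hd[a [b _]] : t - d < t - d / 2 < t + d by hlra.
have /Hd[a' [_ b']] : t - d < t + d / 2 < t + d by hlra.
have [[+ _ _] _] := b ltac:(hlra); have [+ _ _] := b' ltac:(hlra).
rewrite !GE; have [y|y] := lerP 0 (r3 E3 t).
  by have := mulr_ge0 y a; hlra.
by have := mulr_le0_ge0 (ltW y) a'; hlra.
Qed.

(** A negative value would make first [r1 E3], then [r0 E3], decrease from 0 just after [t]. *)
Lemma touch_e23 : 0 < r2 E3 t.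
Proof.
rewrite lt_neqAle eq_sym touch_e23_neq0 /= leNgt; apply/negP => n.
have e13 := touch_e13.
have mn : nr t (fun s => 0 <= r0 E3 s) by exists h => // s /m1[].
have [_ _ c2 _] := ctE s3.
have n' : 0 < - r2 E3 t by rewrite oppr_gt0.
have H := nr_I (nr_I mn (nr_ct (ctN c2) n')) (nr_I (near_ct s3) (near_dv s3)).
have /nr_decr H1 : nr t (fun s => ct (r1 E3) s /\
    (s != x -> exists2 d, dv (r1 E3) s d & d < 0)).
  apply: nr_imp H => s [[p q] [[_ ? _ _] dE]]; split=> // /dE[[_ d _ _] [q1 q2 _]].
  eexists; first exact: d.
  by have := mulr_gt0 q2 q; have := mulr_ge0 (ltW q1) p; hlra.
have [d d0 Hd] := nr_I (nr_I mn H1) (nr_I (near_ct s3) (near_dv s3)).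
have : r0 E3 (t + d / 2) < r0 E3 t.
  apply: (@dec _ x) => [|u ut|u ut ux]; first hlra.
    by have /Hd[_ [[? _ _ _] _]] : t - d < u < t + d by hlra.
  have /Hd[[_ [_ b]] [_ /(_ ux)[[du _ _ _] [q _ _]]]] : t - d < u < t + d by hlra.
  eexists; first exact: du.
  by rewrite pmulr_rlt0// (lt_le_trans (b _)) ?e13//; hlra.
have /Hd[[a _] _] : t - d < t + d / 2 < t + d by hlra.
by rewrite m1t; hlra.
Qed.

Let G0t : [/\ r0 (G r0) t = 1, r1 (G r0) t = 0 & r2 (G r0) t = 0].
Proof. by have [_ []] := atrow_id orth. Qed.

(* Dividing by the component along [gamma t] turns first order information at
   [t] into monotonicity without any bound on the coefficients. *)
Let ratio_incr A : sol c x (t - h) (t + h) A -> 0 < w01 (G r0) A t ->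
  nr t (fun s => (s < t -> r0 A s / r0 (G r0) s < r0 A t) /\
                 (t < s -> r0 A t < r0 A s / r0 (G r0) s)).
Proof.
move=> sA wA; have [g0 g1 g2] := G0t.
have gp : 0 < r0 (G r0) t by rewrite g0 ltr01.
have [c0 _ _ _] := ctE (sG r0).
have H := nr_I (nr_I (nr_ct c0 gp) (nr_ct (w01_ct (ctE (sG r0)) (ctE sA)) wA))
  (nr_I (nr_I (near_ct (sG r0)) (near_ct sA)) (nr_I (near_dv (sG r0)) (near_dv sA))).
have /nr_incr : nr t (fun s => ct (fun s => r0 A s / r0 (G r0) s) s /\
   (s != x -> exists2 d, dv (fun s => r0 A s / r0 (G r0) s) s d & 0 < d)).
  apply: nr_imp H => s [[p w] [[[? _ _ _] [? _ _ _]] [dG dA]]]; split.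
    by apply: ct_div => //; rewrite gt_eqF.
  move=> sx; have [[a0 _ _ _] _] := dA sx; have [[b0 _ _ _] [q _ _]] := dG sx.
  have pn : r0 (G r0) s != 0 by rewrite gt_eqF.
  exists (k1 c s * w01 (G r0) A s / r0 (G r0) s ^+ 2).
    by apply: dv_eq (dv_div pn a0 b0) _; rewrite /w01; field.
  by rewrite !(mulr_gt0, invr_gt0, exprn_gt0).
by rewrite g0 divr1.
Qed.

Let w0A A : w01 (G r0) A t = r1 A t.
Proof. by have [g0 g1 _] := G0t; rewrite /w01 g0 g1; ring. Qed.

(** Second order information integrated twice: [w01 (G r0) E3] increases through 0, and it is the
    numerator of the derivative of [r0 E3 / r0 (G r0)]. *)
Lemma touch_right : nr t (fun s => t < s -> 0 < r0 E3 s).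
Proof.
have [g0 g1 g2] := G0t; have e23 := touch_e23; have e13 := touch_e13.
have cG := ctE (sG r0); have cE := ctE s3.
have w2 : 0 < w02 (G r0) E3 t by rewrite /w02 g0 g2 m1t; hlra.
have c2 : ct (w02 (G r0) E3) t.
  by case: cG cE => [? ? ? ?] [? ? ? ?]; rewrite /w02; cts.
have gp : 0 < r0 (G r0) t by rewrite g0 ltr01.
have c0 : ct (r0 (G r0)) t by case: cG.
have H := nr_I (nr_I (nr_ct c0 gp) (nr_ct c2 w2))
  (nr_I (nr_I (near_ct (sG r0)) (near_ct s3)) (nr_I (near_dv (sG r0)) (near_dv s3))).
have /nr_incr H1 : nr t (fun s => ct (w01 (G r0) E3) s /\
   (s != x -> exists2 d, dv (w01 (G r0) E3) s d & 0 < d)).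
  apply: nr_imp H => s [[p w] [[? ?] [dG dA]]]; split; first exact: w01_ct.
  move=> sx; have [a0 _] := dA sx; have [b0 [_ q _]] := dG sx.
  by eexists; [exact: w01_dv b0 a0|rewrite mulr_gt0].
have [d d0 Hd] := nr_I H H1; exists d => // s sd ts.
have : r0 E3 t / r0 (G r0) t < r0 E3 s / r0 (G r0) s.
  apply: (@mono _ x (fun s => r0 E3 s / r0 (G r0) s)) => // [u ut|u ut ux].
    have /Hd[[[p _] [[[? _ _ _] [? _ _ _]] _]] _] : t - d < u < t + d by hlra.
    by apply: ct_div => //; rewrite gt_eqF.
  have /Hd[[[p _] [_ [/(_ ux)[[dg _ _ _] [q _ _]] /(_ ux)[[de _ _ _] _]]]] [_ w]] : t - d < u < t + d by hlra.
  have pn : r0 (G r0) u != 0 by rewrite gt_eqF.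
  exists (k1 c u * w01 (G r0) E3 u / r0 (G r0) u ^+ 2).
    by apply: dv_eq (dv_div pn de dg) _; rewrite /w01; field.
  have wu : 0 < w01 (G r0) E3 u.
    by apply: le_lt_trans (w _); [rewrite w0A e13|hlra].
  by rewrite !(mulr_gt0, invr_gt0, exprn_gt0).
rewrite m1t mul0r; have /Hd[[[p _] _] _] : t - d < s < t + d by hlra.
by rewrite pmulr_lgt0// invr_gt0.
Qed.

(** The derivative of the quotient is [- k1 * w01 E2 E3 / r0 E3 ^+ 2]; this is where nonnegativity
    of the second minor enters. *)
Let ratio_mono a b : t - h < a -> a < b -> b < t + h ->
  (forall s, a <= s <= b -> 0 < r0 E3 s) ->
  r0 E2 b / r0 E3 b <= r0 E2 a / r0 E3 a.
Proof.
move=> ta ab bt pos.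
apply: (@wdec _ x (fun s => r0 E2 s / r0 E3 s)) => [|u ut|u ut ux]; first exact: ltW.
  have [[] + _ _ _ [] + _ _ _] : row_ct E2 u /\ row_ct E3 u.
    by split; [apply: s2.1|apply: s3.1]; hlra.
  by move=> ? ?; apply: ct_div => //; rewrite gt_eqF// pos.
have uh : t - h < u < t + h by hlra.
have pu : 0 < r0 E3 u by apply: pos; hlra.
have [d2 _ _ _] := s2.2 u uh ux; have [d3 _ _ _] := s3.2 u uh ux.
have [q _ _] := pc uh ux.
have pn : r0 E3 u != 0 by rewrite gt_eqF.
exists (- (k1 c u * w01 E2 E3 u / r0 E3 u ^+ 2)).
  by apply: dv_eq (dv_div pn d2 d3) _; rewrite /w01; field.
rewrite oppr_le0; apply: mulr_ge0; last by rewrite invr_ge0 exprn_ge0// ltW.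
by apply: mulr_ge0; [exact: ltW|have [] := m1 uh].
Qed.

(** The nonincreasing quotient [r0 E2 / r0 E3] is bounded above just before [t] and below just after
    [t], while its denominator tends to 0. *)
Lemma touch_g2 : r0 E2 t = 0.
Proof.
have [c2 _ _ _] := ctE s2; have [c3 _ _ _] := ctE s3.
apply/eqP; rewrite eq_le; apply/andP; split.
- pose a := t - h / 2; pose K := r0 E2 a / r0 E3 a.
  have : ct (fun s => r0 E2 s - K * r0 E3 s) t by cts.
  move=> /ct_le_left; rewrite m1t mulr0 subr0; apply.
  exists (h / 2); first hlra; move=> s sh st.
  have ps : 0 < r0 E3 s by apply: m1l; hlra.
  rewrite subr_le0 -ler_pdivrMr//; apply: ratio_mono; rewrite /a; try hlra.
  by move=> u us; apply: m1l; hlra.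
- have [d d0 Hd] := nr_I touch_right (nr_itv t h0).
  pose b := t + d / 2; pose K := r0 E2 b / r0 E3 b.
  rewrite -oppr_le0; have : ct (fun s => - (r0 E2 s - K * r0 E3 s)) t by cts.
  move=> /ct_le_right; rewrite m1t mulr0 subr0; apply.
  exists (d / 2); first hlra; move=> s sh st.
  have bh : b < t + h.
    have bd' : t - d < b < t + d by rewrite /b; hlra.
    by have [_ ?] := Hd b bd'; hlra.
  have pos u : t < u < t + d -> 0 < r0 E3 u.
    move=> ut; have ut' : t - d < u < t + d by hlra.
    by have [+ _] := Hd u ut'; apply; hlra.
  have ps : 0 < r0 E3 s by apply: pos; hlra.
  rewrite oppr_le0 subr_ge0 -ler_pdivlMr//; apply: ratio_mono => //; rewrite /b; try hlra.
  by move=> u us; apply: pos; hlra.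
Qed.

(** With K an earlier value of the quotient, a negative [r1 E2 t] would make [K * r0 E3 - r0 E2]
    increase through 0 at [t], so that the quotient would exceed K just before [t]. *)
Lemma touch_e12 : 0 <= r1 E2 t.
Proof.
rewrite leNgt; apply/negP => n.
pose a := t - h / 2; pose K := r0 E2 a / r0 E3 a.
pose F := rcomb 0 0 (-1) K E0 E1 E2 E3.
have sF : sol c x (t - h) (t + h) F by exact: sol_rcomb.
have wF : 0 < w01 (G r0) F t by rewrite w0A /= touch_e13; hlra.
have [d d0 Hd] := nr_I (nr_I (ratio_incr sF wF) lead_near) (nr_itv t h0).
pose e := Num.min d (h / 2).
have e0 : 0 < e by rewrite lt_min d0; hlra.
have ed : e <= d by rewrite ge_min lexx.
have eh : e <= h / 2 by rewrite ge_min lexx orbT.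
pose s := t - e / 2.
have /Hd[[[H1 _] [p _ _ _]] _] : t - d < s < t + d by rewrite /s; hlra.
have : r0 F s / r0 (G r0) s < 0.
  by apply: lt_le_trans (H1 _) _; rewrite /s /= ?touch_g2 ?m1t; hlra.
rewrite pmulr_llt0 ?invr_gt0//.
have ps : 0 < r0 E3 s by apply: m1l; rewrite /s; hlra.
have : r0 E2 s / r0 E3 s <= K.
  apply: ratio_mono; rewrite /a /s; try hlra.
  by move=> u us; apply: m1l; hlra.
by rewrite ler_pdivrMr//= => ? ; hlra.
Qed.

(** A sign change, unlike a zero, survives small perturbations of the frame; this is how a touching
    at one parameter is refuted at neighbouring ones. *)
Lemma touch_cross : 0 < r1 E2 t ->
  nr t (fun s => (s < t -> r0 E2 s < 0) /\ (t < s -> 0 < r0 E2 s)).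
Proof.
move=> e12; have w2 : 0 < w01 (G r0) E2 t by rewrite w0A.
have := nr_I (ratio_incr s2 w2) lead_near; apply: nr_imp => s [[a b] [p _ _ _]].
rewrite touch_g2 in a b; split => [/a|/b].
  by rewrite pmulr_llt0 ?invr_gt0.
by rewrite pmulr_lgt0 ?invr_gt0.
Qed.

End Touch.

(** * Deforming the right factor *)

Section Compactness.
Context {R : realType}.

Lemma ct_min (T : topologicalType) (f g : T -> R) (t : T) : ct f t -> ct g t ->
  ct (fun s => Num.min (f s) (g s)) t.
Proof. by move=> hf hg; exact: (@continuous_min R T f g t hf hg). Qed.

Lemma ct_max (T : topologicalType) (f g : T -> R) (t : T) : ct f t -> ct g t ->
  ct (fun s => Num.max (f s) (g s)) t.
Proof. by move=> hf hg; exact: (@continuous_max R T f g t hf hg). Qed.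

Lemma closed_le0 (T : topologicalType) (f : T -> R) : (forall t, ct f t) ->
  closed [set t | f t <= 0].
Proof.
move=> cf; have := @preimage_closed T R f [set x | x <= 0].
by apply; [move=> x _; exact: cf|exact: closed_le].
Qed.

(** Supplies the least deformation parameter at which positivity fails at some time. *)
Lemma square_min (f : R * R -> R) : (forall p, ct f p) ->
  (exists x y, [/\ 0 <= x <= 1, 0 <= y <= 1 & f (x, y) <= 0]) ->
  exists x y, [/\ 0 <= x <= 1, 0 <= y <= 1, f (x, y) <= 0 &
    forall x' y', 0 <= x' <= 1 -> 0 <= y' <= 1 -> f (x', y') <= 0 -> x <= x'].
Proof.
move=> cf [x [y [hx hy fxy]]].
pose A := [set p : R * R | f p <= 0] `&` (`[0, 1] `*` `[0, 1])%classic.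
have cA : compact A.
  rewrite /A setIC; apply: compact_closedI; last exact: closed_le0.
  by apply: compact_setX; exact: segment_compact.
have [||[x0 y0] /set_mem [/= f0 []]] := @compact_EVT_min _ R fst A _ cA _.
- by exists (x, y); split => //=; rewrite !in_itv.
- by apply: continuous_subspaceT => p; exact: cvg_fst.
rewrite /= !in_itv /= => hx0 hy0 mn; exists x0, y0; split => // x' y' hx' hy' f'.
apply: (mn (x', y')); apply/mem_set; split => //=; by rewrite !in_itv.
Qed.

Lemma first_zero (f : R -> R) a b : (forall t, ct f t) ->
  (exists2 t, a <= t <= b & f t <= 0) ->
  exists t, [/\ a <= t <= b, f t <= 0 & forall s, a <= s < t -> 0 < f s].
Proof.
move=> cf [t tab ft].
pose A := [set p : R | f p <= 0] `&` `[a, b]%classic.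
have cA : compact A.
  by rewrite /A setIC; apply: compact_closedI; [exact: segment_compact|exact: closed_le0].
have [||s /set_mem [/= f0]] := @compact_EVT_min _ R id A _ cA _.
- by exists t; split => //=; rewrite in_itv.
- by apply: continuous_subspaceT => p; exact: ct_id.
rewrite /= in_itv /= => sab mn; exists s; split => // r /andP[ar rs].
rewrite ltNge; apply/negP => fr; have : s <= r.
  apply: mn; apply/mem_set; split => //=; rewrite in_itv /= ar (le_trans (ltW rs))//.
  by case/andP: sab.
by rewrite leNgt rs.
Qed.

Definition nr2 (a b : R) (P : R -> R -> Prop) := exists2 h : R, 0 < h &
  forall x y : R, a - h < x < a + h -> b - h < y < b + h -> P x y.

Lemma nr2_ct (f : R * R -> R) a b : ct f (a, b) -> 0 < f (a, b) ->
  nr2 a b (fun x y => 0 < f (x, y)).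
Proof.
move=> cf fp; have : \forall p \near (a, b), 0 < f p by have := cf; move=> /cvgr_gt; apply.
move=> /nbhs_ballP[h /= h0 H]; exists h => // x y hx hy; apply: H.
by split; rewrite /ball /= distrC ltr_distl.
Qed.

Lemma nr2_I a b P Q : nr2 a b P -> nr2 a b Q -> nr2 a b (fun x y => P x y /\ Q x y).
Proof.
move=> [h h0 H] [k k0 K]; have [hk|kh] := leP h k.
  by exists h => // x y hx hy; split; [exact: H|apply: K; lra].
by exists k => // x y hx hy; split; [apply: H; lra|exact: K].
Qed.

Lemma nr2_imp a b (P Q : R -> R -> Prop) : (forall x y, P x y -> Q x y) ->
  nr2 a b P -> nr2 a b Q.
Proof. by move=> PQ [h h0 H]; exists h => // x y hx hy; apply/PQ/H. Qed.

End Compactness.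

(** * The deformed right factors *)

Section Family.
Context {R : realType}.
Implicit Types (z w : @quatn R).

(* Constant rows, so that minors can be evaluated at a pair of quaternions. *)
Definition cr i z w : row := qrow i (fun=> z) (fun=> w).

(** The lower left minors of sizes 1, 2, 3 of the frame z h conj(w); the time 0 is a dummy, the rows
    being constant. *)
Definition m1 z w := r0 (cr 3 z w) 0.
Definition m2 z w := w01 (cr 2 z w) (cr 3 z w) 0.
Definition m3 z w := W012 (cr 1 z w) (cr 2 z w) (cr 3 z w) 0.

(* w e^(x k) *)
Definition rot w (x : R) : quatn := Qn
  (cos x * qa w - sin x * qd w) (cos x * qb w + sin x * qc w)
  (cos x * qc w - sin x * qb w) (cos x * qd w + sin x * qa w).

Lemma rot0 w : rot w 0 = w.
Proof. by case: w => a b c d; rewrite /rot cos0 sin0 /=; congr Qn; ring. Qed.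

Lemma nrm_rot w x : nrm (rot w x) = nrm w.
Proof.
have := cos2Dsin2 x; rewrite /nrm /= => e.
rewrite (_ : _ + _ = (cos x ^+ 2 + sin x ^+ 2) *
  (qa w ^+ 2 + qb w ^+ 2 + qc w ^+ 2 + qd w ^+ 2)); last by ring.
by rewrite e mul1r.
Qed.

Lemma ct_cos (T : topologicalType) (f : T -> R) t : ct f t -> ct (fun s => cos (f s)) t.
Proof. by move=> cf; apply: (ct_comp (f := @cos R) cf); exact: continuous_cos. Qed.

Lemma ct_sin (T : topologicalType) (f : T -> R) t : ct f t -> ct (fun s => sin (f s)) t.
Proof. by move=> cf; apply: (ct_comp (f := @sin R) cf); exact: continuous_sin. Qed.

Lemma rot_ct (T : topologicalType) (w : T -> quatn) (f : T -> R) t :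
  ctq w t -> ct f t -> ctq (fun s => rot (w s) (f s)) t.
Proof.
move=> [? ? ? ?] cf; have ? := ct_cos cf; have ? := ct_sin cf.
by split; rewrite /=; cts.
Qed.

Lemma rot_dv w (f : R -> R) t q : dv f t (q / 2) ->
  dvq (fun s => rot w (f s)) t (spin 0 q (rot w (f t))).
Proof.
move=> df; have ? := dv_cos df; have ? := dv_sin df.
by split; rewrite /=; (eapply dv_eq; [dvs|]); rewrite /=; field.
Qed.

Lemma cr_ct (T : topologicalType) (z w : T -> quatn) t i : ctq z t -> ctq w t ->
  [/\ ct (fun s => r0 (cr i (z s) (w s)) 0) t, ct (fun s => r1 (cr i (z s) (w s)) 0) t,
      ct (fun s => r2 (cr i (z s) (w s)) 0) t & ct (fun s => r3 (cr i (z s) (w s)) 0) t].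
Proof.
move=> cz cw; split; rewrite /=; apply: comp_ct; apply: mulc_ct => //.
- exact: muli_ct.
- exact: mulj_ct.
- exact: mulk_ct.
Qed.

Lemma m1_ct (T : topologicalType) (z w : T -> quatn) t : ctq z t -> ctq w t ->
  ct (fun s => m1 (z s) (w s)) t.
Proof. by move=> cz cw; have [] := cr_ct 3 cz cw. Qed.

Lemma m2_ct (T : topologicalType) (z w : T -> quatn) t : ctq z t -> ctq w t ->
  ct (fun s => m2 (z s) (w s)) t.
Proof.
move=> cz cw; have [? ? _ _] := cr_ct 3 cz cw; have [? ? _ _] := cr_ct 2 cz cw.
by rewrite /m2 /w01; cts.
Qed.

Lemma m3_ct (T : topologicalType) (z w : T -> quatn) t : ctq z t -> ctq w t ->
  ct (fun s => m3 (z s) (w s)) t.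
Proof.
move=> cz cw; have [? ? ? _] := cr_ct 3 cz cw; have [? ? ? _] := cr_ct 2 cz cw.
have [? ? ? _] := cr_ct 1 cz cw.
by rewrite /m3 /W012 /w01 /w02 /w12; cts.
Qed.

(** [sp_delta] is condition (D): its two expressions are half of <gamma_l, k> and half of <n_l,
    i>. *)
Record spin_path (z w : R -> quatn) (c : coef) (th : R -> R) : Prop := SpinPath {
  sp_z : forall t, ctq z t;
  sp_w : forall t, ctq w t;
  sp_nz : forall t, nrm (z t) = 1;
  sp_nw : forall t, nrm (w t) = 1;
  sp_z0 : z 0 = qone';
  sp_w0 : w 0 = qone';
  sp_z1 : z 1 = qopp qone';
  sp_c : forall t, 0 < t < 1 -> [/\ 0 < k1 c t, 0 < k2 c t & 0 < k3 c t];
  sp_row : forall i t, 0 < t < 1 -> row_dv c (qrow i z w) t;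
  sp_dz : forall t, 0 < t < 1 -> dvq z t (spin (k1 c t + k3 c t) (k2 c t) (z t));
  sp_th : forall t, ct th t;
  sp_th0 : th 0 = 0;
  sp_dth : forall t, 0 < t < 1 -> dv th t (k2 c t / 2);
  sp_delta : forall t, 0 < t < 1 ->
    0 < qb (z t) * qd (z t) - qa (z t) * qc (z t) /\
    0 < qb (z t) * qd (z t) + qa (z t) * qc (z t) }.

Definition coef_rev (c : @coef R) := Coef (k3 c) (k2 c) (k1 c).

(** Conjugating w by k turns z h conj(w) into (z h k^-1 conj(w))k. Up to sign this exchanges columns
    0, 3 and 1, 2, and likewise rows, so [k1] and [k3] trade places. It transports statements on
    [m1] to [m3]. *)
Lemma spin_path_mirror (z w : R -> quatn) c th : spin_path z w c th ->
  spin_path z (fun t => mirror (w t)) (coef_rev c) th.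
Proof.
move=> S; split; try by move: S => [].
- move=> t; have [? ? ? ?] := sp_w S t; split; rewrite /=; cts.
- by move=> t; rewrite nrm_mirror (sp_nw S).
- by rewrite (sp_w0 S) /mirror /= !oppr0.
- by move=> t /(sp_c S)[].
- move=> i t t01.
  have [a0 a1 a2 a3] := sp_row S 0 t01; have [b0 b1 b2 b3] := sp_row S 1 t01.
  have [c0 c1 c2 c3] := sp_row S 2 t01; have [d0 d1 d2 d3] := sp_row S 3 t01.
  have key (f g : R -> R) d e : dv f t d -> f =1 g -> d = e -> dv g t e.
    by move=> df /funext <- <-.
  case: i => [|[|[|i]]]; split.
  + by apply: (key _ _ _ _ d3) => [s|] /=; ring.
  + by apply: (key _ _ _ _ (dvN d2)) => [s|] /=; ring.
  + by apply: (key _ _ _ _ d1) => [s|] /=; ring.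
  + by apply: (key _ _ _ _ (dvN d0)) => [s|] /=; ring.
  + by apply: (key _ _ _ _ (dvN c3)) => [s|] /=; ring.
  + by apply: (key _ _ _ _ c2) => [s|] /=; ring.
  + by apply: (key _ _ _ _ (dvN c1)) => [s|] /=; ring.
  + by apply: (key _ _ _ _ c0) => [s|] /=; ring.
  + by apply: (key _ _ _ _ b3) => [s|] /=; ring.
  + by apply: (key _ _ _ _ (dvN b2)) => [s|] /=; ring.
  + by apply: (key _ _ _ _ b1) => [s|] /=; ring.
  + by apply: (key _ _ _ _ (dvN b0)) => [s|] /=; ring.
  + by apply: (key _ _ _ _ (dvN a3)) => [s|] /=; ring.
  + by apply: (key _ _ _ _ a2) => [s|] /=; ring.
  + by apply: (key _ _ _ _ (dvN a1)) => [s|] /=; ring.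
  + by apply: (key _ _ _ _ a0) => [s|] /=; ring.
- by move=> t /(sp_dz S); rewrite /= addrC.
Qed.

(** The minimum makes the family jointly continuous in x and t, and the value at t depends on x only
    through [Num.min x t]. *)
Definition wfam (w : R -> quatn) (th : R -> R) (x t : R) : quatn :=
  rot (w (Num.min x t)) (th t - th (Num.min x t)).

(** After x the right factor has no i-part, which forces equal first and third curvatures; their sum
    is prescribed by [z]. *)
Definition cfam (c : @coef R) (x : R) : coef := Coef
  (fun t => if t < x then k1 c t else (k1 c t + k3 c t) / 2) (k2 c)
  (fun t => if t < x then k3 c t else (k1 c t + k3 c t) / 2).

Lemma wfam_le (w : R -> quatn) th x t : t <= x -> wfam w th x t = w t.
Proof. by move=> tx; rewrite /wfam min_r// subrr rot0. Qed.

Lemma wfam_min (w : R -> quatn) th x t : wfam w th x t = wfam w th (Num.min x t) t.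
Proof. by rewrite /wfam -minA minxx. Qed.

Lemma wfam_mirror (w : R -> quatn) th x t : wfam (fun s =>
  mirror (w s)) th x t = mirror (wfam w th x t).
Proof. by rewrite /wfam /rot /mirror /=; congr Qn; ring. Qed.

Variables (z w : R -> @quatn R) (c : @coef R) (th : R -> R).
Hypothesis S : spin_path z w c th.

Lemma wfam_ct2 (p : R * R) : ctq (fun p => wfam w th p.1 p.2) p.
Proof.
have cm : ct (fun p : R * R => Num.min p.1 p.2) p.
  by apply: ct_min; [exact: cvg_fst|exact: cvg_snd].
apply: rot_ct.
  have [h1 h2 h3 h4] := sp_w S (Num.min p.1 p.2).
  split; [exact: ct_comp cm h1|exact: ct_comp cm h2|exact: ct_comp cm h3|].
  exact: ct_comp cm h4.
apply: ctB.
  have c2 : ct (fun p : R * R => p.2) p by exact: cvg_snd.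
  exact (@ct_comp _ _ _ th (fun p : R * R => p.2) p c2 (sp_th S (t := p.2))).
exact (@ct_comp _ _ _ th (fun p : R * R => Num.min p.1 p.2) p cm (sp_th S (t := Num.min p.1 p.2))).
Qed.

Lemma z_ct2 (p : R * R) : ctq (fun p => z p.2) p.
Proof.
have [h1 h2 h3 h4] := sp_z S p.2.
have c2 : ct (fun p : R * R => p.2) p by exact: cvg_snd.
split; [exact: ct_comp c2 h1|exact: ct_comp c2 h2|exact: ct_comp c2 h3|].
exact: ct_comp c2 h4.
Qed.

Lemma nrm_wfam x t : nrm (wfam w th x t) = 1.
Proof. by rewrite nrm_rot (sp_nw S). Qed.

End Family.

(** * Frenet equations of the deformed frames and positivity near time 0 *)

Section FamilyRows.
Context {R : realType}.
Variables (z w : R -> @quatn R) (c : @coef R) (th : R -> R).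
Hypothesis S : spin_path z w c th.

Let wf := wfam w th.

Definition fam i x := qrow i z (wfam w th x).

Lemma wfam_ct x t : ctq (wf x) t.
Proof.
have cm : ct (fun t => Num.min x t) t by apply: ct_min; [exact: ct_cst|exact: ct_id].
apply: rot_ct.
  have [h1 h2 h3 h4] := sp_w S (Num.min x t).
  split; [exact: ct_comp cm h1|exact: ct_comp cm h2|exact: ct_comp cm h3|].
  exact: ct_comp cm h4.
apply: ctB; first exact (sp_th S (t := t)).
exact (@ct_comp _ _ _ th (fun t => Num.min x t) t cm (sp_th S (t := Num.min x t))).
Qed.

Lemma fam_ct i x t : row_ct (fam i x) t.
Proof. by apply: qrow_ct; [exact: sp_z S t|exact: wfam_ct]. Qed.

Lemma fam_dv i x t : 0 < t < 1 -> t != x -> row_dv (cfam c x) (fam i x) t.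
Proof.
move=> t01; rewrite neq_lt => /orP[tx|xt].
  have e : \forall s \near t, w s = wf x s.
    by near=> s; rewrite /wf wfam_le// ltW//; near: s; exact: lt_nbhsl.
  have [h0 h1 h2 h3] := sp_row S i t01.
  have e0 : w t = wf x t := nbhs_singleton e.
  rewrite /= in h0 h1 h2 h3; rewrite e0 in h0 h1 h2 h3.
  split; rewrite /cfam /= tx; [apply: dv_ext h0|apply: dv_ext h1|apply: dv_ext h2|
    apply: dv_ext h3]; by near=> s; rewrite /= (near e s).
have e : \forall s \near t, rot (w x) (th s - th x) = wf x s.
  near=> s; rewrite /wf /wfam min_l// ltW//; near: s; exact: lt_nbhsr.
have dth : dv (fun s => th s - th x) t (k2 c t / 2).
  by apply: dv_eq (dvB (sp_dth S t01) (dv_cst (th x) t)) _; rewrite subr0.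
have [h0 h1 h2 h3] := qrow_dv i (sp_dz S t01) (rot_dv (w x) dth).
have tx : (t < x) = false by apply/negbTE; rewrite -leNgt ltW.
have e0 : rot (w x) (th t - th x) = wf x t := nbhs_singleton e.
rewrite subr0 addr0 /= in h0 h1 h2 h3; rewrite e0 in h0 h1 h2 h3.
split; rewrite /cfam /= tx; [apply: dv_ext h0|apply: dv_ext h1|apply: dv_ext h2|
    apply: dv_ext h3]; by near=> s; rewrite /= (near e s).
Unshelve. all: by end_near. Qed.

Lemma fam_sol i x a b : 0 <= a -> b <= 1 -> sol (cfam c x) x a b (fam i x).
Proof.
move=> a0 b1; split=> [t _|t tab tx]; first exact: fam_ct.
by apply: fam_dv => //; lra.
Qed.

Lemma fam_posc x a b : 0 <= a -> b <= 1 -> posc (cfam c x) x a b.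
Proof.
move=> a0 b1 t tab _; have [|p1 p2 p3] := sp_c S (t := t); first lra.
by rewrite /cfam /=; case: ifP => _; split => //; lra.
Qed.

Lemma fam_orthc x t : orthc (fam 0 x) (fam 1 x) (fam 2 x) (fam 3 x) t.
Proof. exact: qrow_orthc (sp_nz S t) (nrm_wfam S x t). Qed.

Lemma fam_row3 x t :
  r0 (fam 3 x) t ^+ 2 + r1 (fam 3 x) t ^+ 2 + r2 (fam 3 x) t ^+ 2 + r3 (fam 3 x) t ^+ 2 = 1.
Proof.
have /= := qrow_gram (z t) (wf x t) (i := 3) isT.
by rewrite (sp_nz S) (nrm_wfam S) mulr1.
Qed.

Definition good x t := [/\ 0 < m1 (z t) (wf x t), 0 < m2 (z t) (wf x t) &
  0 < m3 (z t) (wf x t)].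

Lemma good_min x t : good x t <-> good (Num.min x t) t.
Proof. by rewrite /good /wf -wfam_min. Qed.

Lemma nr2_leading x t :
  leading (cr 0 (z t) (wf x t)) (cr 1 (z t) (wf x t)) (cr 2 (z t) (wf x t))
    (cr 3 (z t) (wf x t)) 0 ->
  nr2 x t (fun x t => leading (fam 0 x) (fam 1 x) (fam 2 x) (fam 3 x) t).
Proof.
move=> [p1 p2 p3 p4].
have C i := cr_ct i (z_ct2 S (x, t)) (wfam_ct2 S (x, t)).
have [a0 a1 a2 a3] := C 0%N; have [b0 b1 b2 b3] := C 1%N.
have [c0 c1 c2 c3] := C 2%N; have [d0 d1 d2 d3] := C 3%N.
have h1 := nr2_ct a0 p1.
have h2 : nr2 x t (fun x t => 0 < w01 (fam 0 x) (fam 1 x) t).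
  apply: (nr2_ct (f := fun p => w01 (fam 0 p.1) (fam 1 p.1) p.2)) p2.
  by rewrite /w01; cts.
have h3 : nr2 x t (fun x t => 0 < W012 (fam 0 x) (fam 1 x) (fam 2 x) t).
  apply: (nr2_ct (f := fun p => W012 (fam 0 p.1) (fam 1 p.1) (fam 2 p.1) p.2)) p3.
  by rewrite /W012 /w01 /w02 /w12; cts.
have h4 : nr2 x t (fun x t => 0 < det4 (fam 0 x) (fam 1 x) (fam 2 x) (fam 3 x) t).
  apply: (nr2_ct (f := fun p => det4 (fam 0 p.1) (fam 1 p.1) (fam 2 p.1) (fam 3 p.1) p.2)) p4.
  by rewrite /det4 /W012 /w01 /w02 /w12; cts.
by apply: nr2_imp (nr2_I (nr2_I h1 h2) (nr2_I h3 h4)) => s y [[? ?] [? ?]]; split.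
Qed.

Lemma leading_one : leading (cr 0 qone' qone') (cr 1 qone' qone')
  (cr 2 qone' (@qone' R)) (cr 3 qone' qone') 0.
Proof.
rewrite /leading /det4 /W012 /w01 /w02 /w12 /=.
by split; rewrite ?(mulr0, mul0r, subr0, addr0, mulr1, add0r, oppr0, mulrN, mulNr) ltr01.
Qed.

(** All members start at the identity. The radius is uniform in x because at time s the parameter x
    may be replaced by min(x, s), which is close to 0. *)
Lemma good_near0 : exists2 d : R, 0 < d & forall x t : R, 0 <= x -> 0 < t < d -> good x t.
Proof.
have wf0 : wf 0 0 = qone' by rewrite /wf wfam_le// (sp_w0 S).
have [|h h0 H] := @nr2_leading 0 0; first by rewrite (sp_z0 S) wf0; exact: leading_one.
exists (Num.min h 1); first by rewrite lt_min h0 ltr01.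
move=> x t x0; rewrite lt_min => /andP[t0 /andP[th1 t1]].
have ld (s : R) : 0 <= s <= t -> leading (fam 0 x) (fam 1 x) (fam 2 x) (fam 3 x) s.
  move=> st; have : leading (fam 0 (Num.min x s)) (fam 1 (Num.min x s))
    (fam 2 (Num.min x s)) (fam 3 (Num.min x s)) s.
    apply: H; last lra.
    have [xs|sx] := leP x s; lra.
  pose ldq (u v : @quatn R) := leading (cr 0 u v) (cr 1 u v) (cr 2 u v) (cr 3 u v) 0.
  rewrite -[X in X -> _]/(ldq (z s) (wfam w th (Num.min x s) s)) -wfam_min.
  exact.
have up : upper (fam 0 x) (fam 1 x) (fam 2 x) (fam 3 x) 0.
  pose upq (u v : @quatn R) := upper (cr 0 u v) (cr 1 u v) (cr 2 u v) (cr 3 u v) 0.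
  suff : upq (z 0) (wfam w th x 0) by [].
  rewrite (sp_z0 S) wfam_le// (sp_w0 S).
  by rewrite /upq /upper /=; split; split; ring.
have t11 : t <= 1 by exact: ltW.
have tt : 0 < t <= t by rewrite t0 lexx.
have [p1 p2 p3] := rows_pos (fam_posc (x := x) (lexx 0) t11) (fam_sol 0 x (lexx 0) t11)
  (fam_sol 1 x (lexx 0) t11) (fam_sol 2 x (lexx 0) t11) (fam_sol 3 x (lexx 0) t11)
  ld up tt.
by split.
Qed.

End FamilyRows.

(** * Minors cannot reach zero before time 1 *)

Section Deform.
Context {R : realType}.

Lemma pairl_continuous (x s : R) : {for x, continuous (fun y : R => (y, s))}.
Proof.
rewrite /prop_for /continuous_at /=.
have h1 : (fun y : R => y) @ x --> x by exact: cvg_id.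
have h2 : (fun y : R => s) @ x --> s by exact: cvg_cst.
by have := cvg_pair h1 h2; exact.
Qed.

(** The sum of two complementary Plücker coordinates is a component of the half of the bivector of
    e_0 and e_1 that the left factor alone determines; here it is <gamma_l, k>. *)
Lemma u_minors (z w : @quatn R) :
  w01 (cr 0 z w) (cr 3 z w) 0 + w01 (cr 1 z w) (cr 2 z w) 0 =
  2 * (qb z * qd z - qa z * qc z) * (nrm w).
Proof. by rewrite /w01 /nrm /=; ring. Qed.

Lemma m3E (z w : @quatn R) : nrm z = 1 -> nrm w = 1 ->
  m3 z w = - r3 (cr 0 z w) 0.
Proof.
move=> nz nw; have /= := qrow_W012 z w; rewrite nz nw mulr1 mulr1 /m3 /= => <-.
by [].
Qed.

Lemma sgn_lim (f : R -> R) t : ct f t -> nr t (fun s => s < t -> 0 < f s) -> 0 <= f t.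
Proof.
move=> cf fp; rewrite -oppr_le0; apply: (ct_le_left (ctN cf)).
by apply: nr_imp fp => s h /h; rewrite oppr_le0 => /ltW.
Qed.

Variables (z w : R -> @quatn R) (c : @coef R) (th : R -> R).
Hypothesis S : spin_path z w c th.

Local Notation wf := (wfam w th).
Local Notation E := (fam z w th).

(** At a first zero of [m1] the entry [r0 (E 2 x)] crosses 0 upwards and [r1 (E 2 x)] is positive.
    The crossing persists for y slightly below x, and at its time [m2] equals minus the product of
    [r1 (E 2 y)] and [m1], hence is negative. *)
Lemma m1_avoids_zero (x t : R) : 0 < x -> x <= t -> t < 1 ->
  (forall y s : R, 0 <= y < x -> 0 < s <= 1 -> 0 < m1 (z s) (wf y s) /\ 0 < m2 (z s) (wf y s)) ->
  (forall s : R, 0 < s <= 1 -> 0 <= m1 (z s) (wf x s) /\ 0 <= m2 (z s) (wf x s)) ->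
  (forall s : R, 0 < s < t -> 0 < m1 (z s) (wf x s)) -> m1 (z t) (wf x t) <> 0.
Proof.
move=> x0 xt t1 gd nn ps z0.
have [h [h0 ht0 ht1]] : exists h : R, [/\ 0 < h, 0 <= t - h & t + h <= 1].
  by have [tt|tt] := leP t (1 - t); [exists t|exists (1 - t)]; split; lra.
have P := fam_posc S (x := x) ht0 ht1.
have s0 := fam_sol S 0 x ht0 ht1; have s1 := fam_sol S 1 x ht0 ht1.
have s2 := fam_sol S 2 x ht0 ht1; have s3 := fam_sol S 3 x ht0 ht1.
have O := fam_orthc S x t; have N := fam_row3 S x t.
have M (s : R) : t - h < s < t + h -> 0 <= r0 (E 3 x) s /\ 0 <= w01 (E 2 x) (E 3 x) s.
  by move=> sh; apply: nn; lra.
have Ml (s : R) : t - h < s < t -> 0 < r0 (E 3 x) s.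
  by move=> sh; apply: ps; lra.
have z0' : r0 (E 3 x) t = 0 by exact: z0.
have e13 := touch_e13 h0 P s3 M z0.
have g2 := touch_g2 h0 P s0 s1 s2 s3 O N M Ml z0.
have e12 := touch_e12 h0 P s0 s1 s2 s3 O N M Ml z0.
have X := touch_cross h0 P s0 s1 s2 s3 O N M Ml z0.
(* Otherwise both complementary minors of [u_minors] would vanish, against (D). *)
have {e12} e12 : 0 < r1 (E 2 x) t.
  rewrite lt_neqAle e12 andbT eq_sym; apply/eqP => e0.
  have := u_minors (z t) (wf x t); rewrite (nrm_wfam S) mulr1.
  have -> : w01 (cr 0 (z t) (wf x t)) (cr 3 (z t) (wf x t)) 0 = 0.
    by have : w01 (E 0 x) (E 3 x) t = 0 by rewrite /w01 z0' e13; ring.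
  have -> : w01 (cr 1 (z t) (wf x t)) (cr 2 (z t) (wf x t)) 0 = 0.
    by have : w01 (E 1 x) (E 2 x) t = 0 by rewrite /w01 g2 e0; ring.
  by have [|] := sp_delta S (t := t); [lra|move=> u0 _; lra].
have {}X := X e12.
have [_ c1 _ _] := cr_ct 2 (z_ct2 S (x, t)) (wfam_ct2 S (x, t)).
have [k k0 Hk] : nr2 x t (fun y s => 0 < r1 (E 2 y) s) := nr2_ct c1 e12.
have [l l0 Hl] := nr_I X (nr_I (nr_itv t h0) (nr_itv t k0)).
pose a := t - l / 2; pose b := t + l / 2.
have /Hl[[X1 _] [ha ka]] : t - l < a < t + l by rewrite /a; lra.
have /Hl[[_ X2] [hb kb]] : t - l < b < t + l by rewrite /b; lra.
have {X1} X1 : r0 (E 2 x) a < 0 by apply: X1; rewrite /a; lra.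
have {X2} X2 : 0 < r0 (E 2 x) b by apply: X2; rewrite /b; lra.
have cx s : ct (fun y => r0 (E 2 y) s) x.
  have cp := @pairl_continuous x s.
  have [cc _ _ _] := cr_ct 2 (z_ct2 S (x, s)) (wfam_ct2 S (x, s)).
  exact: ct_comp cp cc.
have n1 : nr x (fun y => 0 < - r0 (E 2 y) a).
  by apply: nr_ct; [exact/ctN/cx|rewrite oppr_gt0].
have n2 : nr x (fun y => 0 < r0 (E 2 y) b) by apply: nr_ct => //; exact: cx.
have [d d0 Hd] := nr_I (nr_I n1 n2) (nr_I (nr_itv x k0) (nr_itv x x0)).
pose y := x - d / 2.
have /Hd[[y1 y2] [yk yx]] : x - d < y < x + d by rewrite /y; lra.
have [||||s sab s0'] := @ivt_zero R (r0 (E 2 y)) a b.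
- by rewrite /a /b; lra.
- by move=> u _; have [] := fam_ct S 2 y u.
- by move: y1; rewrite oppr_gt0 => /ltW.
- exact: ltW.
have sk : t - k < s < t + k by move: ka kb sab; rewrite /a /b; lra.
have q := Hk y s yk sk.
have y01 : 0 <= y < x by move: yx; rewrite /y; lra.
have s01 : 0 < s <= 1 by move: ha hb sab; rewrite /a /b; lra.
have [p1 p2] := gd y s y01 s01.
have : m2 (z s) (wf y s) = - (r1 (E 2 y) s * r0 (E 3 y) s).
  by rewrite -[m2 _ _]/(w01 (E 2 y) (E 3 y) s) /w01 s0'; ring.
have : 0 < r1 (E 2 y) s * r0 (E 3 y) s by rewrite mulr_gt0.
by lra.
Qed.

(** At a zero minimum of [m2] the minor [w02] vanishes as well. As row 3 has nonzero first entry,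
    rows 2 and 3 are then proportional in the first three columns, so [m3] would vanish. *)
Lemma m2_avoids_zero (x t : R) : 0 < t < 1 ->
  (forall s : R, 0 < s <= 1 -> 0 <= m2 (z s) (wf x s)) ->
  m1 (z t) (wf x t) != 0 -> m3 (z t) (wf x t) != 0 -> m2 (z t) (wf x t) <> 0.
Proof.
move=> t01 nn n1 n3 z2.
have t0 : 0 < t by lra.
have t1 : 0 < 1 - t by lra.
have cE i := fam_ct S i x t.
have [a0 a1 a2 _] := cE 2%N; have [b0 b1 b2 _] := cE 3%N.
have cw : ct (w02 (E 2 x) (E 3 x)) t by rewrite /w02; cts.
have I : nr t (fun s => 0 < s < 1).
  by apply: nr_imp (nr_I (nr_itv t t0) (nr_itv t t1)) => s; lra.
have wct : forall s, ct (w01 (E 2 x) (E 3 x)) s.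
  by move=> s; exact: (w01_ct (fam_ct S 2 x s) (fam_ct S 3 x s)).
have dvE s : 0 < s < 1 -> s != x ->
    dv (w01 (E 2 x) (E 3 x)) s (k2 c s * w02 (E 2 x) (E 3 x) s) /\ 0 < k2 c s.
  move=> s01 sx; split; last by have [] := sp_c S s01.
  exact: w01_dv (fam_dv S 2 s01 sx) (fam_dv S 3 s01 sx).
have e02 : w02 (E 2 x) (E 3 x) t = 0.
  have [p|n|//] := ltgtP 0 (w02 (E 2 x) (E 3 x) t).
  - have /nr_incr H : nr t (fun s => ct (w01 (E 2 x) (E 3 x)) s /\
        (s != x -> exists2 d, dv (w01 (E 2 x) (E 3 x)) s d & 0 < d)).
      apply: nr_imp (nr_I (nr_ct cw p) I) => s [ps s01]; split;
        [exact: wct|move=> /(dvE s s01)[d q]].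
      by eexists; [exact: d|rewrite mulr_gt0].
    have [d d0 Hd] := nr_I H I; have dd : t - d < t - d / 2 < t + d by lra.
    have [[H1 _] s01] := Hd _ dd; have := H1 ltac:(lra).
    rewrite [X in _ < X]z2 ltNge -[w01 _ _ _]/(m2 (z (t - d / 2)) (wf x (t - d / 2))) nn//.
    by lra.
  - have n' : 0 < - w02 (E 2 x) (E 3 x) t by rewrite oppr_gt0.
    have /nr_decr H : nr t (fun s => ct (w01 (E 2 x) (E 3 x)) s /\
        (s != x -> exists2 d, dv (w01 (E 2 x) (E 3 x)) s d & d < 0)).
      apply: nr_imp (nr_I (nr_ct (ctN cw) n') I) => s [ps s01]; split;
        [exact: wct|move=> /(dvE s s01)[d q]].
      by eexists; [exact: d|rewrite pmulr_rlt0// -oppr_gt0].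
    have [d d0 Hd] := nr_I H I; have dd : t - d < t + d / 2 < t + d by lra.
    have [[_ H1] s01] := Hd _ dd; have := H1 ltac:(lra).
    rewrite [X in _ < X]z2 ltNge -[w01 _ _ _]/(m2 (z (t + d / 2)) (wf x (t + d / 2))) nn//.
    by lra.
have e01 : w01 (E 2 x) (E 3 x) t = 0 by exact: z2.
have e12 : w12 (E 2 x) (E 3 x) t = 0.
  apply: (@mulfI _ (r0 (E 3 x) t)); first exact: n1.
  rewrite mulr0; transitivity (r1 (E 3 x) t * w02 (E 2 x) (E 3 x) t
    - r2 (E 3 x) t * w01 (E 2 x) (E 3 x) t); last by rewrite e02 e01; ring.
  by rewrite /w12 /w02 /w01; ring.
move/eqP: n3; apply.
rewrite -[m3 _ _]/(W012 (E 1 x) (E 2 x) (E 3 x) t) /W012 e01 e02 e12; ring.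
Qed.

(** For z = w = -1 the frame at time 1 is the identity, and backwards in time its corner entry is
    negative. *)
Lemma minus_one_end_neg (x : R) : 0 <= x -> wf x 1 = qopp qone' ->
  exists2 s, 0 < s < 1 & m1 (z s) (wf x s) < 0.
Proof.
move=> x0 w1.
have [h h0 H] : nr2 x 1 (fun x t => leading (E 0 x) (E 1 x) (E 2 x) (E 3 x) t).
  apply: (nr2_leading S); rewrite w1 (sp_z1 S).
  rewrite /leading /det4 /W012 /w01 /w02 /w12 /=.
  by split; rewrite ?(mulr0, mul0r, subr0, addr0, mulr1, add0r, oppr0, mulrN, mulNr, opprK) ltr01.
have [k [k0 kh k1]] : exists k : R, [/\ 0 < k, k < h & k < 1].
  by have [h1|h1] := leP h 1; [exists (h / 2)|exists (1 / 2)]; split; lra.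
pose s := 1 - k; have s0 : 0 <= s by rewrite /s; lra.
have up : upper (E 0 x) (E 1 x) (E 2 x) (E 3 x) 1.
  pose upq (u v : @quatn R) := upper (cr 0 u v) (cr 1 u v) (cr 2 u v) (cr 3 u v) 0.
  suff : upq (z 1) (wf x 1) by [].
  rewrite (sp_z1 S) w1.
  by rewrite /upq /upper /=; split; split; ring.
have ss : s <= s < 1 by rewrite lexx /s; lra.
have [|[n _ _] _] := rows_neg (fam_posc S (x := x) s0 (lexx 1)) (fam_sol S 0 x s0 (lexx 1))
  (fam_sol S 1 x s0 (lexx 1)) (fam_sol S 2 x s0 (lexx 1)) (fam_sol S 3 x s0 (lexx 1)) _ up ss.
  by move=> u us; apply: H; move: us; rewrite /s; lra.
by exists s => //; rewrite /s; lra.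
Qed.

End Deform.

(** * Failure of positivity at time 1 *)

Section End.
Context {R : realType}.
Variables (z w : R -> @quatn R) (c : @coef R) (th : R -> R).
Hypothesis S : spin_path z w c th.

Local Notation wf := (wfam w th).
Local Notation E := (fam z w th).

Lemma end_values (v : @quatn R) : let z1 := qopp qone' in
  [/\ m1 z1 v = qd v, m2 z1 v = qc v ^+ 2 + qd v ^+ 2 & m3 z1 v = qd v * nrm v] /\
  [/\ r1 (cr 3 z1 v) 0 = qc v, r2 (cr 3 z1 v) 0 = - qb v,
      r2 (cr 0 z1 v) 0 = - qc v & r1 (cr 0 z1 v) 0 = - qb v].
Proof.
by split; split; rewrite /m1 /m2 /m3 /W012 /w01 /w02 /w12 /nrm /=; ring.
Qed.

Let left_mono (f g : R -> R) b (x : R) : (forall s, ct f s) -> ct g 1 -> 0 < g 1 ->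
  nr 1 (fun s => s < 1 -> s != x -> 0 < g s -> exists2 d, dv f s d & 0 < d) ->
  f 1 = b -> nr 1 (fun s => s < 1 -> f s < b).
Proof.
move=> cf cg g1 df <-; have [h h0 H] := nr_I (nr_ct cg g1) df.
exists h => // s sh s1; apply: (@mono _ x) => // u us ux.
have uh : 1 - h < u < 1 + h by lra.
by have [gu H'] := H u uh; apply: H' => //; lra.
Qed.

(** Expanding backwards from t = 1: with [qd = 0], a positive [qc] makes [m1] negative just before 1
    and a negative one makes [m3] negative; once [qc = 0], the same alternative holds for [qb]. So
    w(1) is 1 or -1, and -1 is excluded by [minus_one_end_neg]. *)
Lemma end_eq_one (x : R) : 0 <= x ->
  (forall s, 0 < s < 1 -> 0 < m1 (z s) (wf x s)) ->
  (forall s, 0 < s < 1 -> 0 < m3 (z s) (wf x s)) ->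
  qd (wf x 1) = 0 -> wf x 1 = qone'.
Proof.
move=> x0 p1 p3 d0.
have [_ []] := end_values (wf x 1); rewrite -(sp_z1 S) => v1 v2 v3 v4.
have nw := nrm_wfam S x 1; have nz s := sp_nz S s; have nws s := nrm_wfam S x s.
have e1 : r0 (E 3 x) 1 = 0.
  have [[+ _ _] _] := end_values (wf x 1); rewrite -(sp_z1 S) d0; apply.
have p3' s : 0 < s < 1 -> r3 (E 0 x) s < 0.
  by move=> /p3; rewrite m3E// oppr_gt0.
have e3 : r3 (E 0 x) 1 = 0.
  have [[_ _ +] _] := end_values (wf x 1); rewrite -(sp_z1 S) m3E// d0 mul0r.
  by move/eqP; rewrite oppr_eq0 => /eqP.
have cE i s := fam_ct S i x s.
have near1 : nr (1 : R) (fun s => 0 < s) by exists 1 => // s; lra.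
have dE i s : 0 < s -> s < 1 -> s != x -> row_dv (cfam c x) (E i x) s /\
    [/\ 0 < k1 (cfam c x) s, 0 < k2 (cfam c x) s & 0 < k3 (cfam c x) s].
  move=> s0 s1 sx; have s01 : 0 < s < 1 by rewrite s0.
  by split; [exact: fam_dv|exact: (fam_posc S (lexx 0) (lexx 1))].
have gc : qc (wf x 1) = 0.
  have [p|n|//] := ltgtP 0 (qc (wf x 1)).
  - have [h h0 H] : nr 1 (fun s => s < 1 -> r0 (E 3 x) s < 0).
      apply: (@left_mono _ (r1 (E 3 x)) _ x) => //.
      + by move=> s; have [] := cE 3%N s.
      + by have [] := cE 3%N 1.
      + by rewrite [r1 _ _]v1.
      + apply: nr_imp near1 => s s0 s1 sx q.
        have [[d _ _ _] [q1 _ _]] := dE 3%N s s0 s1 sx.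
        by eexists; [exact: d|rewrite mulr_gt0].
    have [k k0 K] := nr_I near1 (ex_intro2 _ _ h h0 H).
    have kk : 1 - k < 1 - k / 2 < 1 + k by lra.
    have [s0 H'] := K _ kk; have := p1 (1 - k / 2); have := H' ltac:(lra).
    by rewrite /m1 -/(r0 (E 3 x) _) => a b; have := b ltac:(lra); rewrite ltNge ltW.
  - have [h h0 H] : nr 1 (fun s => s < 1 -> - r3 (E 0 x) s < 0).
      apply: (@left_mono _ (r2 (E 0 x)) _ x) => //.
      + by move=> s; have [] := cE 0%N s => _ _ _ ?; cts.
      + by have [] := cE 0%N 1.
      + by rewrite [r2 _ _]v3 oppr_gt0.
      + apply: nr_imp near1 => s s0 s1 sx q.
        have [[_ _ _ d] [_ _ q1]] := dE 0%N s s0 s1 sx.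
        by eexists; [exact: (dvN d)|rewrite opprK mulr_gt0].
      + by rewrite e3 oppr0.
    have [k k0 K] := nr_I near1 (ex_intro2 _ _ h h0 H).
    have kk : 1 - k < 1 - k / 2 < 1 + k by lra.
    have [s0 H'] := K _ kk; have := p3' (1 - k / 2); have := H' ltac:(lra).
    by move=> a b; have := b ltac:(lra); lra.
have f0 : qb (wf x 1) = 0.
  have [p|n|//] := ltgtP 0 (qb (wf x 1)).
  - have H0 : nr 1 (fun s => s < 1 -> - r1 (E 3 x) s < 0).
      apply: (@left_mono _ (fun s => - r2 (E 3 x) s) _ x) => //.
      + by move=> s; have [] := cE 3%N s => _ ? _ _; cts.
      + by have [] := cE 3%N 1 => _ _ ? _; cts.
      + by rewrite [r2 _ _]v2 opprK.
      + apply: nr_imp near1 => s s0 s1 sx q.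
        have [[_ d _ _] [q1 q2 _]] := dE 3%N s s0 s1 sx.
        eexists; first exact: (dvN d).
        have s01 : 0 < s < 1 by rewrite s0.
        by have := mulr_gt0 q2 q; have := mulr_gt0 q1 (p1 s s01); rewrite /m1 /=; lra.
      + by rewrite [r1 _ _]v1 gc oppr0.
    have [h h0 H] := nr_I H0 near1.
    have : r0 (E 3 x) (1 - Num.min h 1 / 2) < r0 (E 3 x) 1.
      have [mh m1 m0] : [/\ Num.min h 1 <= h, Num.min h 1 <= 1 & 0 < Num.min h 1].
        by rewrite !ge_min !lexx orbT lt_min h0 ltr01.
      apply: (@mono _ x); first lra.
      + by move=> u _; have [] := cE 3%N u.
      + move=> u us ux; have uh : 1 - h < u < 1 + h by lra.
        have [a u0] := H u uh; have u1 : u < 1 by lra.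
        have [[d _ _ _] [q1 _ _]] := dE 3%N u u0 u1 ux.
        eexists; first exact: d.
        by rewrite mulr_gt0// -oppr_lt0 a.
    rewrite e1 ltNge ltW//; apply: p1.
    by have [|] := leP h 1; lra.
  - have H0 : nr 1 (fun s => s < 1 -> - r2 (E 0 x) s < 0).
      apply: (@left_mono _ (r1 (E 0 x)) _ x) => //.
      + by move=> s; have [] := cE 0%N s => _ _ ? _; cts.
      + by have [] := cE 0%N 1.
      + by rewrite [r1 _ _]v4 oppr_gt0.
      + apply: nr_imp near1 => s s0 s1 sx q.
        have [[_ _ d _] [_ q2 q3]] := dE 0%N s s0 s1 sx.
        eexists; first exact: (dvN d).
        have s01 : 0 < s < 1 by rewrite s0.
        have a : 0 < - r3 (E 0 x) s by rewrite oppr_gt0 p3'.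
        by have := mulr_gt0 q2 q; have := mulr_gt0 q3 a; lra.
      + by rewrite [r2 _ _]v3 gc !oppr0.
    have [h h0 H] := nr_I H0 near1.
    have : r3 (E 0 x) 1 < r3 (E 0 x) (1 - Num.min h 1 / 2).
      have [mh m1 m0] : [/\ Num.min h 1 <= h, Num.min h 1 <= 1 & 0 < Num.min h 1].
        by rewrite !ge_min !lexx orbT lt_min h0 ltr01.
      apply: (@dec _ x); first lra.
      + by move=> u _; have [] := cE 0%N u.
      + move=> u us ux; have uh : 1 - h < u < 1 + h by lra.
        have [a u0] := H u uh; have u1 : u < 1 by lra.
        have [[_ _ _ d] [_ _ q1]] := dE 0%N u u0 u1 ux.
        eexists; first exact: d.
        by rewrite oppr_lt0 mulr_gt0// -oppr_lt0 a.
    rewrite e3 ltNge ltW//; apply: p3'.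
    by have [|] := leP h 1; lra.
have a2 : qa (wf x 1) ^+ 2 = 1.
  by have := nw; rewrite /nrm f0 gc d0 !expr0n !addr0.
have /eqP : (qa (wf x 1) - 1) * (qa (wf x 1) + 1) = 0 by rewrite -subr_sqr_1 a2; ring.
have eta v : v = Qn (qa v) (qb v) (qc v) (qd v) :> @quatn R by case: v.
rewrite mulf_eq0 subr_eq0 addr_eq0 => /orP[/eqP e|/eqP e].
  by rewrite [LHS]eta e f0 gc d0.
have [|s s01] := @minus_one_end_neg R z w c th S x x0.
  by rewrite [LHS]eta e f0 gc d0 /qopp /= oppr0.
by rewrite ltNge ltW// p1.
Qed.

End End.

(** * The frame cannot end at minus the identity *)

Section Persist.
Context {R : realType}.

Definition nrow (A : @row R) := Row (fun t => - r0 A t) (fun t => - r1 A t)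
  (fun t => - r2 A t) (fun t => - r3 A t).

Lemma nrow_ct A t : row_ct A t -> row_ct (nrow A) t.
Proof. by move=> [? ? ? ?]; split; apply: ctN. Qed.

Lemma nrow_sol c x a b A : sol c x a b A -> sol c x a b (nrow A).
Proof.
move=> [cA dA]; split=> t h; first exact/nrow_ct/cA.
by move=> tx; have [? ? ? ?] := dA t h tx; split; rewrite /=; dvr.
Qed.

(** Signs that [rows_neg] provides, for the negated rows, just before a time at which the frame is
    minus the identity. *)
Definition neg_cone (A B C D : @row R) t :=
  [/\ 0 < r0 C t, 0 < - w01 A C t & 0 < w01 A D t] /\
  0 < w01 B C t /\ 0 < W012 A C D t.

(* Near minus the identity, the sign pattern of [neg_cone] cannot be lost while
   the three lower left minors keep their signs, because
   (L20 - L10 L21) (L31 - L21 L32) = p23 + L21 w123. *)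
Lemma neg_cone_closed (A B C D : @row R) t : leading A B C D t ->
  r0 D t < 0 -> 0 < w01 C D t -> W012 B C D t < 0 ->
  [/\ 0 <= r0 C t, 0 <= - w01 A C t & 0 <= w01 A D t] /\
  0 <= w01 B C t /\ 0 <= W012 A C D t -> neg_cone A B C D t.
Proof.
move=> ld; have [[e21 e31 e12 e23] [e32 e023 e123]] := LU_minors ld.
have [a0 a1 a2 _] := ld.
rewrite /neg_cone e21 e31 e12 e23 e023 e123.
have C0 : r0 C t = r0 A t * l20 (LU A B C D) t by rewrite /= mulrC divfK ?gt_eqF.
have D0 : r0 D t = r0 A t * l30 (LU A B C D) t by rewrite /= mulrC divfK ?gt_eqF.
rewrite C0 D0 oppr_ge0 oppr_gt0.
rewrite !(pmulr_rgt0 _ a0) !(pmulr_rgt0 _ a1) !(pmulr_rgt0 _ a2).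
rewrite !(pmulr_rlt0 _ a0) !(pmulr_rlt0 _ a1) !(pmulr_rlt0 _ a2).
rewrite !(pmulr_rge0 _ a0) !(pmulr_rge0 _ a1) !(pmulr_rge0 _ a2) (pmulr_rle0 _ a1).
set L := LU A B C D => d0 p w [[h1 h2 h3] [h4 h5]].
have q1 : 0 <= l30 L t * l21 L t by rewrite mulr_le0// ltW.
have q2 : 0 < l20 L t * l31 L t by move: p; rewrite /p23; lra.
have q3 : 0 <= l21 L t * w123 L t by rewrite mulr_le0// ltW.
have q4 : p12 L t * w023 L t = p23 L t + l21 L t * w123 L t.
  by rewrite /p12 /w023 /p23 /w123 /w023; ring.
have q5 : 0 < p12 L t * w023 L t by rewrite q4; lra.
have pos (u v : R) : 0 <= u -> 0 <= v -> 0 < u * v -> 0 < u /\ 0 < v.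
  move=> u0 v0 uv; have u1 : u != 0 by apply: contraTneq uv => ->; rewrite mul0r ltxx.
  have v1 : v != 0 by apply: contraTneq uv => ->; rewrite mulr0 ltxx.
  by rewrite !lt_def u1 v1 u0 v0.
have [l20p l31p] := pos _ _ h1 h3 q2; have [p12p w023p] := pos _ _ h4 h5 q5.
split; split => //.
rewrite lt_neqAle h2 andbT; apply: contraTneq p12p => e.
by rewrite /p12 e mulr0 sub0r oppr_gt0 -leNgt ltW.
Qed.

Variables (z w : R -> @quatn R) (c : @coef R) (th : R -> R).
Hypothesis S : spin_path z w c th.

Local Notation wf := (wfam w th).
Local Notation E := (fam z w th).
Local Notation N i x := (nrow (E i x)).

(** Shortly before time 1, at some s, the negated frame lies in the open cone [neg_cone], and so
    does the frame of a parameter y just below x. For y all minors are positive, so the cone is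
    never left up to time 1; there two complementary minors would be positive although their sum is
    <gamma_l(1), k> = 0. *)
Lemma end_one_absurd (x : R) : 0 < x -> x <= 1 -> wf x 1 = qone' ->
  (forall y s : R, 0 <= y < x -> 0 < s <= 1 -> good z w th y s) -> False.
Proof.
move=> x0 x1 w1 gd.
have C i t := cr_ct i (z_ct2 S (x, t)) (wfam_ct2 S (x, t)).
have CN i t : [/\ ct (fun p => r0 (N i p.1) p.2) (x, t), ct (fun p => r1 (N i p.1) p.2) (x, t),
    ct (fun p => r2 (N i p.1) p.2) (x, t) & ct (fun p => r3 (N i p.1) p.2) (x, t)].
  by have [? ? ? ?] := C i t; split; apply: ctN.
have [a0 a1 a2 a3] := CN 0%N 1; have [b0 b1 b2 b3] := CN 1%N 1.
have [c0 c1 c2 c3] := CN 2%N 1; have [d0 d1 d2 d3] := CN 3%N 1.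
have val (F : quatn -> quatn -> R) : F (z 1) (wf x 1) = F (qopp qone') qone'.
  by rewrite (sp_z1 S) w1.
pose crn i u v := nrow (cr i u v).
have h1 : nr2 x 1 (fun x t => 0 < r0 (N 0 x) t).
  apply: (nr2_ct (f := fun p => r0 (N 0 p.1) p.2)); first exact: a0.
  pose F u v := r0 (crn 0%N u v) 0.
  suff : 0 < F (z 1) (wf x 1) by [].
  by rewrite val /F /crn /det4 /W012 /w01 /w02 /w12 /=; lra.
have h2 : nr2 x 1 (fun x t => 0 < w01 (N 0 x) (N 1 x) t).
  apply: (nr2_ct (f := fun p => w01 (N 0 p.1) (N 1 p.1) p.2)).
    by rewrite /w01; cts.
  pose F u v := w01 (crn 0%N u v) (crn 1%N u v) 0.
  suff : 0 < F (z 1) (wf x 1) by [].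
  by rewrite val /F /crn /det4 /W012 /w01 /w02 /w12 /=; lra.
have h3 : nr2 x 1 (fun x t => 0 < W012 (N 0 x) (N 1 x) (N 2 x) t).
  apply: (nr2_ct (f := fun p => W012 (N 0 p.1) (N 1 p.1) (N 2 p.1) p.2)).
    by rewrite /W012 /w01 /w02 /w12; cts.
  pose F u v := W012 (crn 0%N u v) (crn 1%N u v) (crn 2%N u v) 0.
  suff : 0 < F (z 1) (wf x 1) by [].
  by rewrite val /F /crn /det4 /W012 /w01 /w02 /w12 /=; lra.
have h4 : nr2 x 1 (fun x t => 0 < det4 (N 0 x) (N 1 x) (N 2 x) (N 3 x) t).
  apply: (nr2_ct (f := fun p => det4 (N 0 p.1) (N 1 p.1) (N 2 p.1) (N 3 p.1) p.2)).
    by rewrite /det4 /W012 /w01 /w02 /w12; cts.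
  pose F u v := det4 (crn 0%N u v) (crn 1%N u v) (crn 2%N u v) (crn 3%N u v) 0.
  suff : 0 < F (z 1) (wf x 1) by [].
  by rewrite val /F /crn /det4 /W012 /w01 /w02 /w12 /=; lra.
have [h h0 H] : nr2 x 1 (fun x t => leading (N 0 x) (N 1 x) (N 2 x) (N 3 x) t).
  by apply: nr2_imp (nr2_I (nr2_I h1 h2) (nr2_I h3 h4)) => s y [[? ?] [? ?]]; split.
have [k [k0 kh k1]] : exists k : R, [/\ 0 < k, k < h & k < 1].
  by have [hh|hh] := leP h 1; [exists (h / 2)|exists (1 / 2)]; split; lra.
pose s := 1 - k; have s0 : 0 <= s by rewrite /s; lra.
have up : upper (N 0 x) (N 1 x) (N 2 x) (N 3 x) 1.
  pose F u v := upper (crn 0%N u v) (crn 1%N u v) (crn 2%N u v) (crn 3%N u v) 0.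
  suff : F (z 1) (wf x 1) by [].
  by rewrite (sp_z1 S) w1 /F /upper /=; split; split; ring.
have ss : s <= s < 1 by rewrite lexx /s; lra.
have sN i y := nrow_sol (fam_sol S i y s0 (lexx 1)).
have [|[_ n1 n2] [n3 n4 n5]] := rows_neg (fam_posc S (x := x) s0 (lexx 1))
    (sN 0%N x) (sN 1%N x) (sN 2%N x) (sN 3%N x) _ up ss.
  by move=> u us; apply: H; move: us; rewrite /s; lra.
have cy (F : R * R -> R) : ct F (x, s) -> ct (fun y => F (y, s)) x.
  by move=> cF; have cp := @pairl_continuous R x s; exact: ct_comp cp cF.
have [g0 g1 g2 g3] := CN 0%N s; have [i0 i1 i2 i3] := CN 1%N s.
have [j0 j1 j2 j3] := CN 2%N s; have [l0 l1 l2 l3] := CN 3%N s.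
have near5 : nr x (fun y => neg_cone (N 0 y) (N 1 y) (N 2 y) (N 3 y) s).
  have q1 : nr x (fun y => 0 < r0 (N 2 y) s).
    apply: (nr_ct (f := fun y => r0 (N 2 y) s)); last by [].
    by apply: (cy (fun p => r0 (N 2 p.1) p.2)); cts.
  have q2 : nr x (fun y => 0 < - w01 (N 0 y) (N 2 y) s).
    apply: (nr_ct (f := fun y => - w01 (N 0 y) (N 2 y) s)); last by rewrite oppr_gt0.
    by apply: (cy (fun p => - w01 (N 0 p.1) (N 2 p.1) p.2)); rewrite /w01; cts.
  have q3 : nr x (fun y => 0 < w01 (N 0 y) (N 3 y) s).
    apply: (nr_ct (f := fun y => w01 (N 0 y) (N 3 y) s)); last by [].
    by apply: (cy (fun p => w01 (N 0 p.1) (N 3 p.1) p.2)); rewrite /w01; cts.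
  have q4 : nr x (fun y => 0 < w01 (N 1 y) (N 2 y) s).
    apply: (nr_ct (f := fun y => w01 (N 1 y) (N 2 y) s)); last by [].
    by apply: (cy (fun p => w01 (N 1 p.1) (N 2 p.1) p.2)); rewrite /w01; cts.
  have q5 : nr x (fun y => 0 < W012 (N 0 y) (N 2 y) (N 3 y) s).
    apply: (nr_ct (f := fun y => W012 (N 0 y) (N 2 y) (N 3 y) s)); last by [].
    by apply: (cy (fun p => W012 (N 0 p.1) (N 2 p.1) (N 3 p.1) p.2));
      rewrite /W012 /w01 /w02 /w12; cts.
  by apply: nr_imp (nr_I (nr_I (nr_I q1 q2) q3) (nr_I q4 q5)) => y [[[? ?] ?] [? ?]].
have [d dd0 Hd] := nr_I near5 (nr_I (nr_itv x h0) (nr_itv x x0)).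
pose y := x - d / 2.
have yd : x - d < y < x + d by rewrite /y; lra.
have [n0 [yh yx]] := Hd _ yd.
have y0 : 0 <= y < x by move: yx; rewrite /y; lra.
pose f t := Num.min (Num.min (Num.min (r0 (N 2 y) t) (- w01 (N 0 y) (N 2 y) t))
  (w01 (N 0 y) (N 3 y) t)) (Num.min (w01 (N 1 y) (N 2 y) t) (W012 (N 0 y) (N 2 y) (N 3 y) t)).
have fE t : 0 < f t <-> neg_cone (N 0 y) (N 1 y) (N 2 y) (N 3 y) t.
  rewrite /f !lt_min; split; first by move=> /andP[/andP[/andP[? ?] ?] /andP[? ?]].
  by move=> [[-> -> ->] [-> ->]].
have cN i t : row_ct (N i y) t by exact: nrow_ct (fam_ct S i y t).
have cf t : ct f t.
  rewrite /f; apply: ct_min; [apply: ct_min|apply: ct_min].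
  - apply: ct_min; first by have [] := cN 2%N t.
    by apply: ctN; apply: w01_ct.
  - exact: w01_ct.
  - exact: w01_ct.
  - exact: W012_ct.
have [[t ts ft]|nf] := pselect (exists2 t, s <= t <= 1 & f t <= 0).
- have [t' [t's ft' before]] := first_zero cf (ex_intro2 _ _ t ts ft).
  have st' : s < t'.
    rewrite lt_neqAle (proj1 (andP t's)) andbT; apply: contraTneq ft' => <-.
    by rewrite -ltNge; apply/fE.
  have f0 : 0 <= f t'.
    apply: (sgn_lim (cf t')); have dst : 0 < t' - s by rewrite subr_gt0.
    exists (t' - s) => // u us ut; apply: before; lra.
  have t'01 : 0 < t' <= 1 by lra.
  have [m1p m2p m3p] := gd y t' y0 t'01.
  suff : 0 < f t' by rewrite ltNge ft'.
  apply/fE/neg_cone_closed.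
  + by apply: H; [exact: yh|rewrite /s in st'; lra].
  + by rewrite /= oppr_lt0; exact: m1p.
  + by move: m2p; rewrite /m2 /w01 /= !mulrNN.
  + rewrite (_ : W012 _ _ _ _ = - m3 (z t') (wf y t')) ?oppr_lt0//.
    by rewrite /m3 /W012 /w01 /w02 /w12 /=; ring.
  + by move: f0; rewrite /f !le_min => /andP[/andP[/andP[? ?] ?] /andP[? ?]].
- have /fE[[_ _ h03] [h12 _]] : 0 < f 1.
    by rewrite ltNge; apply/negP => f1; apply: nf; exists 1 => //; rewrite /s; lra.
  have q : qb (z 1) * qd (z 1) - qa (z 1) * qc (z 1) = 0.
    by rewrite (sp_z1 S) /=; ring.
  have e := u_minors (z 1) (wf y 1); rewrite q mulr0 mul0r in e.
  have e1 : w01 (N 0 y) (N 3 y) 1 = w01 (cr 0 (z 1) (wf y 1)) (cr 3 (z 1) (wf y 1)) 0.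
    by rewrite /w01 /= !mulrNN.
  have e2 : w01 (N 1 y) (N 2 y) 1 = w01 (cr 1 (z 1) (wf y 1)) (cr 2 (z 1) (wf y 1)) 0.
    by rewrite /w01 /= !mulrNN.
  by rewrite e1 in h03; rewrite e2 in h12; lra.
Qed.

End Persist.

(** * The fully deformed frame, with w = e^(theta k) *)

Section Base.
Context {R : realType}.
Variables (z w : R -> @quatn R) (c : @coef R) (th : R -> R).
Hypothesis S : spin_path z w c th.

Local Notation wf := (wfam w th).
Local Notation E := (fam z w th).

Lemma wfam0 t : 0 <= t -> wf 0 t = Qn (cos (th t)) 0 0 (sin (th t)).
Proof.
move=> t0; rewrite /wfam min_l// (sp_w0 S) (sp_th0 S) subr0 /rot /=.
by congr Qn; ring.
Qed.

Lemma base_m1 t : 0 <= t ->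
  m1 (z t) (wf 0 t) = qd (z t) * cos (th t) - qa (z t) * sin (th t).
Proof. by move=> t0; rewrite /m1 wfam0//=; ring. Qed.

Lemma base_m3 t : 0 <= t -> m3 (z t) (wf 0 t) = m1 (z t) (wf 0 t).
Proof.
move=> t0; rewrite m3E ?(sp_nz S) ?(nrm_wfam S)// base_m1//.
by rewrite wfam0//=; ring.
Qed.

(** The parenthesis is <gamma_l, i>, so positivity means <gamma_l, i> > cos(2 theta). *)
Lemma base_m2 t : 0 <= t -> m2 (z t) (wf 0 t) =
  ((qa (z t) ^+ 2 + qb (z t) ^+ 2 - qc (z t) ^+ 2 - qd (z t) ^+ 2) - cos (th t + th t)) / 2.
Proof.
move=> t0; rewrite cosD; have n := sp_nz S t; rewrite /nrm in n.
have e := cos2Dsin2 (th t).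
rewrite /m2 /w01 wfam0//=; move: n e.
set a := qa _; set b := qb _; set c1 := qc _; set d := qd _.
set C := cos _; set D := sin _ => n e.
have e1 : a ^+ 2 + b ^+ 2 = 1 - (c1 ^+ 2 + d ^+ 2) by lra.
have e2 : D ^+ 2 = 1 - C ^+ 2 by lra.
have -> : a ^+ 2 + b ^+ 2 - c1 ^+ 2 - d ^+ 2 - (C * C - D * D) =
  (a ^+ 2 + b ^+ 2) - (c1 ^+ 2 + d ^+ 2) - C ^+ 2 + D ^+ 2 by ring.
rewrite [LHS](_ : _ = (a ^+ 2 + b ^+ 2) * D ^+ 2 - (c1 ^+ 2 + d ^+ 2) * C ^+ 2); last by ring.
by rewrite e1 e2; field.
Qed.

Lemma th_incr s t : 0 <= s -> s < t -> t <= 1 -> th s < th t.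
Proof.
move=> s0 st t1; apply: (@mono _ s) => // [u _|u us _]; first exact: (sp_th S (t := u)).
have u01 : 0 < u < 1 by lra.
by exists (k2 c u / 2); [exact: (sp_dth S u01)|have [_ h _] := sp_c S u01; lra].
Qed.

Lemma th_gt0 t : 0 < t <= 1 -> 0 < th t.
Proof. by move=> /andP[t0 t1]; rewrite -(sp_th0 S); exact: th_incr. Qed.

(** Near 0 this follows from [m1 > 0]; at a later zero of [qd] the two quantities of (D) would be
    opposite numbers. *)
Lemma qd_gt0 t : 0 < t < 1 -> 0 < qd (z t).
Proof.
move=> t01; have [e e0 gd] := good_near0 S.
have cz u : ctq z u := sp_z S u.
have ct0 : ct th 0 := sp_th S (t := 0).
have n1 : nr 0 (fun s => 0 < cos (th s)).
  by apply: nr_ct; [exact: ct_cos|rewrite (sp_th0 S) cos0].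
have n2 : nr 0 (fun s => 0 < qa (z s)).
  by apply: nr_ct; [have [] := cz 0|rewrite (sp_z0 S)].
have n3 : nr 0 (fun s => 0 < pi - th s).
  by apply: nr_ct; [cts|rewrite (sp_th0 S) subr0 pi_gt0].
have [h h0 H] := nr_I (nr_I n1 n2) n3.
have [s [s0 st se sh]] : exists s, [/\ 0 < s, s < t, s < e & s < h].
  exists (Num.min t (Num.min e h) / 2).
  have : 0 < Num.min t (Num.min e h) by rewrite !lt_min e0 h0 (proj1 (andP t01)).
  have : Num.min t (Num.min e h) <= t /\ Num.min t (Num.min e h) <= e /\
      Num.min t (Num.min e h) <= h by rewrite !ge_min !lexx !orbT.
  by move=> [? [? ?]] ?; split; lra.
have [[C A] P] : (0 < cos (th s) /\ 0 < qa (z s)) /\ 0 < pi - th s by apply: H; lra.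
have s01 : 0 < s <= 1 by lra.
have thp := th_gt0 s01.
have ds : 0 < qd (z s).
  have [|+ _ _] := gd 0 s (lexx 0); first lra.
  rewrite base_m1 ?ltW// => m.
  have : 0 < qa (z s) * sin (th s) by apply: mulr_gt0 => //; apply: sin_gt0_pi; lra.
  by move=> h'; rewrite -(pmulr_lgt0 _ C); lra.
rewrite ltNge; apply/negP => dt.
have [|||u us u0] := @ivt_zero _ (fun u => - qd (z u)) s t (ltW st).
- by move=> u _; apply: ctN; have [] := cz u.
- by lra.
- by lra.
have [|p q] := sp_delta S (t := u); first lra.
have d0 : qd (z u) = 0 by lra.
by rewrite d0 mulr0 in p q; lra.
Qed.

(** The two bounds support each other at the first failure: sin(theta) > 0 rules out a zero of [m1],
    and [m1 >= 0] rules out theta = pi. *)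
Lemma base_pos t : 0 < t <= 1 -> th t < pi /\ 0 < m1 (z t) (wf 0 t).
Proof.
move=> t01; have [e e0 gd] := good_near0 S.
pose f s := Num.min (m1 (z s) (wf 0 s)) (pi - th s).
have cf s : ct f s.
  have ? := sp_th S (t := s).
  by apply: ct_min; [exact: m1_ct (sp_z S s) (wfam_ct S 0 s)|cts].
suff : 0 < f t by rewrite lt_min subr_gt0 => /andP[].
have cth0 : ct th 0 := sp_th S (t := 0).
have [h h0 H] : nr 0 (fun s => 0 < pi - th s).
  by apply: nr_ct; [cts|rewrite (sp_th0 S) subr0 pi_gt0].
have [k [k0 ke kh k1]] : exists k, [/\ 0 < k, k < e, k < h & k < 1].
  exists (Num.min 1 (Num.min e h) / 2).
  have : 0 < Num.min (1 : R) (Num.min e h) by rewrite !lt_min e0 h0 ltr01.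
  have : Num.min 1 (Num.min e h) <= 1 /\ Num.min 1 (Num.min e h) <= e /\
      Num.min 1 (Num.min e h) <= h by rewrite !ge_min !lexx !orbT.
  by move=> [? [? ?]] ?; split; lra.
have fk s : 0 < s <= k -> 0 < f s.
  move=> sk; rewrite lt_min; apply/andP; split; last by apply: H; lra.
  by have [|] := gd 0 s (lexx 0); first lra.
rewrite ltNge; apply/negP => ft.
have kt : k <= t by rewrite leNgt; apply/negP => tk; move: ft; rewrite leNgt fk//; lra.
have [|s [ks fs before]] := @first_zero _ f k 1 cf; first by exists t => //; lra.
have s0 : 0 < s by lra.
have s0' : 0 <= s by lra.
have {}before u : 0 < u < s -> 0 < f u.
  by move=> us; have [uk|ku] := leP u k; [apply: fk; lra|apply: before; lra].
have lim (g : R -> R) : ct g s -> (forall u : R, 0 < u < s -> 0 < g u) -> 0 <= g s.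
  move=> cg gp; apply: (sgn_lim cg); exists s => // u us ut; apply: gp; lra.
have ms : 0 <= m1 (z s) (wf 0 s).
  apply: (lim (fun s => m1 (z s) (wf 0 s))).
    exact: m1_ct (sp_z S s) (wfam_ct S 0 s).
  by move=> u /before; rewrite lt_min => /andP[].
have ps : 0 <= pi - th s.
  apply: (lim (fun s => pi - th s)); first by (have ? := sp_th S (t := s)); cts.
  by move=> u /before; rewrite lt_min => /andP[].
have ths : 0 < th s by apply: th_gt0; lra.
(* At theta = pi the minor equals [- qd], which is negative before time 1; at time 1 it would mean w
   = -1. *)
have [spi|spi] := eqVneq (th s) pi.
  have [s1|s1] := eqVneq s 1.
    rewrite s1 in spi; have [|u u01] := minus_one_end_neg S (lexx 0).
      by rewrite wfam0 ?ler01// spi cospi sinpi /qopp /= oppr0.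
    move=> m1u; have := before u; rewrite s1 => /(_ u01).
    by rewrite lt_min => /andP[]; lra.
  have s1' : 0 < s < 1 by rewrite s0 lt_neqAle s1; case/andP: ks.
  have := qd_gt0 s1'; move: ms; rewrite base_m1// spi cospi sinpi; lra.
have {spi}ps : th s < pi by rewrite lt_neqAle spi; lra.
have sn : 0 < sin (th s) by apply: sin_gt0_pi; lra.
have [s1|s1] := eqVneq s 1.
  by move: fs; rewrite leNgt lt_min subr_gt0 ps andbT base_m1// s1 (sp_z1 S) /=;
    rewrite s1 in sn; lra.
have s1' : 0 < s < 1 by rewrite s0 lt_neqAle s1; case/andP: ks.
have m0 : m1 (z s) (wf 0 s) = 0.
  apply/eqP; rewrite eq_le ms andbT leNgt; apply/negP => mp.
  by move: fs; rewrite leNgt lt_min mp subr_gt0 ps.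
have d0 := qd_gt0 s1'; have [u0 _] := sp_delta S s1'.
(* Since [m1] vanishes at s, [qd] times this entry reduces to half of <gamma_l, k> times
   sin(theta). *)
have r1p : 0 < r1 (E 3 0) s.
  rewrite -(pmulr_rgt0 _ d0).
  have -> : r1 (E 3 0) s = qb (z s) * sin (th s) - qc (z s) * cos (th s).
    have -> : r1 (E 3 0) s = r1 (cr 3 (z s) (wf 0 s)) 0 by [].
    by rewrite wfam0//=; ring.
  have m0' := m0; rewrite base_m1// in m0'.
  have -> : qd (z s) * (qb (z s) * sin (th s) - qc (z s) * cos (th s)) =
    (qb (z s) * qd (z s) - qa (z s) * qc (z s)) * sin (th s) -
    qc (z s) * (qd (z s) * cos (th s) - qa (z s) * sin (th s)) by ring.
  by rewrite m0' mulr0 subr0 mulr_gt0.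
have [_ cr1 _ _] := fam_ct S 3 0 s.
have n1 := nr_ct cr1 r1p.
have [k' k'0 K] := nr_I n1 (nr_I (nr_itv s s0) (nr_itv s (h := 1 - s) ltac:(lra))).
have : nr s (fun u => (u < s -> r0 (E 3 0) u < r0 (E 3 0) s) /\ (s < u ->
  r0 (E 3 0) s < r0 (E 3 0) u)).
  apply: (@nr_incr _ 0); exists k' => // u /K [r1u [u0' u1]].
  split; first by have [] := fam_ct S 3 0 u.
  move=> un0; have u01 : 0 < u < 1 by lra.
  have [dr _ _ _] := fam_dv S 3 u01 un0; eexists; first exact: dr.
  rewrite mulr_gt0//; have [p1 p2 p3] := sp_c S u01.
  by rewrite /cfam /=; case: ifP => _ //; lra.
move=> /(nr_I (nr_itv s s0))[j j0 J].
have [|q1 [q2 _]] := J (s - j / 2); first lra.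
have : 0 < f (s - j / 2) by apply: before; lra.
rewrite lt_min => /andP[+ _].
have e3 u : r0 (E 3 0) u = m1 (z u) (wf 0 u) by [].
by rewrite -e3; move: q2; rewrite (e3 s) m0; have jj : s - j / 2 < s by [lra]; move=> /(_ jj); lra.
Qed.

(** [F] is the i-coordinate of gamma_l cos(ph) + t_l sin(ph). The angle is chosen to cancel the
    rotation of speed c_2, so F' = (c_1 + c_3) <n_l, i> sin(ph), whose sign is that of sin(ph) by
    (D). *)
Lemma base_m2_pos t : 0 < t <= 1 -> 0 < m2 (z t) (wf 0 t).
Proof.
move=> t01; have t0 : 0 <= t by lra.
have thb u : 0 < u <= 1 -> 0 < th u < pi.
  by move=> u01; rewrite th_gt0// (proj1 (base_pos u01)).
pose h1 u := qa (z u) * qa (z u) + qb (z u) * qb (z u) - qc (z u) * qc (z u) -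
  qd (z u) * qd (z u).
pose h2 u := 2 * (qb (z u) * qc (z u) - qa (z u) * qd (z u)).
pose ph u := th t + th t - (th u + th u).
pose F u := h1 u * cos (ph u) + h2 u * sin (ph u).
have Fct u : ct F u.
  have ? := sp_th S (t := u); have [? ? ? ?] := sp_z S u.
  have cp : ct ph u by rewrite /ph; cts.
  have ? := ct_cos cp; have ? := ct_sin cp.
  by rewrite /F /h1 /h2; cts.
have Fdv u : 0 < u < 1 -> dv F u ((k1 c u + k3 c u) *
   (2 * (qb (z u) * qd (z u) + qa (z u) * qc (z u))) * sin (ph u)).
  move=> u01; have [? ? ? ?] := sp_dz S u01; have dth := sp_dth S u01.
  have dp : dv ph u (- k2 c u).
    by rewrite /ph; eapply dv_eq; [dvs|]; field.
  have ? := dv_cos dp; have ? := dv_sin dp.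
  by rewrite /F /h1 /h2; eapply dv_eq; [dvs|]; rewrite /=; field.
have pu u : 0 < u < 1 -> 0 < (k1 c u + k3 c u) *
   (2 * (qb (z u) * qd (z u) + qa (z u) * qc (z u))).
  move=> u01; have [? _ ?] := sp_c S u01; have [_ ?] := sp_delta S u01.
  by rewrite !mulr_gt0//; lra.
have Ft : F t = h1 t by rewrite /F /ph subrr cos0 sin0; ring.
have th1 : 0 < th 1 < pi by apply: thb; lra.
have tht := thb t t01.
rewrite base_m2// divr_gt0// subr_gt0 !expr2 -/(h1 t) -Ft.
(* When 2 theta exceeds pi, this moves the angle back into [0, pi], where the cosine decreases. *)
have cosE : cos (th t + th t) = cos (pi *+ 2 - (th t + th t)) :> R.
  by rewrite cosB cos2pi (_ : sin (pi *+ 2) = 0) ?mulr2n ?(sinD pi) ?sinpi; ring.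
(* In the first case [ph] stays between 0 and pi on [0,t], and [F 0] is the cosine. In the second it
   stays between -pi and 0 on [t,1], and F is compared with its value at 1, again a cosine because
   z(1) = -1. *)
have [le_pi|gt_pi] := leP (th t + th t) pi.
  have -> : cos (th t + th t) = F 0.
    by rewrite /F /h1 /h2 /ph (sp_z0 S) (sp_th0 S) /=; rewrite addr0 subr0; ring.
  apply: (@mono _ 0) => //; first lra.
  move=> u ut _; have u01 : 0 < u < 1 by lra.
  eexists; first exact: Fdv.
  apply: mulr_gt0; first exact: pu.
  apply: sin_gt0_pi; rewrite /ph.
  have /thb : 0 < u <= 1 by lra.
  have : th u < th t by apply: th_incr; lra.
  lra.
have F1 : F 1 = cos (th 1 + th 1 - (th t + th t)).
  rewrite /F /h1 /h2 /ph (sp_z1 S) /= -cosN opprB; ring.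
have le1 : th t <= th 1.
  have [->|t1] := eqVneq t 1; first by [].
  by apply/ltW/th_incr; rewrite ?lexx// lt_neqAle t1; lra.
have lt1 : cos (th t + th t) < F 1.
  rewrite F1 cosE ltr_cos ?in_itv /=; rewrite ?mulr2n; first lra.
    by apply/andP; split; lra.
  by apply/andP; split; lra.
apply: (lt_le_trans lt1).
apply: (@wdec _ 0); [lra|by []|].
move=> u ut _; have u01 : 0 < u < 1 by lra.
eexists; first exact: Fdv.
apply: ltW; rewrite pmulr_rlt0; last exact: pu.
rewrite -oppr_gt0 -sinN; apply: sin_gt0_pi; rewrite /ph.
have /thb : 0 < u <= 1 by lra.
have : th t < th u by apply: th_incr; lra.
have : th u < th 1 by apply: th_incr; lra.
lra.
Qed.

Lemma base_good t : 0 < t <= 1 -> good z w th 0 t.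
Proof.
move=> t01; have [_ m] := base_pos t01; have t0 : 0 <= t by lra.
by split => //; [exact: base_m2_pos|rewrite base_m3].
Qed.

End Base.

(** * Positivity along the whole family *)

Section Positivity.
Context {R : realType}.

Lemma mirror_m1 (z w : @quatn R) : nrm z = 1 -> nrm w = 1 -> m1 z (mirror w) = m3 z w.
Proof. by move=> nz nw; rewrite m3E// /m1 /=; ring. Qed.

Lemma mirror_m2 (z w : @quatn R) : m2 z (mirror w) = m2 z w.
Proof. by rewrite /m2 /w01 /=; ring. Qed.

Variables (z w : R -> @quatn R) (c : @coef R) (th : R -> R).
Hypothesis S : spin_path z w c th.

Local Notation wf := (wfam w th).

Lemma m3_avoids_zero (x t : R) : 0 < x -> x <= t -> t < 1 ->
  (forall y s : R, 0 <= y < x -> 0 < s <= 1 -> 0 < m3 (z s) (wf y s) /\ 0 < m2 (z s) (wf y s)) ->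
  (forall s : R, 0 < s <= 1 -> 0 <= m3 (z s) (wf x s) /\ 0 <= m2 (z s) (wf x s)) ->
  (forall s : R, 0 < s < t -> 0 < m3 (z s) (wf x s)) -> m3 (z t) (wf x t) <> 0.
Proof.
move=> x0 xt t1 h1 h2 h3.
have e1 y s : m1 (z s) (wfam (fun s => mirror (w s)) th y s) = m3 (z s) (wf y s).
  by rewrite wfam_mirror mirror_m1 ?(sp_nz S) ?(nrm_wfam S).
have e2 y s : m2 (z s) (wfam (fun s => mirror (w s)) th y s) = m2 (z s) (wf y s).
  by rewrite wfam_mirror mirror_m2.
rewrite -e1; apply: (m1_avoids_zero (spin_path_mirror S) x0 xt t1).
- by move=> y s hy hs; rewrite e1 e2; exact: h1.
- by move=> s hs; rewrite e1 e2; exact: h2.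
- by move=> s hs; rewrite e1; exact: h3.
Qed.

Let g (p : R * R) := Num.min (m1 (z p.2) (wf p.1 p.2))
  (Num.min (m2 (z p.2) (wf p.1 p.2)) (m3 (z p.2) (wf p.1 p.2))).

Let gE x t : 0 < g (x, t) <-> good z w th x t.
Proof. by rewrite /g !lt_min; split=> [/andP[? /andP[? ?]]|[-> -> ->]]. Qed.

Let g_ct p : ct g p.
Proof.
have cz := z_ct2 S p; have cw := wfam_ct2 S p.
by apply: ct_min; [exact: m1_ct|apply: ct_min; [exact: m2_ct|exact: m3_ct]].
Qed.

Lemma family_good x t : 0 <= x -> 0 < t <= 1 -> good z w th x t.
Proof.
move=> x0 t01; apply/gE; rewrite ltNge; apply/negP => gxt.
have [e e0 near0] := good_near0 S.
pose k := Num.min e 1 / 2.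
have me : 0 < Num.min e 1 by rewrite lt_min e0 ltr01.
have [mel me1] : Num.min e 1 <= e /\ Num.min e 1 <= 1 by rewrite !ge_min !lexx !orbT.
have k0 : 0 < k by rewrite /k; lra.
have ke : k < e by rewrite /k; lra.
(* Restricts the search to parameters at most the time, which loses nothing since only the minimum
   matters, and to times at least [k], which keeps away from the degenerate time 0. *)
pose f (p : R * R) := Num.max (g p) (Num.max (p.1 - p.2) (k - p.2)).
have cf p : ct f p.
  have c1 : ct (fun p : R * R => p.1) p by exact: cvg_fst.
  have c2 : ct (fun p : R * R => p.2) p by exact: cvg_snd.
  by apply: ct_max; [exact: g_ct|apply: ct_max; cts].
have fle y s : f (y, s) <= 0 <-> [/\ g (y, s) <= 0, y <= s & k <= s].
  rewrite /f !ge_max /= !subr_le0; split; first by move=> /andP[? /andP[? ?]].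
  by move=> [-> -> ->].
have red y s : 0 <= y -> 0 < s <= 1 -> g (y, s) <= 0 -> f (Num.min y s, s) <= 0.
  move=> y0 s01 gys; apply/fle; split; last 1 first.
  - rewrite leNgt; apply/negP => sk; move: gys; rewrite leNgt => /negP; apply.
    by apply/gE/near0 => //; lra.
  - rewrite leNgt; apply/negP => /gE/(good_min z w th y s)/gE.
    by rewrite ltNge gys.
  - by rewrite ge_min lexx orbT.
have mn01 (y s : R) : 0 <= y -> 0 < s <= 1 -> 0 <= Num.min y s <= 1.
  by move=> y0 s01; rewrite le_min y0 ge_min; apply/andP; split; [|apply/orP; right]; lra.
have [|x1 [y1 [x101 y101 /fle[g1 xy ky] mini]]] := square_min cf.
  by exists (Num.min x t), t; split; [exact: mn01|lra|exact: red].
have y1p : 0 < y1 <= 1 by lra.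
have x1p : 0 < x1.
  rewrite lt_neqAle (proj1 (andP x101)) andbT; apply/negP => /eqP x1e.
  have := base_good S y1p; rewrite x1e => /gE; by rewrite ltNge g1.
have below y s : 0 <= y < x1 -> 0 < s <= 1 -> good z w th y s.
  move=> yx s01; have y0 : 0 <= y by lra.
  apply/gE; rewrite ltNge; apply/negP => gys.
  have /= := mini _ s (mn01 y s y0 s01) _ (red y s y0 s01 gys).
  have : Num.min y s <= y by rewrite ge_min lexx.
  by move=> ? h; have : x1 <= Num.min y s by [apply: h; lra]; lra.
have nneg s : 0 < s <= 1 -> [/\ 0 <= m1 (z s) (wf x1 s), 0 <= m2 (z s) (wf x1 s) &
    0 <= m3 (z s) (wf x1 s)].
  move=> s01.
  have lim (m : quatn -> quatn -> R) : ct (fun p : R * R => m (z p.2) (wf p.1 p.2)) (x1, s) ->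
      (forall y, 0 <= y < x1 -> 0 < m (z s) (wf y s)) -> 0 <= m (z s) (wf x1 s).
    move=> cm mp; apply: (@sgn_lim _ (fun y => m (z s) (wf y s))).
      exact: (@ct_comp _ _ _ (fun p : R * R => m (z p.2) (wf p.1 p.2)) (fun y : R => (y,
        s)) x1 (@pairl_continuous R x1 s) cm).
    by apply: nr_imp (nr_itv x1 x1p) => y yx y1x; apply: mp; lra.
  have cz := z_ct2 S (x1, s); have cw := wfam_ct2 S (x1, s).
  split; [apply: (lim m1); first exact: m1_ct|apply: (lim m2); first exact: m2_ct|
    apply: (lim m3); first exact: m3_ct]; by move=> y yx; have [] := below y s yx s01.
have [s [sx gs before]] : exists s, [/\ x1 <= s <= 1, g (x1, s) <= 0 &
    forall u, x1 <= u < s -> 0 < g (x1, u)].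
  apply: (@first_zero _ (fun s => g (x1, s))); last by exists y1 => //; lra.
  move=> u; have cg : ct g (x1, u) by exact: g_ct.
  have cm : {for u, continuous (fun s : R => (x1, s))}.
    have h1 : (fun y : R => y) @ u --> u by exact: cvg_id.
    have h2 : (fun s : R => x1) @ u --> x1 by exact: cvg_cst.
    by have := cvg_pair h2 h1; exact.
  exact: (@ct_comp _ _ _ g (fun s : R => (x1, s)) u cm cg).
have s01 : 0 < s <= 1 by lra.
have {}before u : 0 < u < s -> good z w th x1 u.
  move=> us; have [xu|ux] := leP x1 u; first by apply/gE/before; lra.
  apply/(good_min z w th x1 u); rewrite min_r ?ltW//; apply: below; lra.
have [n1 n2 n3] := nneg s s01.
have [s1|s1] := eqVneq s 1; last first.
  have slt : s < 1 by rewrite lt_neqAle s1; case/andP: s01.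
  have p1 : m1 (z s) (wf x1 s) <> 0.
    apply: (m1_avoids_zero S x1p) => //; first lra.
    - by move=> y u yx u01; have [? ? ?] := below y u yx u01.
    - by move=> u /nneg[].
    - by move=> u /before[].
  have p3 : m3 (z s) (wf x1 s) <> 0.
    apply: m3_avoids_zero => //; first lra.
    - by move=> y u yx u01; have [? ? ?] := below y u yx u01.
    - by move=> u /nneg[].
    - by move=> u /before[].
  have p2 : m2 (z s) (wf x1 s) <> 0.
    apply: (m2_avoids_zero S); [lra|by move=> u /nneg[]|exact/eqP|exact/eqP].
  move: gs; rewrite leNgt => /negP; apply; apply/gE.
  by split; rewrite lt_def ?n1 ?n2 ?n3 andbT; apply/eqP.
rewrite s1 in gs n1 n2 n3 before.
have [[v1 v2 v3] _] := end_values (wf x1 1).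
(* At time 1 the three minors are [qd], [qc ^+ 2 + qd ^+ 2] and [qd], so a failure with nonnegative
   minors means [qd = 0]. *)
have d0 : qd (wf x1 1) = 0.
  apply/eqP; apply: contraT => d0; move: gs; rewrite leNgt => /negP; case; apply/gE.
  split; [rewrite lt_def n1|rewrite lt_def n2|rewrite lt_def n3];
    rewrite andbT (sp_z1 S) ?v1 ?v2 ?v3 ?(nrm_wfam S) ?mulr1//.
  by rewrite paddr_eq0 ?sqr_ge0// negb_and [qd _ ^+ 2 == 0]expf_eq0 d0 orbT.
have x1l : x1 <= 1 by lra.
apply: (end_one_absurd S x1p x1l _ below).
by apply: (end_eq_one S (ltW x1p)) => // u /before[].
Qed.

Lemma minors_pos t : 0 < t < 1 ->
  [/\ 0 < m1 (z t) (w t), 0 < m2 (z t) (w t) & 0 < m3 (z t) (w t)].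
Proof.
move=> t01; have [||] := @family_good 1 t; [exact: ler01|lra|].
by rewrite wfam_le //; lra.
Qed.

End Positivity.

(** * Sign conditions forced by convexity *)

Section Left.
Context {R : realType}.

Record frame_path (z w : R -> @quatn R) (c : @coef R) : Prop := FramePath {
  fp_z : forall t, ctq z t;
  fp_w : forall t, ctq w t;
  fp_nz : forall t, nrm (z t) = 1;
  fp_nw : forall t, nrm (w t) = 1;
  fp_z0 : z 0 = qone';
  fp_w0 : w 0 = qone';
  fp_z1 : z 1 = qopp qone';
  fp_w1 : w 1 = Qn 0 0 0 1;
  fp_c : forall t, 0 < t < 1 -> [/\ 0 < k1 c t, 0 < k2 c t & 0 < k3 c t];
  fp_row : forall i t, 0 < t < 1 -> row_dv c (qrow i z w) t;
  fp_dz : forall t, 0 < t < 1 -> dvq z t (spin (k1 c t + k3 c t) (k2 c t) (z t)) }.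

(* No hyperplane has four contacts, counted with multiplicity, at two points. *)
Definition two_point (z w : R -> @quatn R) := forall (y0 y1 y2 y3 s t : R),
  let A := rcomb y0 y1 y2 y3 (qrow 0 z w) (qrow 1 z w) (qrow 2 z w) (qrow 3 z w) in
  0 < s < 1 -> 0 < t < 1 -> s != t -> r0 A s = 0 -> r1 A s = 0 -> r0 A t = 0 ->
  (r2 A s = 0 \/ r1 A t = 0) -> y0 ^+ 2 + y1 ^+ 2 + y2 ^+ 2 + y3 ^+ 2 = 0.

Lemma ct_ge_left (f : R -> R) t : ct f t -> nr t (fun s => s < t -> 0 <= f s) -> 0 <= f t.
Proof.
move=> cf fs; rewrite -oppr_le0; apply: (ct_le_left (ctN cf)).
by apply: nr_imp fs => s h /h; rewrite oppr_le0.
Qed.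

(** The bounds of [flow_ge] multiplied by the leading minors at [b]; in this form they survive a
    limit in which those minors may tend to 0. *)
Lemma flow_minors c x b (A B C D : @row R) : 0 <= b -> posc c x 0 b ->
  sol c x 0 b A -> sol c x 0 b B -> sol c x 0 b C -> sol c x 0 b D ->
  (forall t, 0 <= t <= b -> leading A B C D t) -> let L := LU A B C D in
  [/\ r0 A b * l10 L 0 <= r0 B b, W012 A B C b * l32 L 0 <= W012 A B D b,
      r0 A b * (l20 L 0 - l21 L 0 * l10 L 0) + l21 L 0 * r0 B b <= r0 C b &
      w01 A B b * (l31 L 0 - l32 L 0 * l21 L 0) + l32 L 0 * w01 A C b <= w01 A D b] /\
  [/\ r0 A b * (l30 L 0 - (l31 L 0 - l32 L 0 * l21 L 0) * l10 L 0 - l32 L 0 * l20 L 0) +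
      (l31 L 0 - l32 L 0 * l21 L 0) * r0 B b + l32 L 0 * r0 C b <= r0 D b,
      w01 A B b * (p12 L 0 - l10 L 0 * l21 L 0) + l10 L 0 * w01 A C b <= w01 B C b,
      W012 A B C b * (w023 L 0 - l21 L 0 * l32 L 0) + l21 L 0 * W012 A B D b <=
        W012 A C D b &
      W012 A B C b * (w123 L 0 + l20 L 0 * l32 L 0 - l10 L 0 * w023 L 0)
        - l20 L 0 * W012 A B D b + l10 L 0 * W012 A C D b <= W012 B C D b].
Proof.
move=> b0 pc sA sB sC sD ld L.
have F : flow x 0 b L by exact: LU_flow pc sA sB sC sD ld.
have bb : 0 <= b <= b by rewrite b0 lexx.
have [[g10 g21 g32] [g20 g31 g30 g12 [g023 g123]]] := flow_ge F bb.
have ldb := ld b bb; have [[e21 e31 e12 e23] [e32 e023 e123]] := LU_minors ldb.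
have [a0 a1 a2 _] := ldb.
have B0 : r0 B b = r0 A b * l10 L b by rewrite /= mulrC divfK ?gt_eqF.
have C0 : r0 C b = r0 A b * l20 L b by rewrite /= mulrC divfK ?gt_eqF.
have D0 : r0 D b = r0 A b * l30 L b by rewrite /= mulrC divfK ?gt_eqF.
rewrite -/L in e21 e31 e12 e32 e023 e123.
rewrite B0 C0 D0 e21 e31 e12 e32 e023 e123; clear B0 C0 D0 e21 e31 e12 e23 e32 e023 e123.
move: a0 a1 a2; set d1 := r0 A b; set d2 := w01 A B b; set d3 := W012 A B C b => a0 a1 a2.
have sc (d X Y Z : R) : 0 < d -> X <= Y -> Z = d * X -> Z <= d * Y.
  by move=> d0 XY ->; rewrite ler_pM2l.
split; split.
- exact: (sc _ _ _ _ a0 g10).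
- exact: (sc _ _ _ _ a2 g32).
- by apply: (sc _ _ _ _ a0 g20); ring.
- by apply: (sc _ _ _ _ a1 g31); ring.
- by apply: (sc _ _ _ _ a0 g30); ring.
- by apply: (sc _ _ _ _ a1 g12); ring.
- by apply: (sc _ _ _ _ a2 g023); ring.
- by apply: (sc _ _ _ _ a2 g123); ring.
Qed.

End Left.

(** * Nonnegative minors of the frame of a convex gamma *)

Section TwoPoint.
Context {R : realType}.
Variables (z w : R -> @quatn R) (c : @coef R).
Hypotheses (P : frame_path z w c) (T : two_point z w).

Local Notation E i := (qrow i z w).

Let dual (f : @row R -> R -> R) s := atrow (E 0) (E 1) (E 2) (E 3) s f.

(* The rows -e_3(s), e_2(s), -e_1(s), e_0(s) applied to the frame. *)
Let A0 s := nrow (dual r3 s).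
Let A1 s := dual r2 s.
Let A2 s := nrow (dual r1 s).
Let A3 s := dual r0 s.

Let E_ct i t : row_ct (E i) t.
Proof. exact: qrow_ct (fp_z P t) (fp_w P t). Qed.

Let E_sol i (a b : R) : 0 <= a -> b <= 1 -> sol c 0 a b (E i).
Proof.
move=> a0 b1; split=> [t _|t tab _]; first exact: E_ct.
by apply: (fp_row P); lra.
Qed.

Let orth t : orthc (E 0) (E 1) (E 2) (E 3) t.
Proof. exact: qrow_orthc (fp_nz P t) (fp_nw P t). Qed.

Let dual_at s : [/\ r0 (A0 s) s = 0, r1 (A0 s) s = 0 & r2 (A0 s) s = 0] /\
  [/\ r0 (A1 s) s = 0, r1 (A1 s) s = 0 & r0 (A2 s) s = 0].
Proof.
have [_ [[e01 e02 e03] [e12 e13 e23]]] := orth s; rewrite /colprod in e01 e02 e03 e12 e13 e23.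
have z0 (x y : R) : y = 0 -> x = - y -> x = 0 by move=> -> ->; rewrite oppr0.
have z1 (x y : R) : y = 0 -> x = y -> x = 0 by move=> -> ->.
split; split; rewrite /=.
- by apply: (z0 _ _ e03); rewrite /=; ring.
- by apply: (z0 _ _ e13); rewrite /=; ring.
- by apply: (z0 _ _ e23); rewrite /=; ring.
- by apply: (z1 _ _ e02); rewrite /=; ring.
- by apply: (z1 _ _ e12); rewrite /=; ring.
- by apply: (z0 _ _ e01); rewrite /=; ring.
Qed.

(** Passing from (a, b, g) to fixed coordinates is an isometry, which turns the conclusion of
    [two_point] into a = b = g = 0. *)
Lemma dual_comb s (a b g : R) : let y f := - a * r3 f s + b * r2 f s - g * r1 f s in
  let A := rcomb (y (E 0)) (y (E 1)) (y (E 2)) (y (E 3)) (E 0) (E 1) (E 2) (E 3) in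
  [/\ forall t, r0 A t = a * r0 (A0 s) t + b * r0 (A1 s) t + g * r0 (A2 s) t,
      forall t, r1 A t = a * r1 (A0 s) t + b * r1 (A1 s) t + g * r1 (A2 s) t,
      forall t, r2 A t = a * r2 (A0 s) t + b * r2 (A1 s) t + g * r2 (A2 s) t &
      y (E 0) ^+ 2 + y (E 1) ^+ 2 + y (E 2) ^+ 2 + y (E 3) ^+ 2 = a ^+ 2 + b ^+ 2 + g ^+ 2].
Proof.
move=> y A; split; [by move=> t; rewrite /A /y /=; ring..|].
have [[e0 e1 e2 e3] [[e01 e02 e03] [e12 e13 e23]]] := orth s.
transitivity (a ^+ 2 * colprod (E 0) (E 1) (E 2) (E 3) r3 r3 s +
  b ^+ 2 * colprod (E 0) (E 1) (E 2) (E 3) r2 r2 s +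
  g ^+ 2 * colprod (E 0) (E 1) (E 2) (E 3) r1 r1 s
  - 2 * a * b * colprod (E 0) (E 1) (E 2) (E 3) r2 r3 s
  + 2 * a * g * colprod (E 0) (E 1) (E 2) (E 3) r1 r3 s
  - 2 * b * g * colprod (E 0) (E 1) (E 2) (E 3) r1 r2 s).
  by rewrite /y /colprod; ring.
by rewrite e1 e2 e3 e12 e13 e23; ring.
Qed.

Let sq0 (a b g : R) : a ^+ 2 + b ^+ 2 + g ^+ 2 = 0 -> a = 0 /\ b = 0 /\ g = 0.
Proof.
move/eqP; rewrite !paddr_eq0 ?addr_ge0 ?sqr_ge0// !expf_eq0 /=.
by move=> /andP[/andP[/eqP-> /eqP->] /eqP->].
Qed.

Let two_point_comb s t u (a b g : R) :
  let F (f : @row R -> R -> R) v := a * f (A0 u) v + b * f (A1 u) v + g * f (A2 u) v in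
  0 < s < 1 -> 0 < t < 1 -> s != t -> F r0 s = 0 -> F r1 s = 0 -> F r0 t = 0 ->
  (F r2 s = 0 \/ F r1 t = 0) -> a = 0 /\ b = 0 /\ g = 0.
Proof.
move=> F s01 t01 st h1 h2 h3 h4; have [q0 q1 q2 q3] := dual_comb u a b g.
by apply: sq0; rewrite -q3; apply: (T s01 t01 st); rewrite ?q0 ?q1 ?q2.
Qed.

(** A zero leading minor of size 1, 2 or 3 gives a combination of -e_3(s), e_2(s), -e_1(s) with four
    contacts: three at s and one at t, two at each, or one at s and three at t. *)
Let leading_neq0 s t : 0 < s < 1 -> 0 < t < 1 -> s != t ->
  [/\ r0 (A0 s) t != 0, w01 (A0 s) (A1 s) t != 0 & W012 (A0 s) (A1 s) (A2 s) t != 0].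
Proof.
move=> s01 t01 st; have [[d00 d01 d02] [d10 d11 d20]] := dual_at s.
have ts : t != s by rewrite eq_sym.
have h0 : r0 (A0 s) t != 0.
  apply/eqP => e; suff [/eqP] : 1 = 0 :> R /\ 0 = 0 :> R /\ 0 = 0 :> R by rewrite oner_eq0.
  apply: (two_point_comb (u := s) s01 t01 st); last left.
  - by rewrite d00; ring.
  - by rewrite d01; ring.
  - by rewrite e; ring.
  - by rewrite d02; ring.
have h1 : w01 (A0 s) (A1 s) t != 0.
  apply/eqP => e; have /(_ (r0 (A1 s) t) (- r0 (A0 s) t) 0) := two_point_comb (u := s) s01 t01 st.
  rewrite d00 d01 d10 d11 => h.
  suff [_ [/eqP + _]] : r0 (A1 s) t = 0 /\ - r0 (A0 s) t = 0 /\ 0 = 0 :> R.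
    by rewrite oppr_eq0 (negbTE h0).
  apply: h; [ring|ring|ring|right].
  rewrite [LHS](_ : _ = - w01 (A0 s) (A1 s) t); first by rewrite e oppr0.
  by rewrite /w01; ring.
split => //; apply/eqP => e.
(* Cofactors with respect to the third column: the combination has zero first two coordinates at t,
   and its third is the minor [W012]. *)
have /(_ (w01 (A1 s) (A2 s) t) (- w01 (A0 s) (A2 s) t) (w01 (A0 s) (A1 s) t)) :=
  two_point_comb (u := s) t01 s01 ts.
rewrite d00 d10 d20 => h.
suff [_ [_ /eqP]] : w01 (A1 s) (A2 s) t = 0 /\ - w01 (A0 s) (A2 s) t = 0 /\
  w01 (A0 s) (A1 s) t = 0 by rewrite (negbTE h1).
apply: h; [by rewrite /w01; ring|by rewrite /w01; ring|ring|left].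
by rewrite -e /W012 /w12 /w02 /w01; ring.
Qed.

Let det_one s t : 0 < s < 1 -> 0 <= t <= s -> det4 (A0 s) (A1 s) (A2 s) (A3 s) t = 1.
Proof.
move=> s01 ts; have [e0 e1 e2 e3] : [/\ colprod (E 0) (E 1) (E 2) (E 3) r0 r0 s = 1,
   colprod (E 0) (E 1) (E 2) (E 3) r1 r1 s = 1, colprod (E 0) (E 1) (E 2) (E 3) r2 r2 s = 1 &
   colprod (E 0) (E 1) (E 2) (E 3) r3 r3 s = 1] by have [] := orth s.
have [_ [[e01 e02 e03] [e12 e13 e23]]] := orth s.
have sE (f g : @row R -> R -> R) : r0 (dual f s) s = colprod (E 0) (E 1) (E 2) (E 3) f r0 s /\
   r1 (dual f s) s = colprod (E 0) (E 1) (E 2) (E 3) f r1 s /\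
   r2 (dual f s) s = colprod (E 0) (E 1) (E 2) (E 3) f r2 s /\
   r3 (dual f s) s = colprod (E 0) (E 1) (E 2) (E 3) f r3 s by [].
have sym (f g : @row R -> R -> R) : colprod (E 0) (E 1) (E 2) (E 3) f g s =
  colprod (E 0) (E 1) (E 2) (E 3) g f s by rewrite /colprod; ring.
have [h00 [h01 [h02 h03]]] := sE r0 r0; have [h10 [h11 [h12 h13]]] := sE r1 r0.
have [h20 [h21 [h22 h23]]] := sE r2 r0; have [h30 [h31 [h32 h33]]] := sE r3 r0.
rewrite e0 in h00; rewrite e01 in h01; rewrite e02 in h02; rewrite e03 in h03.
rewrite sym e01 in h10; rewrite e1 in h11; rewrite e12 in h12; rewrite e13 in h13.
rewrite sym e02 in h20; rewrite sym e12 in h21; rewrite e2 in h22; rewrite e23 in h23.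
rewrite sym e03 in h30; rewrite sym e13 in h31; rewrite sym e23 in h32; rewrite e3 in h33.
rewrite (@dv_const _ (det4 (A0 s) (A1 s) (A2 s) (A3 s)) t s); [|by case/andP: ts|..].
- have nE (D : @row R) : [/\ r0 (nrow D) s = - r0 D s, r1 (nrow D) s = - r1 D s,
    r2 (nrow D) s = - r2 D s & r3 (nrow D) s = - r3 D s] by [].
  rewrite /det4 /W012 /w12 /w02 /w01 /A0 /A1 /A2 /A3.
  have [-> -> -> ->] := nE (dual r3 s); have [-> -> -> ->] := nE (dual r1 s).
  by rewrite h00 h01 h02 h03 h10 h11 h12 h13 h20 h21 h22 h23 h30 h31 h32 h33; ring.
- move=> u _; apply: det4_ct; try apply: nrow_ct; exact: row_ct_rcomb.
- move=> u us.
  have sd (f : @row R -> R -> R) : row_dv c (dual f s) u.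
    by have [_] := sol_rcomb (f (E 0) s) (f (E 1) s) (f (E 2) s) (f (E 3) s)
      (E_sol 0 (lexx 0) (lexx 1)) (E_sol 1 (lexx 0) (lexx 1)) (E_sol 2 (lexx 0) (lexx 1))
      (E_sol 3 (lexx 0) (lexx 1)); apply; rewrite ?gt_eqF; lra.
  have nd (D : @row R) : row_dv c D u -> row_dv c (nrow D) u.
    by move=> [? ? ? ?]; split; rewrite /=; dvr.
  by apply: (@det4_dv _ c); [apply/nd|..|apply/nd|]; exact: sd.
Qed.

Let A_ct (t u : R) : [/\
  [/\ ct (fun s => r0 (A0 s) t) u, ct (fun s => r1 (A0 s) t) u & ct (fun s => r2 (A0 s) t) u],
  [/\ ct (fun s => r0 (A1 s) t) u, ct (fun s => r1 (A1 s) t) u & ct (fun s => r2 (A1 s) t) u],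
  [/\ ct (fun s => r0 (A2 s) t) u, ct (fun s => r1 (A2 s) t) u & ct (fun s => r2 (A2 s) t) u] &
  [/\ ct (fun s => r0 (A3 s) t) u, ct (fun s => r1 (A3 s) t) u & ct (fun s => r2 (A3 s) t) u]].
Proof.
have D (f g : @row R -> R -> R) : (forall i, ct (f (E i)) u) -> ct (fun s => f (E 0) s * g (E 0) t +
    f (E 1) s * g (E 1) t + f (E 2) s * g (E 2) t + f (E 3) s * g (E 3) t) u.
  by move=> h; have := (h 0%N, h 1%N, h 2%N, h 3%N) => -[[[? ? ]?] ?]; cts.
have D0 g := D r0 g (fun i => let: And4 h _ _ _ := E_ct i u in h).
have D1 g := D r1 g (fun i => let: And4 _ h _ _ := E_ct i u in h).
have D2 g := D r2 g (fun i => let: And4 _ _ h _ := E_ct i u in h).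
have D3 g := D r3 g (fun i => let: And4 _ _ _ h := E_ct i u in h).
split; split; [exact: ctN (D3 r0)|exact: ctN (D3 r1)|exact: ctN (D3 r2)|exact: D2 r0|
  exact: D2 r1|exact: D2 r2|exact: ctN (D1 r0)|exact: ctN (D1 r1)|exact: ctN (D1 r2)|
  exact: D0 r0|exact: D0 r1|exact: D0 r2].
Qed.

Let at_end t : [/\
  [/\ r0 (A0 1) t = r0 (E 0) t, r1 (A0 1) t = r1 (E 0) t & r2 (A0 1) t = r2 (E 0) t],
  [/\ r0 (A1 1) t = r0 (E 1) t, r1 (A1 1) t = r1 (E 1) t & r2 (A1 1) t = r2 (E 1) t],
  [/\ r0 (A2 1) t = r0 (E 2) t, r1 (A2 1) t = r1 (E 2) t & r2 (A2 1) t = r2 (E 2) t] &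
  [/\ r0 (A3 1) t = r0 (E 3) t, r1 (A3 1) t = r1 (E 3) t & r2 (A3 1) t = r2 (E 3) t]].
Proof.
by split; split; rewrite /A0 /A1 /A2 /A3 /dual /atrow /= (fp_z1 P) (fp_w1 P) /=; ring.
Qed.

Let E0 : [/\ [/\ r0 (E 0) 0 = 1, r1 (E 0) 0 = 0 & r2 (E 0) 0 = 0],
  [/\ r0 (E 1) 0 = 0, r1 (E 1) 0 = 1 & r2 (E 1) 0 = 0],
  [/\ r0 (E 2) 0 = 0, r1 (E 2) 0 = 0 & r2 (E 2) 0 = 1] &
  [/\ r0 (E 3) 0 = 0, r1 (E 3) 0 = 0 & r2 (E 3) 0 = 0]].
Proof. by split; split; rewrite /= (fp_z0 P) (fp_w0 P) /=; ring. Qed.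

Let A_ctr (s t : R) : [/\ row_ct (A0 s) t, row_ct (A1 s) t, row_ct (A2 s) t & row_ct (A3 s) t].
Proof. by split; try apply: nrow_ct; exact: row_ct_rcomb. Qed.

Let pos0 s := [/\ 0 < r0 (A0 s) 0, 0 < w01 (A0 s) (A1 s) 0 & 0 < W012 (A0 s) (A1 s) (A2 s) 0].

Let pos0_near : nr 1 pos0.
Proof.
have [[a0 a1 a2] [b0 b1 b2] [c0 c1 c2] _] := A_ct 0 1.
have [[ea0 ea1 ea2] [eb0 eb1 eb2] [ec0 ec1 ec2] _] := at_end 0.
have [[f0 f1 f2] [g0 g1 g2] [h0 h1 h2] _] := E0.
have n1 : nr 1 (fun s => 0 < r0 (A0 s) 0) by apply: nr_ct => //; rewrite ea0 f0.
have n2 : nr 1 (fun s => 0 < w01 (A0 s) (A1 s) 0).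
  apply: nr_ct; first by rewrite /w01; cts.
  by rewrite /w01 ea0 ea1 eb0 eb1 f0 f1 g0 g1; lra.
have n3 : nr 1 (fun s => 0 < W012 (A0 s) (A1 s) (A2 s) 0).
  apply: nr_ct; first by rewrite /W012 /w12 /w02 /w01; cts.
  rewrite /W012 /w12 /w02 /w01 ea0 ea1 ea2 eb0 eb1 eb2 ec0 ec1 ec2.
  by rewrite f0 f1 f2 g0 g1 g2 h0 h1 h2; lra.
by apply: nr_imp (nr_I (nr_I n1 n2) n3) => s [[? ?] ?]; split.
Qed.

(** The leading minors are positive at time 0 and cannot vanish before s. *)
Let lead s t : 0 < s < 1 -> pos0 s -> 0 <= t < s -> leading (A0 s) (A1 s) (A2 s) (A3 s) t.
Proof.
move=> s01 [p0 p1 p2] ts.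
have main (f : R -> R) : (forall u, ct f u) -> 0 < f 0 ->
    (forall u, 0 < u < s -> f u != 0) -> 0 < f t.
  move=> cf f0 nf; rewrite ltNge; apply/negP => ft.
  have [||||u ut u0] := @ivt_zero _ (fun u => - f u) 0 t; [lra|by move=> u _;
    apply: ctN|by rewrite oppr_le0 ltW|by rewrite oppr_ge0|].
  have [u00|u00] := eqVneq u 0; first by move: u0 f0; rewrite u00; lra.
  have : 0 < u < s by move: u00; rewrite neq_lt; lra.
  by move=> /nf/eqP; apply; apply: oppr_inj; rewrite u0 oppr0.
have nz u : 0 < u < s -> [/\ r0 (A0 s) u != 0, w01 (A0 s) (A1 s) u != 0 &
    W012 (A0 s) (A1 s) (A2 s) u != 0].
  by move=> us; apply: leading_neq0; rewrite ?gt_eqF//; lra.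
have cA u := A_ctr s u.
split.
- by apply: main => // u; [have [[]] := cA u|move=> /nz[]].
- by apply: main => // u; [have [? ? _ _] := cA u; exact: w01_ct|move=> /nz[]].
- by apply: main => // u; [have [? ? ? _] := cA u; exact: W012_ct|move=> /nz[]].
- by rewrite det_one//; lra.
Qed.

Let lim (X Y : R -> R) : ct X 1 -> ct Y 1 -> X 1 = 0 -> nr 1 (fun s => s < 1 -> X s <= Y s) ->
  0 <= Y 1.
Proof.
move=> cX cY X0 XY; suff : 0 <= Y 1 - X 1 by rewrite X0 subr0.
apply: (ct_ge_left (f := fun s => Y s - X s)); first by cts.
by apply: nr_imp XY => s h /h; rewrite subr_ge0.
Qed.

Let L s := LU (A0 s) (A1 s) (A2 s) (A3 s).

Let L_end : [/\
  [/\ ct (fun s => l10 (L s) 0) 1, ct (fun s => l21 (L s) 0) 1 & ct (fun s => l32 (L s) 0) 1],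
  [/\ ct (fun s => l20 (L s) 0) 1, ct (fun s => l31 (L s) 0) 1 & ct (fun s => l30 (L s) 0) 1] &
  lower_zero (L 1) 0].
Proof.
have [[a0 a1 a2] [b0 b1 b2] [c0 c1 c2] [d0 d1 d2]] := A_ct 0 1.
have [[za0 za1 za2] [zb0 zb1 zb2] [zc0 zc1 zc2] [zd0 zd1 zd2]] := at_end 0.
have [[f0 f1 f2] [g0 g1 g2] [h0 h1 h2] [i0 i1 i2]] := E0.
rewrite f0 in za0; rewrite f1 in za1; rewrite f2 in za2.
rewrite g0 in zb0; rewrite g1 in zb1; rewrite g2 in zb2.
rewrite h0 in zc0; rewrite h1 in zc1; rewrite h2 in zc2.
rewrite i0 in zd0; rewrite i1 in zd1; rewrite i2 in zd2.
have [p0 p1 p2] : pos0 1.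
  rewrite /pos0 /W012 /w12 /w02 /w01 za0 za1 za2 zb0 zb1 zb2 zc0 zc1 zc2.
  by split; lra.
have n0 : r0 (A0 1) 0 != 0 by rewrite gt_eqF.
have n1 : w01 (A0 1) (A1 1) 0 != 0 by rewrite gt_eqF.
have n2 : W012 (A0 1) (A1 1) (A2 1) 0 != 0 by rewrite gt_eqF.
have w1 : ct (fun s => w01 (A0 s) (A1 s) 0) 1 by rewrite /w01; cts.
have w2 : ct (fun s => W012 (A0 s) (A1 s) (A2 s) 0) 1 by rewrite /W012 /w12 /w02 /w01; cts.
split; [split; [exact: (ct_div (g := fun s => r0 (A0 s) 0) n0)|apply: (ct_div (g := fun s =>
  w01 (A0 s) (A1 s) 0) n1) => //|apply: (ct_div (g := fun s =>
    W012 (A0 s) (A1 s) (A2 s) 0) n2) => //]|split; [exact: (ct_div (g := fun s =>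
      r0 (A0 s) 0) n0)| apply: (ct_div (g := fun s => w01 (A0 s) (A1 s) 0) n1) =>
        //|exact: (ct_div (g := fun s => r0 (A0 s) 0) n0)]|].
- by rewrite /w01; cts.
- by rewrite /W012 /w12 /w02 /w01; cts.
- by rewrite /w01; cts.
- by apply: LU_zero; split; split.
Qed.

(** Each lower bound from [flow_minors] is built from the unipotent factor at time 0, which tends to
    the identity as s tends to 1 because the frame starts at the identity. So the bounds tend to 0,
    and the minors at t to those of the frame itself. *)
Lemma two_point_minors t : 0 < t < 1 ->
  [/\ 0 <= r0 (E 0) t, 0 <= r0 (E 1) t, 0 <= r0 (E 2) t & 0 <= r0 (E 3) t] /\
  [/\ 0 <= w01 (E 0) (E 3) t & 0 <= w01 (E 1) (E 2) t] /\
  [/\ 0 <= W012 (E 0) (E 1) (E 2) t, 0 <= W012 (E 0) (E 1) (E 3) t,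
      0 <= W012 (E 0) (E 2) (E 3) t & 0 <= W012 (E 1) (E 2) (E 3) t].
Proof.
move=> t01.
have [k [k0 kt]] : exists k : R, 0 < k /\ k < 1 - t by exists ((1 - t) / 2); lra.
have FM : nr 1 (fun s => s < 1 -> let A := A0 s in let B := A1 s in let C := A2 s in let D :=
  A3 s in
  leading A B C D t /\ let L := L s in
  [/\ r0 A t * l10 L 0 <= r0 B t, W012 A B C t * l32 L 0 <= W012 A B D t,
      r0 A t * (l20 L 0 - l21 L 0 * l10 L 0) + l21 L 0 * r0 B t <= r0 C t &
      w01 A B t * (l31 L 0 - l32 L 0 * l21 L 0) + l32 L 0 * w01 A C t <= w01 A D t] /\
  [/\ r0 A t * (l30 L 0 - (l31 L 0 - l32 L 0 * l21 L 0) * l10 L 0 - l32 L 0 * l20 L 0) +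
      (l31 L 0 - l32 L 0 * l21 L 0) * r0 B t + l32 L 0 * r0 C t <= r0 D t,
      w01 A B t * (p12 (L) 0 - l10 L 0 * l21 L 0) + l10 L 0 * w01 A C t <= w01 B C t,
      W012 A B C t * (w023 L 0 - l21 L 0 * l32 L 0) + l21 L 0 * W012 A B D t <=
        W012 A C D t &
      W012 A B C t * (w123 L 0 + l20 L 0 * l32 L 0 - l10 L 0 * w023 L 0)
        - l20 L 0 * W012 A B D t + l10 L 0 * W012 A C D t <= W012 B C D t]).
  apply: nr_imp (nr_I pos0_near (nr_itv 1 k0)) => s [ps sk] s1 A B C D.
  have s01 : 0 < s < 1 by lra.
  split; first by apply: lead => //; lra.
  have sd (f : @row R -> R -> R) : sol c 0 0 t (dual f s) by apply: sol_rcomb; apply: E_sol; lra.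
  have sA : sol c 0 0 t (A0 s) := nrow_sol (sd r3).
  have sC : sol c 0 0 t (A2 s) := nrow_sol (sd r1).
  have t0 : 0 <= t by lra.
  have pc : posc c 0 0 t by move=> u ut _; apply: (fp_c P); lra.
  have ld u : 0 <= u <= t -> leading (A0 s) (A1 s) (A2 s) (A3 s) u.
    by move=> ut; apply: lead => //; lra.
  exact: (flow_minors t0 pc sA (sd r2) sC (sd r0) ld).
have [[a0 a1 a2] [b0 b1 b2] [c0 c1 c2] [d0 d1 d2]] := A_ct t 1.
have [[ea0 ea1 ea2] [eb0 eb1 eb2] [ec0 ec1 ec2] [ed0 ed1 ed2]] := at_end t.
have [[za0 za1 za2] [zb0 zb1 zb2] [zc0 zc1 zc2] [zd0 zd1 zd2]] := at_end 0.
have [[f0 f1 f2] [g0 g1 g2] [h0 h1 h2] [i0 i1 i2]] := E0.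
have cw (A B : R -> @row R) : ct (fun s => r0 (A s) t) 1 -> ct (fun s => r1 (A s) t) 1 ->
    ct (fun s => r0 (B s) t) 1 -> ct (fun s => r1 (B s) t) 1 -> ct (fun s => w01 (A s) (B s) t) 1.
  by move=> *; rewrite /w01; cts.
have cW (A B C : R -> @row R) : ct (fun s => r0 (A s) t) 1 -> ct (fun s => r1 (A s) t) 1 ->
    ct (fun s => r2 (A s) t) 1 -> ct (fun s => r0 (B s) t) 1 -> ct (fun s => r1 (B s) t) 1 ->
    ct (fun s => r2 (B s) t) 1 -> ct (fun s => r0 (C s) t) 1 -> ct (fun s => r1 (C s) t) 1 ->
    ct (fun s => r2 (C s) t) 1 -> ct (fun s => W012 (A s) (B s) (C s) t) 1.
  by move=> *; rewrite /W012 /w12 /w02 /w01; cts.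
have w1 := cw _ _ a0 a1 b0 b1; have w2 := cw _ _ a0 a1 c0 c1; have w3 := cw _ _ a0 a1 d0 d1.
have w4 := cw _ _ b0 b1 c0 c1.
have x1 := cW _ _ _ a0 a1 a2 b0 b1 b2 c0 c1 c2.
have x2 := cW _ _ _ a0 a1 a2 b0 b1 b2 d0 d1 d2.
have x3 := cW _ _ _ a0 a1 a2 c0 c1 c2 d0 d1 d2.
have x4 := cW _ _ _ b0 b1 b2 c0 c1 c2 d0 d1 d2.
have [[k1 k2 k3] [k4 k5 k6] [[z1 z2 z3] [z4 z5 z6]]] := L_end.
have ew (A B A' B' : @row R) : r0 A t = r0 A' t -> r1 A t = r1 A' t -> r0 B t = r0 B' t ->
  r1 B t = r1 B' t -> w01 A B t = w01 A' B' t.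
  by rewrite /w01 => -> -> -> ->.
have eW (A B C A' B' C' : @row R) : r0 A t = r0 A' t -> r1 A t = r1 A' t -> r2 A t = r2 A' t ->
  r0 B t = r0 B' t -> r1 B t = r1 B' t -> r2 B t = r2 B' t -> r0 C t = r0 C' t ->
    r1 C t = r1 C' t ->
  r2 C t = r2 C' t -> W012 A B C t = W012 A' B' C' t.
  by rewrite /W012 /w12 /w02 /w01 => -> -> -> -> -> -> -> -> ->.
rewrite -(ew _ _ _ _ ea0 ea1 ed0 ed1) -(ew _ _ _ _ eb0 eb1 ec0 ec1).
rewrite -(eW _ _ _ _ _ _ ea0 ea1 ea2 eb0 eb1 eb2 ec0 ec1 ec2).
rewrite -(eW _ _ _ _ _ _ ea0 ea1 ea2 eb0 eb1 eb2 ed0 ed1 ed2).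
rewrite -(eW _ _ _ _ _ _ ea0 ea1 ea2 ec0 ec1 ec2 ed0 ed1 ed2).
rewrite -(eW _ _ _ _ _ _ eb0 eb1 eb2 ec0 ec1 ec2 ed0 ed1 ed2).
rewrite -ea0 -eb0 -ec0 -ed0.
have cZ : ct (fun=> 0) (1 : R) := @ct_cst R R 0 1.
split; [split|split; split].
- apply: (lim cZ a0) => //.
  by apply: nr_imp FM => s h s1; have [[p _ _ _] _] := h s1; exact: ltW.
- apply: (lim (X := fun s => r0 (A0 s) t * l10 (L s) 0) _ b0); [by cts|by rewrite z1 mulr0|].
  by apply: nr_imp FM => s h s1; have [_ [[]]] := h s1.
- apply: (lim (X := fun s => r0 (A0 s) t * (l20 (L s) 0 - l21 (L s) 0 * l10 (L s) 0) +
  l21 (L s) 0 * r0 (A1 s) t) _ c0).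
  + by cts.
  + by rewrite z1 z2 z4; ring.
  + by apply: nr_imp FM => s h s1; have [_ [[]]] := h s1.
- apply: (lim (X := fun s => r0 (A0 s) t * (l30 (L s) 0 - (l31 (L s) 0 - l32 (L s) 0 * l21 (L s) 0) * l10 (L s) 0 - l32 (L s) 0 * l20 (L s) 0) +
      (l31 (L s) 0 - l32 (L s) 0 * l21 (L s) 0) * r0 (A1 s) t + l32 (L s) 0 * r0 (A2 s) t) _ d0).
  + by cts.
  + by rewrite z1 z2 z3 z4 z5 z6; ring.
  + by apply: nr_imp FM => s h s1; have [_ [_ []]] := h s1.
- apply: (lim (X := fun s => w01 (A0 s) (A1 s) t * (l31 (L s) 0 - l32 (L s) 0 * l21 (L s) 0) +
  l32 (L s) 0 * w01 (A0 s) (A2 s) t) _ w3).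
  + by cts.
  + by rewrite z2 z3 z5; ring.
  + by apply: nr_imp FM => s h s1; have [_ [[]]] := h s1.
- apply: (lim (X := fun s => w01 (A0 s) (A1 s) t * (p12 (L s) 0 - l10 (L s) 0 * l21 (L s) 0) +
  l10 (L s) 0 * w01 (A0 s) (A2 s) t) _ w4).
  + by rewrite /p12; cts.
  + by rewrite /p12 z1 z2 z4; ring.
  + by apply: nr_imp FM => s h s1; have [_ [_ []]] := h s1.
- apply: (lim cZ x1) => //.
  by apply: nr_imp FM => s h s1; have [[_ _ p _] _] := h s1; exact: ltW.
- apply: (lim (X := fun s => W012 (A0 s) (A1 s) (A2 s) t * l32 (L s) 0) _ x2);
  [by cts|by rewrite z3 mulr0|].
  by apply: nr_imp FM => s h s1; have [_ [[]]] := h s1.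
- apply: (lim (X := fun s => W012 (A0 s) (A1 s) (A2 s) t * (w023 (L s) 0 - l21 (L s) 0 * l32 (L s) 0) + l21 (L s) 0 * W012 (A0 s) (A1 s) (A3 s) t) _ x3).
  + by rewrite /w023; cts.
  + by rewrite /w023 z2 z3 z5; ring.
  + by apply: nr_imp FM => s h s1; have [_ [_ []]] := h s1.
- apply: (lim (X := fun s => W012 (A0 s) (A1 s) (A2 s) t * (w123 (L s) 0 +
  l20 (L s) 0 * l32 (L s) 0 - l10 (L s) 0 * w023 (L s) 0)
        - l20 (L s) 0 * W012 (A0 s) (A1 s) (A3 s) t +
          l10 (L s) 0 * W012 (A0 s) (A2 s) (A3 s) t) _ x4).
  + by rewrite /w123 /w023; cts.
  + by rewrite /w123 /w023 z1 z2 z3 z4 z5 z6; ring.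
  + by apply: nr_imp FM => s h s1; have [_ [_ []]] := h s1.
Qed.

End TwoPoint.

(** * From a convex gamma to condition (D) *)

Section Delta.
Context {R : realType}.

(* Row [i] of the matrix with columns z i z', z j z', z k z'. *)
Definition lrow (i : nat) (z : R -> @quatn R) : row := Row
  (fun t => comp i (mulc (muli (z t)) (z t))) (fun t => comp i (mulc (mulj (z t)) (z t)))
  (fun t => comp i (mulc (mulk (z t)) (z t))) (fun=> 0).

Lemma lrow_dv i z t (q p : R) : dvq z t (spin p q (z t)) ->
  row_dv3 (fun=> q) (fun=> p) (lrow i z) t.
Proof.
move=> [? ? ? ?]; have R2 : (2 : R) != 0 by rewrite pnatr_eq0.
by case: i => [|[|[|i]]]; split; rewrite /= ; (eapply dv_eq; [dvs|]); rewrite /=; field.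
Qed.

Lemma lrow_ct i z t : ctq z t ->
  [/\ ct (r0 (lrow i z)) t, ct (r1 (lrow i z)) t & ct (r2 (lrow i z)) t].
Proof.
move=> cz; split; apply: comp_ct; apply: mulc_ct => //.
- exact: muli_ct.
- exact: mulj_ct.
- exact: mulk_ct.
Qed.

Lemma lrow_norm i (z : R -> @quatn R) t : (0 < i <= 3)%N -> nrm (z t) = 1 ->
  r0 (lrow i z) t ^+ 2 + r1 (lrow i z) t ^+ 2 + r2 (lrow i z) t ^+ 2 = 1.
Proof.
move=> i3 nz; transitivity (nrm (z t) ^+ 2); last by rewrite nz expr1n.
by case: i i3 => [|[|[|[|]]]]//= _; rewrite /nrm; ring.
Qed.

Lemma lcol_norm (f : @row R -> R -> R) (z : R -> @quatn R) t :
  (f = r0 \/ f = r1 \/ f = r2) -> nrm (z t) = 1 ->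
  f (lrow 1 z) t ^+ 2 + f (lrow 2 z) t ^+ 2 + f (lrow 3 z) t ^+ 2 = 1.
Proof.
move=> fE nz; transitivity (nrm (z t) ^+ 2); last by rewrite nz expr1n.
by case: fE => [|[]] ->; rewrite /nrm /=; ring.
Qed.

Lemma lrow_delta (z : R -> @quatn R) t :
  r0 (lrow 3 z) t = 2 * (qb (z t) * qd (z t) - qa (z t) * qc (z t)) /\
  r2 (lrow 1 z) t = 2 * (qb (z t) * qd (z t) + qa (z t) * qc (z t)).
Proof. by split; rewrite /=; ring. Qed.

Lemma min_dv (f df : R -> R) t : 0 < t < 1 ->
  (forall s, 0 < s < 1 -> dv f s (df s)) -> (forall s, 0 < s < 1 -> 0 <= f s) ->
  f t = 0 -> df t = 0.
Proof.
move=> t01 dfs fs ft.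
have [h [h0 ht h1]] : exists h : R, [/\ 0 < h, h <= t & h <= 1 - t].
  exists (Num.min t (1 - t)); rewrite !ge_min !lexx orbT lt_min; split => //.
  by apply/andP; split; lra.
have sE s : `|s - t| < h -> 0 < s < 1 by rewrite ltr_distl; lra.
apply: (dv_min h0 _ (dfs t t01) ft) => s /sE s01; [|exact: fs].
by exists (df s); exact: dfs.
Qed.

(** In the coordinate planes 03 and 12 the projections of g are parallel to those of a and of b.
    With M and N the squared lengths of the two projections of g, this gives M N = la^2 = lb^2,
    while orthogonality of a and b gives la lb = 0; hence M N = 0. *)
Lemma plane_pair (g0 g1 g2 g3 a0 a1 a2 a3 b0 b1 b2 b3 : R) :
  g0 ^+ 2 + g1 ^+ 2 + g2 ^+ 2 + g3 ^+ 2 = 1 -> a0 ^+ 2 + a1 ^+ 2 + a2 ^+ 2 + a3 ^+ 2 = 1 ->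
  b0 ^+ 2 + b1 ^+ 2 + b2 ^+ 2 + b3 ^+ 2 = 1 ->
  g0 * a0 + g1 * a1 + g2 * a2 + g3 * a3 = 0 -> g0 * b0 + g1 * b1 + g2 * b2 + g3 * b3 = 0 ->
  a0 * b0 + a1 * b1 + a2 * b2 + a3 * b3 = 0 ->
  g0 * a3 - a0 * g3 = 0 -> g0 * b3 - b0 * g3 = 0 ->
  g1 * a2 - a1 * g2 = 0 -> g1 * b2 - b1 * g2 = 0 ->
  (g0 = 0 /\ g3 = 0) \/ (g1 = 0 /\ g2 = 0).
Proof.
move=> gg aa bb ga gb ab a03 b03 a12 b12.
pose M := g0 ^+ 2 + g3 ^+ 2; pose N := g1 ^+ 2 + g2 ^+ 2.
pose la := g0 * a0 + g3 * a3; pose lb := g0 * b0 + g3 * b3.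
have MN : M + N = 1 by rewrite -gg /M /N; ring.
have ma : g1 * a1 + g2 * a2 = - la by apply/eqP; rewrite -subr_eq0 -[X in _ == X]ga /la;
  apply/eqP; ring.
have mb : g1 * b1 + g2 * b2 = - lb by apply/eqP; rewrite -subr_eq0 -[X in _ == X]gb /lb;
  apply/eqP; ring.
have ea : M * N = la ^+ 2.
  rewrite -[LHS]mulr1 -aa -[RHS]mulr1 -MN.
  rewrite [LHS](_ : _ = N * (la ^+ 2 + (g0 * a3 - a0 * g3) ^+ 2) +
    M * ((g1 * a1 + g2 * a2) ^+ 2 + (g1 * a2 - a1 * g2) ^+ 2)); last first.
    by rewrite /M /N /la; ring.
  by rewrite a03 a12 ma; ring.
have eb : M * N = lb ^+ 2.
  rewrite -[LHS]mulr1 -bb -[RHS]mulr1 -MN.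
  rewrite [LHS](_ : _ = N * (lb ^+ 2 + (g0 * b3 - b0 * g3) ^+ 2) +
    M * ((g1 * b1 + g2 * b2) ^+ 2 + (g1 * b2 - b1 * g2) ^+ 2)); last first.
    by rewrite /M /N /lb; ring.
  by rewrite b03 b12 mb; ring.
have eab : la * lb = 0.
  transitivity (M * N * (a0 * b0 + a1 * b1 + a2 * b2 + a3 * b3)); last by rewrite ab mulr0.
  rewrite [RHS](_ : _ = N * (la * lb + (g0 * a3 - a0 * g3) * (g0 * b3 - b0 * g3)) +
    M * ((g1 * a1 + g2 * a2) * (g1 * b1 + g2 * b2) + (g1 * a2 - a1 * g2) * (g1 * b2 - b1 * g2))).
    rewrite a03 a12 ma mb -[LHS]mul1r -MN; ring.
  by rewrite /M /N /la /lb; ring.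
have /eqP : (M * N) * (M * N) = 0.
  by rewrite {1}ea eb -exprMn eab expr0n.
have sq (x y : R) : x ^+ 2 + y ^+ 2 == 0 -> x = 0 /\ y = 0.
  by rewrite paddr_eq0 ?sqr_ge0// !expf_eq0 /= => /andP[/eqP-> /eqP->].
by rewrite mulf_eq0 orbb mulf_eq0 => /orP[/sq|/sq]; [left|right].
Qed.

Lemma qrow_minors3 (z w : R -> @quatn R) t : nrm (z t) = 1 -> nrm (w t) = 1 ->
  [/\ W012 (qrow 0 z w) (qrow 1 z w) (qrow 2 z w) t = r3 (qrow 3 z w) t,
      W012 (qrow 0 z w) (qrow 1 z w) (qrow 3 z w) t = - r3 (qrow 2 z w) t,
      W012 (qrow 0 z w) (qrow 2 z w) (qrow 3 z w) t = r3 (qrow 1 z w) t &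
      W012 (qrow 1 z w) (qrow 2 z w) (qrow 3 z w) t = - r3 (qrow 0 z w) t].
Proof.
move=> nz nw; have main (x y : R) : x = y * (nrm (z t) * nrm (w t)) -> x = y.
  by rewrite nz nw !mulr1.
by split; apply: main; rewrite /W012 /w12 /w02 /w01 /nrm /=; ring.
Qed.

(** For a unit w, z h conj(z) is the product of the column z h conj(w) with conj(e_0). The formulas
    are its k-coordinate for h = i and its i-coordinate for h = k. *)
Lemma lrow_minors (z w : R -> @quatn R) t : nrm (w t) = 1 ->
  r0 (lrow 3 z) t = w01 (qrow 0 z w) (qrow 3 z w) t + w01 (qrow 1 z w) (qrow 2 z w) t /\
  r2 (lrow 1 z) t = r0 (qrow 2 z w) t * r3 (qrow 3 z w) t - r0 (qrow 3 z w) t * r3 (qrow 2 z w) t +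
    r0 (qrow 0 z w) t * r3 (qrow 1 z w) t - r0 (qrow 1 z w) t * r3 (qrow 0 z w) t.
Proof.
move=> nw; have main (x y : R) : y = x * nrm (w t) -> x = y by rewrite nw mulr1.
by split; apply: main; rewrite /w01 /nrm /=; ring.
Qed.

(** At an interior zero the derivative vanishes too, so the i-row of the left frame is (1, 0, 0) up
    to sign. The first column is then concentrated in that row, against the positivity of its
    k-entry. *)
Lemma lrow_w_gt0 (z : R -> @quatn R) (c : @coef R) t : (forall s, nrm (z s) = 1) ->
  (forall s, 0 < s < 1 -> [/\ 0 < k1 c s, 0 < k2 c s & 0 < k3 c s]) ->
  (forall s, 0 < s < 1 -> dvq z s (spin (k1 c s + k3 c s) (k2 c s) (z s))) ->
  (forall s, 0 < s < 1 -> 0 <= r2 (lrow 1 z) s) -> 0 < t < 1 ->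
  0 < r0 (lrow 3 z) t -> 0 < r2 (lrow 1 z) t.
Proof.
move=> nz pc dz nn t01 ut.
rewrite lt_def nn// andbT; apply/eqP => w0.
have dd s : 0 < s < 1 -> dv (r2 (lrow 1 z)) s (- ((k1 c s + k3 c s) * r1 (lrow 1 z) s)).
  by move=> s01; have [] := lrow_dv 1 (dz s s01).
have [k1t _ k3t] := pc t t01.
have h2 : r1 (lrow 1 z) t = 0.
  apply/eqP; have /eqP := min_dv t01 dd nn w0.
  by rewrite oppr_eq0 mulf_eq0 gt_eqF ?addr_gt0.
have := lrow_norm (i := 1) isT (nz t); have := lcol_norm (or_introl erefl) (nz t).
rewrite w0 h2 !expr0n !addr0 => e1 e2; rewrite e2 in e1.
have := sqr_ge0 (r0 (lrow 2 z) t); have := exprn_gt0 2 ut; lra.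
Qed.

Variables (z w : R -> @quatn R) (c : @coef R).
Hypotheses (P : frame_path z w c) (T : two_point z w).

Local Notation E i := (qrow i z w).

(** Two nonnegative minors of sum 0 vanish together with their derivatives, so [plane_pair] puts e_0
    in a coordinate plane. Its two zero entries are minima as well, so e_1 lies in the same
    plane. *)
Let u_gt0 t : 0 < t < 1 -> 0 < r0 (lrow 3 z) t.
Proof.
move=> t01; have mn s := two_point_minors P T (t := s).
have [ue _] := lrow_minors z (fp_nw P t); rewrite ue.
have [[g0 g1 g2 g3] [[m03 m12] _]] := mn t t01.
rewrite ltNge; apply/negP => le0.
have z03 : w01 (E 0) (E 3) t = 0 by lra.
have z12 : w01 (E 1) (E 2) t = 0 by lra.
have [_ k2t k3t] := fp_c P t01; have [k1t _ _] := fp_c P t01.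
have min2 i j : (forall s, 0 < s < 1 -> 0 <= w01 (E i) (E j) s) -> w01 (E i) (E j) t = 0 ->
    w02 (E i) (E j) t = 0.
  move=> nn zt; have := min_dv (df := fun s => k2 c s * w02 (E i) (E j) s) t01 _ nn zt.
  have dd s : 0 < s < 1 -> dv (w01 (E i) (E j)) s (k2 c s * w02 (E i) (E j) s).
    by move=> s01; apply: w01_dv; exact: (fp_row P).
  by move=> /(_ dd) /eqP; rewrite mulf_eq0 gt_eqF//= => /eqP.
have min1 i : (forall s, 0 < s < 1 -> 0 <= r0 (E i) s) -> r0 (E i) t = 0 -> r1 (E i) t = 0.
  move=> nn zt; have := min_dv (df := fun s => k1 c s * r1 (E i) s) t01 _ nn zt.
  have dd s : 0 < s < 1 -> dv (r0 (E i)) s (k1 c s * r1 (E i) s).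
    by move=> s01; have [] := fp_row P i s01.
  by move=> /(_ dd) /eqP; rewrite mulf_eq0 gt_eqF//= => /eqP.
have y03 : w02 (E 0) (E 3) t = 0 by apply: min2 => // s /mn[_ [[]]].
have y12 : w02 (E 1) (E 2) t = 0 by apply: min2 => // s /mn[_ [[]]].
have [[e0 e1 e2 _] [[e01 e02 _] [e12 _ _]]] := qrow_orthc (fp_nz P t) (fp_nw P t).
rewrite /colprod in e0 e1 e2 e01 e02 e12.
rewrite /w01 in z03 z12; rewrite /w02 in y03 y12.
rewrite -!expr2 in e0 e1 e2.
have [[n0 n3]|[n1 n2]] := plane_pair e0 e1 e2 e01 e02 e12 z03 y03 z12 y12.
  have a0 : r1 (E 0) t = 0 by apply: min1 => // s /mn[[]].
  have a3 : r1 (E 3) t = 0 by apply: min1 => // s /mn[[]].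
  rewrite n0 n3 a0 a3 in e0 e1 e01.
  (* Lagrange's identity: an orthonormal pair in a plane has minor 1 or -1, whereas this minor is
     0. *)
  have : (r0 (E 1) t ^+ 2 + r0 (E 2) t ^+ 2) * (r1 (E 1) t ^+ 2 + r1 (E 2) t ^+ 2) = 
    (r0 (E 1) t * r1 (E 1) t + r0 (E 2) t * r1 (E 2) t) ^+ 2 +
    (r0 (E 1) t * r1 (E 2) t - r1 (E 1) t * r0 (E 2) t) ^+ 2 by ring.
  rewrite z12.
  have -> : r0 (E 1) t ^+ 2 + r0 (E 2) t ^+ 2 = 1 by rewrite -[RHS]e0; ring.
  have -> : r1 (E 1) t ^+ 2 + r1 (E 2) t ^+ 2 = 1 by rewrite -[RHS]e1; ring.
  have -> : r0 (E 1) t * r1 (E 1) t + r0 (E 2) t * r1 (E 2) t = 0 by lra.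
  by rewrite expr0n addr0 mul1r => /eqP; rewrite oner_eq0.
have a1 : r1 (E 1) t = 0 by apply: min1 => // s /mn[[]].
have a2 : r1 (E 2) t = 0 by apply: min1 => // s /mn[[]].
rewrite n1 n2 a1 a2 in e0 e1 e01.
have : (r0 (E 0) t ^+ 2 + r0 (E 3) t ^+ 2) * (r1 (E 0) t ^+ 2 + r1 (E 3) t ^+ 2) = 
  (r0 (E 0) t * r1 (E 0) t + r0 (E 3) t * r1 (E 3) t) ^+ 2 +
  (r0 (E 0) t * r1 (E 3) t - r1 (E 0) t * r0 (E 3) t) ^+ 2 by ring.
rewrite z03.
have -> : r0 (E 0) t ^+ 2 + r0 (E 3) t ^+ 2 = 1 by rewrite -[RHS]e0; ring.
have -> : r1 (E 0) t ^+ 2 + r1 (E 3) t ^+ 2 = 1 by rewrite -[RHS]e1; ring.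
have -> : r0 (E 0) t * r1 (E 0) t + r0 (E 3) t * r1 (E 3) t = 0 by lra.
by rewrite expr0n addr0 mul1r => /eqP; rewrite oner_eq0.
Qed.

Lemma two_point_delta t : 0 < t < 1 -> 0 < r0 (lrow 3 z) t /\ 0 < r2 (lrow 1 z) t.
Proof.
move=> t01; have ut := u_gt0 t01; split => //.
have nn s : 0 < s < 1 -> 0 <= r2 (lrow 1 z) s.
  move=> s01; have [[g0 g1 g2 g3] [_ [W0 W1 W2 W3]]] := two_point_minors P T s01.
  have [_ ->] := lrow_minors z (fp_nw P s).
  have [e0 e1 e2 e3] := qrow_minors3 (fp_nz P s) (fp_nw P s).
  rewrite e0 in W0; rewrite e1 in W1; rewrite e2 in W2; rewrite e3 in W3.
  have := mulr_ge0 g2 W0; have := mulr_ge0 g3 W1.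
  have := mulr_ge0 g0 W2; have := mulr_ge0 g1 W3.
  by rewrite !mulrN; lra.
exact: (lrow_w_gt0 (fp_nz P) (fp_c P) (fp_dz P) nn t01 ut).
Qed.

End Delta.

(** * From a convex left part to condition (D) *)

Section DeltaLeft.
Context {R : realType}.

Definition lcomb (z : R -> @quatn R) (y1 y2 y3 : R) (f : @row R -> R -> R) t :=
  y1 * f (lrow 1 z) t + y2 * f (lrow 2 z) t + y3 * f (lrow 3 z) t.

(** Three distinct zeros are excluded only for <gamma_l, j>, the form that vanishes at both ends of
    the curve. *)
Definition three_point (z : R -> @quatn R) :=
  (forall y1 y2 y3 s t : R, 0 < s < 1 -> 0 < t < 1 -> s != t ->
    lcomb z y1 y2 y3 r0 s = 0 -> lcomb z y1 y2 y3 r1 s = 0 ->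
    lcomb z y1 y2 y3 r0 t = 0 -> y1 ^+ 2 + y2 ^+ 2 + y3 ^+ 2 = 0) /\
  (forall s t u : R, 0 < s -> s < t -> t < u -> u < 1 -> r0 (lrow 2 z) s = 0 ->
    r0 (lrow 2 z) t = 0 -> r0 (lrow 2 z) u <> 0).

Variables (z w : R -> @quatn R) (c : @coef R).
Hypotheses (P : frame_path z w c) (T : three_point z).

Local Notation L i := (lrow i z).
Local Notation q := (k2 c).
Local Notation p t := (k1 c t + k3 c t).

Let L_ct i t : [/\ ct (r0 (L i)) t, ct (r1 (L i)) t & ct (r2 (L i)) t].
Proof. exact: lrow_ct (fp_z P t). Qed.

Let L_dv i t : 0 < t < 1 -> [/\ dv (r0 (L i)) t (q t * r1 (L i) t),
  dv (r1 (L i)) t (p t * r2 (L i) t - q t * r0 (L i) t) &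
  dv (r2 (L i)) t (- (p t * r1 (L i) t))].
Proof. by move=> t01; exact (lrow_dv i (fp_dz P t01)). Qed.

Let pq t : 0 < t < 1 -> 0 < p t /\ 0 < q t.
Proof. by move=> /(fp_c P)[? ? ?]; split => //; exact: addr_gt0. Qed.

(** Coordinate [f] of the vector n_l(s) in the left frame at time t; for [r0] it is <gamma_l(t),
    n_l(s)>. *)
Let D s f t := lcomb z (r2 (L 1) s) (r2 (L 2) s) (r2 (L 3) s) f t.

Let D_at s : [/\ D s r0 s = 0, D s r1 s = 0 & D s r2 s = 1].
Proof.
have nz := fp_nz P s; have main (x y : R) : x = y * nrm (z s) ^+ 2 -> x = y.
  by rewrite nz expr1n mulr1.
by split; apply: main; rewrite /D /lcomb /nrm /=; ring.
Qed.

Let D_ct s t : [/\ ct (D s r0) t, ct (D s r1) t & ct (D s r2) t].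
Proof.
have [? ? ?] := L_ct 1 t; have [? ? ?] := L_ct 2 t; have [? ? ?] := L_ct 3 t.
by rewrite /D /lcomb; split; cts.
Qed.

Let D_dv s t : 0 < t < 1 -> dv (D s r0) t (q t * D s r1 t) /\
  dv (D s r1) t (p t * D s r2 t - q t * D s r0 t).
Proof.
move=> t01; have [? ? _] := L_dv 1 t01; have [? ? _] := L_dv 2 t01; have [? ? _] := L_dv 3 t01.
by rewrite /D /lcomb; split; dvr.
Qed.

Let D_neq0 s t : 0 < s < 1 -> 0 < t < 1 -> s != t -> D s r0 t != 0.
Proof.
move=> s01 t01 st; apply/eqP => e; have [e0 e1 _] := D_at s.
have := lcol_norm (or_intror (or_intror erefl)) (fp_nz P s).
by rewrite (T.1 _ _ _ s t s01 t01 st e0 e1 e) => /eqP; rewrite eq_sym oner_eq0.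
Qed.

(* Were f := <gamma(.), n(s)> negative on one side of s, then g' = p h - q f > 0
   there, where g = <t(.), n(s)> and h = <n(.), n(s)>, and f would increase away
   from f(s) = 0. *)
Let D_gt0 s t : 0 < s < 1 -> 0 < t < 1 -> s != t -> 0 < D s r0 t.
Proof.
move=> s01 t01 st; rewrite lt_def D_neq0//=; apply: contraT; rewrite -ltNge => Dt.
have [e0 e1 e2] := D_at s.
have cD u : ct (D s r0) u by have [] := D_ct s u.
have sgn u : 0 < u < 1 -> s < u /\ s < t \/ u < s /\ t < s -> D s r0 u < 0.
  move=> u01 side; rewrite ltNge; apply/negP => Du.
  have zero a b : a <= b -> (D s r0 a <= 0 <= D s r0 b \/ D s r0 b <= 0 <= D s r0 a) ->
      exists2 v, a <= v <= b & D s r0 v = 0.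
    move=> ab [/andP[h1 h2]|/andP[h1 h2]].
      by apply: ivt_zero => // v _; exact: cD.
    have [v vab ve] := @ivt_zero _ (fun v => - D s r0 v) a b ab (fun v _ => ctN (cD v))
      ltac:(by rewrite oppr_le0) ltac:(by rewrite oppr_ge0).
    by exists v => //; apply: oppr_inj; rewrite ve oppr0.
  have [v v01 [vs v0]] : exists2 v, 0 < v < 1 & s != v /\ D s r0 v = 0.
    have [tu|ut] := leP t u.
      have [|v vab v0] := zero t u tu; first by left; rewrite ltW.
      by exists v; [lra|split => //; rewrite neq_lt; lra].
    have [|v vab v0] := zero u t (ltW ut); first by right; rewrite ltW.
    by exists v; [lra|split => //; rewrite neq_lt; lra].
  by move/eqP: v0; rewrite (negbTE (D_neq0 s01 v01 vs)).
have [_ _ c2] := D_ct s s.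
have [h h0 H] := nr_I (nr_ct c2 (eq_ind_r (fun x => 0 < x) ltr01 e2))
  (nr_I (nr_itv s (proj1 (andP s01))) (nr_itv s (h := 1 - s) ltac:(lra))).
have dec1 u : s - h < u < s + h -> 0 < u < 1 -> (s < u /\ s < t \/ u < s /\ t < s) ->
    0 < p u * D s r2 u - q u * D s r0 u.
  move=> /H[h2 _] u01 side; have [pu qu] := pq u01; have := sgn u u01 side.
  move=> Du; have := mulr_gt0 pu h2; have : q u * D s r0 u < 0 by rewrite pmulr_rlt0.
  lra.
have cD1 u : ct (D s r1) u by have [] := D_ct s u.
move: st; rewrite neq_lt => /orP[st|ts].
- have g0 u : s < u < s + h -> 0 < D s r1 u.
    move=> su; rewrite -e1; apply: (@mono _ s) => //; first lra.
    move=> v vs _; have [|_ [? ?]] := H v; first lra.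
    have v01 : 0 < v < 1 by lra.
    eexists; first exact: (D_dv s v01).2.
    by apply: dec1 => //; [lra|left; lra].
  have : 0 < D s r0 (s + h / 2).
    rewrite -e0; apply: (@mono _ s) => //; first lra.
    move=> v vs _; have [|_ [? ?]] := H v; first lra.
    have v01 : 0 < v < 1 by lra.
    eexists; first exact: (D_dv s v01).1.
    by have [_ qv] := pq v01; apply: mulr_gt0 => //; apply: g0; lra.
  have [|_ [? ?]] := H (s + h / 2); first lra.
  by have := sgn (s + h / 2) ltac:(lra) ltac:(left; lra); lra.
- have g0 u : s - h < u < s -> D s r1 u < 0.
    move=> su; rewrite -e1; apply: (@mono _ s) => //; first lra.
    move=> v vs _; have [|_ [? ?]] := H v; first lra.
    have v01 : 0 < v < 1 by lra.
    eexists; first exact: (D_dv s v01).2.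
    by apply: dec1 => //; [lra|right; lra].
  have : 0 < D s r0 (s - h / 2).
    rewrite -e0; apply: (@dec _ s) => //; first lra.
    move=> v vs _; have [|_ [? ?]] := H v; first lra.
    have v01 : 0 < v < 1 by lra.
    eexists; first exact: (D_dv s v01).1.
    by have [_ qv] := pq v01; rewrite pmulr_rlt0//; apply: g0; lra.
  have [|_ [? ?]] := H (s - h / 2); first lra.
  by have := sgn (s - h / 2) ltac:(lra) ltac:(right; lra); lra.
Qed.

Let L0 : [/\ [/\ r0 (L 1) 0 = 1, r0 (L 2) 0 = 0 & r0 (L 3) 0 = 0],
  [/\ r2 (L 1) 0 = 0, r2 (L 2) 0 = 0 & r2 (L 3) 0 = 1] & r1 (L 2) 0 = 1].
Proof. by split; [split|split|]; rewrite /= (fp_z0 P) /=; ring. Qed.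

Let ge_right (f : R -> R) t : ct f t -> nr t (fun s => t < s -> 0 <= f s) -> 0 <= f t.
Proof.
move=> cf fs; rewrite -oppr_le0; apply: (ct_le_right (ctN cf)).
by apply: nr_imp fs => s h /h; rewrite oppr_le0.
Qed.

Let nonneg t : 0 < t < 1 -> 0 <= r0 (L 3) t /\ 0 <= r2 (L 1) t.
Proof.
move=> t01; have [[a1 a2 a3] [b1 b2 b3] _] := L0.
have t0 := proj1 (andP t01); split.
- have -> : r0 (L 3) t = D 0 r0 t by rewrite /D /lcomb b1 b2 b3; ring.
  apply: (ge_right (f := fun s => D s r0 t)).
    have [_ _ ?] := L_ct 1 0; have [_ _ ?] := L_ct 2 0; have [_ _ ?] := L_ct 3 0.
    by rewrite /D /lcomb; cts.
  apply: nr_imp (nr_itv 0 t0) => s st s0; apply: ltW; apply: D_gt0 => //; first lra.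
  by rewrite neq_lt; lra.
- have -> : r2 (L 1) t = D t r0 0 by rewrite /D /lcomb a1 a2 a3; ring.
  apply: (ge_right (f := fun s => D t r0 s)); first by have [] := D_ct t 0.
  apply: nr_imp (nr_itv 0 t0) => s st s0; apply: ltW; apply: D_gt0 => //; first lra.
  by rewrite neq_lt; lra.
Qed.

Let after (f g r : R -> R) t : 0 < t < 1 -> (forall s, 0 < s < 1 -> 0 < r s) ->
  (forall s, 0 < s < 1 -> dv f s (r s * g s)) -> f t = 0 ->
  nr t (fun s => t < s -> g s < 0) -> ~ (forall s, 0 < s < 1 -> 0 <= f s).
Proof.
move=> t01 rp df ft gn fn.
have [h h0 H] := nr_I gn (nr_itv t (h := 1 - t) ltac:(lra)).
have [|_ th] := H (t + h / 2); first lra.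
have : f (t + h / 2) < f t.
  apply: (@dec _ t); [lra|move=> u ut; apply: dv_ct (df u _); lra|].
  move=> u ut _; have [|gu _] := H u; first lra.
  have u01 : 0 < u < 1 by lra.
  eexists; first exact: df.
  by rewrite pmulr_rlt0 ?rp//; apply: gu; lra.
by rewrite ft ltNge fn//; lra.
Qed.

Let below (f : R -> R) t (d : R -> R) : 0 < t < 1 -> (forall s, 0 < s < 1 -> dv f s (d s)) ->
  f t = 0 -> nr t (fun s => d s < 0) -> nr t (fun s => t < s -> f s < 0).
Proof.
move=> t01 df ft dn; have t0 : 0 < Num.min t (1 - t) by rewrite lt_min; apply/andP; split; lra.
have m1 : Num.min t (1 - t) <= t by rewrite ge_min lexx.
have m2 : Num.min t (1 - t) <= 1 - t by rewrite ge_min lexx orbT.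
have [h h0 H] := nr_I dn (nr_itv t t0).
exists h => // s sh ts; rewrite -ft; apply: (@dec _ t) => //.
  by move=> u us; have [|_ ?] := H u; [lra|apply: dv_ct (df u _); lra].
move=> u us _; have [|du ?] := H u; first lra.
by exists (d u) => //; apply: df; lra.
Qed.

(** Zero minima have zero derivatives, so unit length reduces the k-row to its last entry and the
    i-row to its first, each 1 or -1. The value -1 would make one of the nonnegative functions
    negative just after t. The middle entry is then positive as a cofactor. *)
Let middle t : 0 < t < 1 -> r0 (L 3) t = 0 -> r0 (L 2) t = 0 /\ 0 < r1 (L 2) t.
Proof.
move=> t01 u0; have nz := fp_nz P t; have [pt qt] := pq t01.
have r13 : r1 (L 3) t = 0.
  have dd s : 0 < s < 1 -> dv (r0 (L 3)) s (q s * r1 (L 3) s) by move=> /(L_dv 3)[].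
  have nn s : 0 < s < 1 -> 0 <= r0 (L 3) s by move=> /nonneg[].
  by have /eqP := min_dv t01 dd nn u0; rewrite mulf_eq0 gt_eqF//= => /eqP.
have n3 := lrow_norm (i := 3) isT nz; rewrite u0 r13 expr0n !add0r in n3.
have c2 := lcol_norm (or_intror (or_intror erefl)) nz.
rewrite n3 in c2.
have [w0 r22] : r2 (L 1) t = 0 /\ r2 (L 2) t = 0.
  have : r2 (L 1) t ^+ 2 + r2 (L 2) t ^+ 2 == 0 by apply/eqP; move: c2; lra.
  by rewrite paddr_eq0 ?sqr_ge0// !expf_eq0 => /andP[/eqP-> /eqP->].
have r11 : r1 (L 1) t = 0.
  have dd s : 0 < s < 1 -> dv (r2 (L 1)) s (- (p s * r1 (L 1) s)) by move=> /(L_dv 1)[].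
  have nn s : 0 < s < 1 -> 0 <= r2 (L 1) s by move=> /nonneg[].
  by have /eqP := min_dv t01 dd nn w0; rewrite oppr_eq0 mulf_eq0 gt_eqF//= => /eqP.
have n1 := lrow_norm (i := 1) isT nz; rewrite w0 r11 expr0n !addr0 in n1.
have [c10 c12 c13] := L_ct 1 t; have [c30 c31 c32] := L_ct 3 t.
have t0 : 0 < Num.min t (1 - t) by rewrite lt_min; apply/andP; split; lra.
have m1 : Num.min t (1 - t) <= t by rewrite ge_min lexx.
have m2 : Num.min t (1 - t) <= 1 - t by rewrite ge_min lexx orbT.
have n3p : 0 < r2 (L 3) t.
  rewrite lt_def; apply/andP; split.
    by apply/eqP => e; move: n3; rewrite e expr0n => /eqP; rewrite eq_sym oner_eq0.
  rewrite leNgt; apply/negP => neg.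
  apply: (after (f := r0 (L 3)) (g := r1 (L 3)) t01 (fun s h => (pq h).2)).
  - by move=> s /(L_dv 3)[].
  - exact: u0.
  - apply: (below (d := fun s => p s * r2 (L 3) s - q s * r0 (L 3) s) t01 _ r13).
      by move=> s /(L_dv 3)[].
    have nn := nr_ct (ctN c32) (etrans (oppr_gt0 _) neg).
    apply: nr_imp (nr_I nn (nr_itv t t0)) => s [ng st].
    have s01 : 0 < s < 1 by lra.
    have [us _] := nonneg s01; have [ps qs] := pq s01.
    rewrite oppr_gt0 in ng.
    have : p s * r2 (L 3) s < 0 by rewrite pmulr_rlt0.
    by have := mulr_ge0 (ltW qs) us; lra.
  - by move=> s /nonneg[].
have n1p : 0 < r0 (L 1) t.
  rewrite lt_def; apply/andP; split.
    by apply/eqP => e; move: n1; rewrite e expr0n => /eqP; rewrite eq_sym oner_eq0.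
  rewrite leNgt; apply/negP => neg.
  apply: (after (f := r2 (L 1)) (g := fun s => - r1 (L 1) s) t01 (fun s h => (pq h).1)).
  - by move=> s /(L_dv 1)[_ _]; rewrite mulrN.
  - exact: w0.
  - apply: (below (d := fun s => - (p s * r2 (L 1) s - q s * r0 (L 1) s)) t01).
    + by move=> s /(L_dv 1)[_ + _]; exact: dvN.
    + by rewrite r11 oppr0.
    have nn := nr_ct (ctN c10) (etrans (oppr_gt0 _) neg).
    apply: nr_imp (nr_I nn (nr_itv t t0)) => s [ng st].
    have s01 : 0 < s < 1 by lra.
    have [_ ws] := nonneg s01; have [ps qs] := pq s01.
    rewrite oppr_gt0 in ng.
    have : q s * r0 (L 1) s < 0 by rewrite pmulr_rlt0.
    by have := mulr_ge0 (ltW ps) ws; lra.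
  - by move=> s /nonneg[].
have e2 : r0 (L 2) t = 0.
  have := lcol_norm (or_introl erefl) nz; rewrite n1 u0 expr0n addr0 => c0.
  have : r0 (L 2) t ^+ 2 == 0 by apply/eqP; move: c0; lra.
  by rewrite expf_eq0 => /eqP.
split => //.
have -> : r1 (L 2) t = r2 (L 3) t * r0 (L 1) t - r0 (L 3) t * r2 (L 1) t.
  have main (x y : R) : x * nrm (z t) = y -> x = y by rewrite nz mulr1.
  by apply: main; rewrite /nrm /=; ring.
by rewrite u0 mul0r subr0 mulr_gt0.
Qed.

(** Equality at s would make <gamma_l, j> increase through 0 at 0, s and 1, so that it has a further
    zero on each side of s. *)
Lemma three_point_delta t : 0 < t < 1 -> 0 < r0 (L 3) t /\ 0 < r2 (L 1) t.
Proof.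
suff up s : 0 < s < 1 -> 0 < r0 (L 3) s.
  move=> t01; have ut := up t t01; split => //.
  by apply: (lrow_w_gt0 (fp_nz P) (fp_c P) (fp_dz P) _ t01 ut) => s /nonneg[].
move=> s01; rewrite lt_def (nonneg s01).1 andbT; apply/eqP => us.
have [v0 v1] := middle s01 us.
have cv u : ct (r0 (L 2)) u by have [] := L_ct 2 u.
have incr a b : 0 <= a -> a < b -> b <= 1 -> (forall u, a < u < b -> 0 < r1 (L 2) u) ->
    r0 (L 2) a < r0 (L 2) b.
  move=> a0 ab b1 pos; apply: (@mono _ a) => // u uab _.
  have u01 : 0 < u < 1 by lra.
  have [d _ _] := L_dv 2 u01; eexists; first exact: d.
  by have [_ ?] := pq u01; rewrite mulr_gt0// pos.
have z1 : r0 (L 2) 1 = 0 /\ r1 (L 2) 1 = 1 by split; rewrite /= (fp_z1 P) /=; ring.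
have [_ _ r120] := L0; have [[_ r020 _] _ _] := L0.
have near u : 0 < r1 (L 2) u -> nr u (fun v => 0 < r1 (L 2) v).
  by move=> ?; apply: nr_ct => //; have [] := L_ct 2 u.
have [h h0 H] := near 0 (eq_ind_r (fun x => 0 < x) ltr01 r120).
have [h' h'0 H'] := near 1 (eq_ind_r (fun x => 0 < x) ltr01 z1.2).
have [k k0 K] := near s v1.
have [m [m0 mh mh' [mk ms ms']]] : exists m, [/\ 0 < m, m < h, m < h' & [/\ m < k, 2 * m < s &
  2 * m < 1 - s]].
  exists (Num.min (Num.min h h') (Num.min k (Num.min s (1 - s))) / 3).
  set M := Num.min _ _.
  have M0 : 0 < M by rewrite !lt_min h0 h'0 k0 /=; lra.
  have M1 : M <= h by rewrite !ge_min lexx.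
  have M2 : M <= h' by rewrite !ge_min lexx !orbT.
  have M3 : M <= k by rewrite !ge_min lexx !orbT.
  have M4 : M <= s by rewrite !ge_min lexx !orbT.
  have M5 : M <= 1 - s by rewrite !ge_min lexx !orbT.
  by split; [..|split]; lra.
have p1 : 0 < r0 (L 2) m by rewrite -r020; apply: incr; [lra..|move=> u um; apply: H; lra].
have p2 : r0 (L 2) (1 - m) < 0 by rewrite -z1.1; apply: incr; [lra..|move=> u um; apply: H'; lra].
have p3 : r0 (L 2) (s - m) < 0 by rewrite -v0; apply: incr; [lra..|move=> u um; apply: K; lra].
have p4 : 0 < r0 (L 2) (s + m) by rewrite -v0; apply: incr; [lra..|move=> u um; apply: K; lra].
have zero a b : a <= b -> 0 < r0 (L 2) a -> r0 (L 2) b < 0 ->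
    exists2 v, a <= v <= b & r0 (L 2) v = 0.
  move=> ab ha hb; have [|||v vab ve] := @ivt_zero _ (fun v => - r0 (L 2) v) a b ab.
  - by move=> v _; exact: ctN.
  - by rewrite oppr_le0 ltW.
  - by rewrite oppr_ge0 ltW.
  by exists v => //; apply: oppr_inj; rewrite ve oppr0.
have [a aI a0] := zero m (s - m) ltac:(lra) p1 p3.
have [b bI b0] := zero (s + m) (1 - m) ltac:(lra) p4 p2.
by apply: (T.2 a s b _ _ _ _ a0 v0 b0); lra.
Qed.

End DeltaLeft.

(** * Contacts and convexity *)

Section Contacts.
Context {R : realType}.

(* Up to vanishing lower terms, the derivatives of [dot a g] are positive
   multiples of the frame coordinates [rv]. *)
Definition jets n (rv : nat -> R -> R) (a : 'cV[R]_n.+1) (g : R -> 'cV[R]_n.+1) :=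
  forall (t : R) j, 0 < t < 1 -> (j <= n)%N -> (forall m, (m < j)%N -> rv m t = 0) ->
    exists2 u : R, 0 < u & dot a (derive01n j g t) = u * rv j t.

Lemma convex_contacts n (g : R -> 'cV[R]_n.+1) a (s : seq R) (k : R -> nat) :
  convex_curve g -> a != 0 -> uniq s ->
  (forall t, t \in s -> [/\ 0 < t < 1, (0 < k t)%N &
     forall j, (j < k t)%N -> dot a (derive01n j g t) = 0]) ->
  (\sum_(t <- s) k t <= n)%N.
Proof.
move=> [_ conv] a0 us sk; have [s' [m [us' s'E cm sm]]] := conv a a0.
have ss' t : t \in s -> t \in s'.
  by move=> /sk[t01 k0 kz]; apply/s'E; split => //; exact: (kz 0%N).
apply: leq_trans sm; apply: (@leq_trans (\sum_(t <- s) m t)%N).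
  rewrite big_seq [X in (_ <= X)%N]big_seq; apply: leq_sum => t ts.
  have [_ _ nz] := cm t (ss' t ts); have [_ _ kz] := sk t ts.
  by rewrite leqNgt; apply/negP => /kz e; rewrite e eqxx in nz.
have -> : (\sum_(t <- s) m t = \sum_(t <- s' | t \in s) m t)%N.
  rewrite -[RHS]big_filter; apply: perm_big; apply: uniq_perm => //; first exact: filter_uniq.
  by move=> t; rewrite mem_filter; have := ss' t; case: (t \in s) => //= ->.
by rewrite [X in (_ <= X)%N](bigID (mem s)) /= leq_addr.
Qed.

Lemma jets_zero n rv (a : 'cV[R]_n.+1) g t p : jets rv a g -> 0 < t < 1 -> (p <= n.+1)%N ->
  (forall m, (m < p)%N -> rv m t = 0) ->
  forall j, (j < p)%N -> dot a (derive01n j g t) = 0.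
Proof.
move=> J t01 pn z j jp; have [|m mj|u _ ->] := J t j t01.
- by rewrite -ltnS (leq_trans jp).
- by apply: z; exact: ltn_trans jp.
- by rewrite z// mulr0.
Qed.

Definition rvec (A : @row R) (m : nat) t := nth 0 [:: r0 A t; r1 A t; r2 A t; r3 A t] m.

Definition arow (z w : R -> @quatn R) (a : 'cV[R]_4) :=
  rcomb (qre a) (qi a) (qj a) (qk a) (qrow 0 z w) (qrow 1 z w) (qrow 2 z w) (qrow 3 z w).

Definition lvec (z : R -> @quatn R) (a : 'cV[R]_3) (m : nat) t :=
  lcomb z (a (inord 0) 0) (a (inord 1) 0) (a (inord 2) 0) (nth r0 [:: r0; r1; r2] m) t.

Lemma quat_neq0 (a : 'cV[R]_4) : a != 0 ->
  qre a ^+ 2 + qi a ^+ 2 + qj a ^+ 2 + qk a ^+ 2 != 0.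
Proof.
apply: contraNneq => /eqP; rewrite !paddr_eq0 ?addr_ge0 ?sqr_ge0// !expf_eq0 /=.
move=> /andP[/andP[/andP[/eqP e0 /eqP e1] /eqP e2] /eqP e3].
apply/eqP/matrixP => i j; rewrite ord1 mxE.
have : nat_of_ord i \in iota 0 4 by rewrite mem_iota ltn_ord.
have -> : i = inord i by rewrite inord_val.
by rewrite inordK//= !inE => /or4P[] /eqP ->.
Qed.

Lemma vec3_neq0 (a : 'cV[R]_3) : a != 0 ->
  a (inord 0) 0 ^+ 2 + a (inord 1) 0 ^+ 2 + a (inord 2) 0 ^+ 2 != 0.
Proof.
apply: contraNneq => /eqP; rewrite !paddr_eq0 ?addr_ge0 ?sqr_ge0// !expf_eq0 /=.
move=> /andP[/andP[/eqP e0 /eqP e1] /eqP e2].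
apply/eqP/matrixP => i j; rewrite ord1 mxE.
have : nat_of_ord i \in iota 0 3 by rewrite mem_iota ltn_ord.
have -> : i = inord i by rewrite inord_val.
by rewrite inordK//= !inE => /or3P[] /eqP ->.
Qed.

Lemma rcomb_norm (y0 y1 y2 y3 : R) (z w : R -> @quatn R) t : nrm (z t) = 1 -> nrm (w t) = 1 ->
  let A := rcomb y0 y1 y2 y3 (qrow 0 z w) (qrow 1 z w) (qrow 2 z w) (qrow 3 z w) in
  r0 A t ^+ 2 + r1 A t ^+ 2 + r2 A t ^+ 2 + r3 A t ^+ 2 = y0 ^+ 2 + y1 ^+ 2 + y2 ^+ 2 + y3 ^+ 2.
Proof.
move=> nz nw A.
transitivity ((y0 ^+ 2 + y1 ^+ 2 + y2 ^+ 2 + y3 ^+ 2) * (nrm (z t) * nrm (w t))); last first.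
  by rewrite nz nw !mulr1.
by rewrite /A /nrm /=; ring.
Qed.

Lemma lcomb_norm (y1 y2 y3 : R) (z : R -> @quatn R) t : nrm (z t) = 1 ->
  lcomb z y1 y2 y3 r0 t ^+ 2 + lcomb z y1 y2 y3 r1 t ^+ 2 + lcomb z y1 y2 y3 r2 t ^+ 2 =
  y1 ^+ 2 + y2 ^+ 2 + y3 ^+ 2.
Proof.
move=> nz; transitivity ((y1 ^+ 2 + y2 ^+ 2 + y3 ^+ 2) * nrm (z t) ^+ 2).
  by rewrite /lcomb /nrm /=; ring.
by rewrite nz expr1n mulr1.
Qed.

Lemma col_quat (y0 y1 y2 y3 : R) : let a := quat y0 y1 y2 y3 in
  [/\ qre a = y0, qi a = y1, qj a = y2 & qk a = y3].
Proof. by split; rewrite /qre /qi /qj /qk mxE inordK. Qed.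

Lemma convex_two_point (z w : R -> @quatn R) (g : R -> 'cV[R]_4) : convex_curve g ->
  (forall a, jets (rvec (arow z w a)) a g) -> two_point z w.
Proof.
move=> conv J y0 y1 y2 y3 s t A s01 t01 st s0 s1 t0 h.
have [a [a0 a1 a2 a3]] : exists a, [/\ qre a = y0, qi a = y1, qj a = y2 & qk a = y3].
  by exists (quat y0 y1 y2 y3); exact: col_quat.
have AE : A = arow z w a by rewrite /arow a0 a1 a2 a3.
apply/eqP; apply: contraT => nz.
have an : a != 0.
  apply: contraNneq nz => a00; rewrite -a0 -a1 -a2 -a3 a00 /qre /qi /qj /qk !mxE.
  by rewrite !expr0n !addr0.
have rz (u : R) m : nth 0 [:: r0 A u; r1 A u; r2 A u; r3 A u] m = 0 -> rvec (arow z w a) m u = 0.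
  by rewrite -AE.
have sum2 p q : (forall m, (m < p)%N -> rvec (arow z w a) m s = 0) ->
    (forall m, (m < q)%N -> rvec (arow z w a) m t = 0) -> (0 < p <= 4)%N -> (0 < q <= 4)%N ->
    (p + q <= 3)%N.
  move=> hp hq /andP[p0 p4] /andP[q0 q4].
  have := @convex_contacts 3 g a [:: s; t] (fun u => if u == s then p else q) conv an.
  rewrite /= !big_cons big_nil eqxx eq_sym (negbTE st) addn0 inE st; apply => //.
  move=> u; rewrite !inE => /orP[] /eqP ->.
    by rewrite eqxx; split => //; apply: jets_zero (J a) s01 p4 hp.
  by rewrite eq_sym (negbTE st); split => //; apply: jets_zero (J a) t01 q4 hq.
case: h => [s2|t1].
- suff : (3 + 1 <= 3)%N by [].
  apply: sum2 => // m.
    by move=> m3; apply: rz; case: m m3 => [|[|[|]]].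
  by case: m => // _; exact: rz.
- suff : (2 + 2 <= 3)%N by [].
  apply: sum2 => // m.
    by move=> m3; apply: rz; case: m m3 => [|[|]].
  by move=> m3; apply: rz; case: m m3 => [|[|]].
Qed.

Lemma convex_three_point (z : R -> @quatn R) (g : R -> 'cV[R]_3) : (forall t, nrm (z t) = 1) ->
  convex_curve g -> (forall a, jets (lvec z a) a g) -> three_point z.
Proof.
move=> nz conv J; pose vec (y1 y2 y3 : R) : 'cV[R]_3 := \col_i [:: y1; y2; y3]`_i.
have vE y1 y2 y3 : [/\ vec y1 y2 y3 (inord 0) 0 = y1, vec y1 y2 y3 (inord 1) 0 = y2 &
   vec y1 y2 y3 (inord 2) 0 = y3] by split; rewrite mxE inordK.
have vn y1 y2 y3 : y1 ^+ 2 + y2 ^+ 2 + y3 ^+ 2 != 0 -> vec y1 y2 y3 != 0.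
  apply: contraNneq => e; have [e1 e2 e3] := vE y1 y2 y3.
  rewrite e !mxE in e1; rewrite e !mxE in e2; rewrite e !mxE in e3.
  by rewrite -e1 -e2 -e3 !expr0n !addr0.
have lE y1 y2 y3 m t : lvec z (vec y1 y2 y3) m t = lcomb z y1 y2 y3 (nth r0 [:: r0; r1; r2] m) t.
  by have [e1 e2 e3] := vE y1 y2 y3; rewrite /lvec e1 e2 e3.
split.
- move=> y1 y2 y3 s t s01 t01 st s0 s1 t0; apply/eqP; apply: contraT => /vn an.
  have := @convex_contacts 2 g _ [:: s; t] (fun u => if u == s then 2 else 1) conv an.
  rewrite /= !big_cons big_nil eqxx eq_sym (negbTE st) addn0 inE st; apply => //.
  move=> u; rewrite !inE => /orP[] /eqP ->.
    rewrite eqxx; split => //; apply: jets_zero (J _) s01 _ _ => // m.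
    by rewrite lE; case: m => [|[|]].
  rewrite eq_sym (negbTE st); split => //; apply: jets_zero (J _) t01 _ _ => // m.
  by rewrite lE; case: m.
- move=> s t u s0 st tu u1 zs zt zu.
  have an : vec 0 1 0 != 0 by apply: vn; rewrite expr0n expr1n add0r addr0 oner_eq0.
  have := @convex_contacts 2 g _ [:: s; t; u] (fun=> 1%N) conv an.
  have su := lt_trans st tu.
  rewrite /= !big_cons big_nil !inE !negb_or (lt_eqF st) (lt_eqF su) (lt_eqF tu) /= => h.
  suff : (1 + (1 + (1 + 0)) <= 2)%N by [].
  apply: h => // v vI; have [v01 zv] : 0 < v < 1 /\ r0 (lrow 2 z) v = 0.
    by move: vI; rewrite !inE => /or3P[] /eqP ->; split => //; lra.
  split => //; apply: jets_zero (J _) v01 _ _ => // m.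
  by rewrite lE; case: m => // _; rewrite /lcomb !mul0r add0r addr0 mul1r.
Qed.

Lemma spin_path_convex (z w : R -> @quatn R) c th (g : R -> 'cV[R]_4) : spin_path z w c th ->
  smooth_sphere_curve g -> (forall a, jets (rvec (arow z w a)) a g) -> convex_curve g.
Proof.
move=> S sm J; split => // a an.
pose A := arow z w a; pose E i := qrow i z w.
have sE i : sol c 0 0 1 (E i).
  split=> [t _|t t01 _]; first exact: qrow_ct (sp_z S t) (sp_w S t).
  exact: (sp_row S).
have sA : sol c 0 0 1 A.
  exact: (sol_rcomb _ _ _ _ (sE 0%N) (sE 1%N) (sE 2%N) (sE 3%N)).
have pc : posc c 0 0 1 by move=> t t01 _; exact: (sp_c S).
have pos t : 0 < t < 1 -> [/\ 0 < r0 (E 3) t, 0 < w01 (E 2) (E 3) t &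
    0 < W012 (E 1) (E 2) (E 3) t] by move=> t01; exact (minors_pos S t01).
apply: (@convex_of_chain R 3 g a (wchain4 A (E 1) (E 2) (E 3))).
- apply: (wchain4_chain (lexx 0) pc sA (sE 1%N) (sE 2%N) (sE 3%N) pos) => t t01.
  apply: contraT; rewrite !negb_or !negbK => /and4P[/eqP e0 /eqP e1 /eqP e2 /eqP e3].
  have := rcomb_norm (qre a) (qi a) (qj a) (qk a) (sp_nz S t) (sp_nw S t).
  rewrite /= -/A.
  rewrite [X in X + _ + _ + _](_ : _ = r0 A t ^+ 2)// [X in _ + X + _ + _](_ : _ = r1 A t ^+ 2)//.
  rewrite [X in _ + _ + X + _](_ : _ = r2 A t ^+ 2)// [X in _ + _ + _ +
    X = _](_ : _ = r3 A t ^+ 2)//.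
  rewrite e0 e1 e2 e3 !expr0n !addr0 => /esym/eqP.
  by rewrite (negbTE (quat_neq0 an)).
- move=> t j t01 j3 z0; have [p1 p2 p3] := pos t t01.
  have [-> nz] := wchain4_eq0 j3 p1 p2 p3 z0.
  have [u u0 ->] := J a t j t01 j3 nz.
  by rewrite mulf_eq0 (gt_eqF u0) orFb.
Qed.

Lemma left_convex (z : R -> @quatn R) (q p : R -> R) (g : R -> 'cV[R]_3) :
  (forall t, nrm (z t) = 1) -> (forall t, 0 < t < 1 -> 0 < q t /\ 0 < p t) ->
  (forall t, 0 < t < 1 -> dvq z t (spin (p t) (q t) (z t))) ->
  (forall t, 0 < t < 1 -> 0 < r0 (lrow 3 z) t /\ 0 < r2 (lrow 1 z) t) ->
  smooth_sphere_curve g -> (forall a, jets (lvec z a) a g) -> convex_curve g.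
Proof.
move=> nz pq dz delta sm J; split => // a an.
pose A := Row (lvec z a 0) (lvec z a 1) (lvec z a 2) (fun=> 0).
have pos t : 0 < t < 1 -> 0 < r0 (lrow 3 z) t /\ 0 < w01 (lrow 2 z) (lrow 3 z) t.
  move=> t01; have [h1 h2] := delta t t01; split => //.
  (* This minor is the cofactor of the entry <n_l, i> of a rotation matrix, hence equal to it. *)
  suff -> : w01 (lrow 2 z) (lrow 3 z) t = r2 (lrow 1 z) t * nrm (z t) by rewrite nz mulr1.
  by rewrite /w01 /nrm /=; ring.
apply: (@convex_of_chain R 2 g a (wchain3 A (lrow 2 z) (lrow 3 z))).
- apply: (wchain3_chain pq _ pos) => t t01.
    have dL i := lrow_dv i (dz t t01); split; try exact: dL.
    have [? ? ?] := dL 1%N; have [? ? ?] := dL 2%N; have [? ? ?] := dL 3%N.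
    by split; rewrite /A /lvec /lcomb [lrow]lock /= -lock; dvr.
  apply: contraT; rewrite !negb_or !negbK => /and3P[/eqP e0 /eqP e1 /eqP e2].
  have := lcomb_norm (a (inord 0) 0) (a (inord 1) 0) (a (inord 2) 0) (nz t).
  rewrite [lcomb _ _ _ _ r0 t]e0 [lcomb _ _ _ _ r1 t]e1 [lcomb _ _ _ _ r2 t]e2.
  rewrite !expr0n !addr0 => /esym/eqP.
  by rewrite (negbTE (vec3_neq0 an)).
- move=> t j t01 j3 z0; have [p1 p2] := pos t t01.
  have [-> nz'] := wchain3_eq0 j3 p1 p2 z0.
  have jE m : (m <= 2)%N -> nth 0 [:: r0 A t; r1 A t; r2 A t] m = lvec z a m t.
    by case: m => [|[|[|]]].
  have nz2 m : (m < j)%N -> lvec z a m t = 0.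
    by move=> mj; rewrite -jE ?nz'//; apply: ltnW; exact: leq_trans j3.
  have [u u0 ->] := J a t j t01 j3 nz2.
  by rewrite mulf_eq0 (gt_eqF u0) orFb -jE.
Qed.

End Contacts.

(** * Differentiation on [0,1] *)

Section Closed.
Context {R : realType}.
Implicit Types (f g : R -> R) (t : R).

Local Notation near01 t := (within `[0, 1]%classic ((t : R)^')).

Lemma near01P t (P : set R) : near01 t P <->
  exists2 h : R, 0 < h & forall s, 0 <= s <= 1 -> s != t -> `|s - t| < h -> P s.
Proof.
split.
- move=> /nbhs_ballP[h /= h0 H]; exists h => // s s01 st sh.
  by apply: H => //; rewrite /ball /= distrC.
- move=> [h h0 H]; apply/nbhs_ballP; exists h => //= s /=; rewrite /ball /= distrC => sh st.
  by rewrite in_itv /= => s01; exact: H.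
Qed.

Lemma near01_proper t : 0 <= t <= 1 -> ProperFilter (near01 t).
Proof.
move=> t01; apply: Build_ProperFilter_ex => P /near01P[h h0 H].
have [m [m0 mh m1]] : exists m : R, [/\ 0 < m, m < h & m <= 1 / 2].
  exists (Num.min h 1 / 2).
  have : 0 < Num.min h 1 by rewrite lt_min h0 ltr01.
  have : Num.min h 1 <= h /\ Num.min h 1 <= 1 by rewrite !ge_min !lexx orbT.
  by move=> [? ?] ?; split; lra.
have [th|th] := leP t (1 / 2).
- exists (t + m); apply: H; first lra.
    by apply/eqP => e; lra.
  by rewrite addrAC subrr add0r gtr0_norm.
- exists (t - m); apply: H; first lra.
    by apply/eqP => e; lra.
  by rewrite addrAC subrr add0r normrN gtr0_norm.
Qed.

Definition hasd f t (d : R) := (s - t)^-1 * (f s - f t) @[s --> near01 t] --> d.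

Lemma hasd_uniq f t d e : 0 <= t <= 1 -> hasd f t d -> hasd f t e -> d = e.
Proof.
move=> t01 hd he; have PF := near01_proper t01.
exact: (cvg_unique (@norm_hausdorff R R) hd he).
Qed.

Lemma hasd_ext f g t d : 0 <= t <= 1 -> (forall s, 0 <= s <= 1 -> f s = g s) ->
  hasd f t d -> hasd g t d.
Proof.
move=> t01 fg hf; apply: (cvg_trans _ hf); apply: near_eq_cvg.
by apply/near01P; exists 1 => // s s01 _ _; rewrite !fg.
Qed.

Lemma hasd_cvg f t d : hasd f t d -> f s @[s --> near01 t] --> f t.
Proof.
move=> hf; have id0 : s - t @[s --> near01 t] --> (0 : R).
  apply/cvgrPdist_lt => e e0; apply/near01P; exists e => // s _ _.
  by rewrite sub0r normrN.
pose proof (cvgD (cvgM id0 hf) (cvg_cst (f t))) as lim.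
rewrite mul0r add0r in lim; apply: (cvg_trans _ lim).
apply: near_eq_cvg; apply/near01P; exists 1 => // s _ st _ /=.
change ((s - t) * ((s - t)^-1 * (f s - f t)) + f t = f s).
by rewrite mulrA divff ?subr_eq0// mul1r subrK.
Qed.

Lemma hasd_cst (x : R) t : hasd (fun=> x) t 0.
Proof.
rewrite /hasd; under eq_fun do rewrite subrr mulr0.
exact: cvg_cst.
Qed.

Lemma hasdD f g t d e : hasd f t d -> hasd g t e -> hasd (fun s => f s + g s) t (d + e).
Proof.
move=> hf hg; pose proof (cvgD hf hg) as lim.
apply: (cvg_trans _ lim); apply: near_eq_cvg; apply/near01P; exists 1 => // s _ _ _.
change ((s - t)^-1 * (f s - f t) + (s - t)^-1 * (g s - g t) =
  (s - t)^-1 * (f s + g s - (f t + g t))); ring.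
Qed.

Lemma hasdN f t d : hasd f t d -> hasd (fun s => - f s) t (- d).
Proof.
move=> hf; pose proof (cvgN hf) as lim.
apply: (cvg_trans _ lim); apply: near_eq_cvg; apply/near01P; exists 1 => // s _ _ _.
change (- ((s - t)^-1 * (f s - f t)) = (s - t)^-1 * (- f s - - f t)); ring.
Qed.

Lemma hasdM f g t d e : hasd f t d -> hasd g t e ->
  hasd (fun s => f s * g s) t (d * g t + f t * e).
Proof.
move=> hf hg; pose proof (cvgD (cvgM hf (hasd_cvg hg)) (cvgM (cvg_cst (f t)) hg)) as lim.
apply: (cvg_trans _ lim); apply: near_eq_cvg; apply/near01P; exists 1 => // s _ _ _.
change ((s - t)^-1 * (f s - f t) * g s + f t * ((s - t)^-1 * (g s - g t)) =
  (s - t)^-1 * (f s * g s - f t * g t)); ring.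
Qed.

(** With r = 1/sqrt(f), so that r^2 f = 1, the difference quotient of r is that of f times - r(s)^2
    r(t)^2 / (r(s) + r(t)). *)
Lemma hasd_rsqrt f t d : 0 <= t <= 1 -> (forall s, 0 <= s <= 1 -> 0 < f s) -> hasd f t d ->
  hasd (fun s => (Num.sqrt (f s))^-1) t (- 2^-1 * ((Num.sqrt (f t))^-1) ^+ 3 * d).
Proof.
move=> t01 fp hf; set r := fun s => (Num.sqrt (f s))^-1.
have fc := hasd_cvg hf.
have rt : Num.sqrt (f t) != 0 by rewrite sqrtr_eq0 -ltNge fp.
have rc : r s @[s --> near01 t] --> r t.
  apply: cvgV => //.
  apply: (cvg_comp _ _ fc); exact: (@sqrt_continuous R (f t)).
have rp s : 0 <= s <= 1 -> 0 < r s /\ r s ^+ 2 * f s = 1.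
  move=> s01; have fs := fp s s01; split; first by rewrite invr_gt0 sqrtr_gt0.
  by rewrite /r exprVn sqr_sqrtr ?ltW// mulVf// gt_eqF.
have [rt0 rt2] := rp t t01.
have den : (r s + r t)^-1 @[s --> near01 t] --> (r t + r t)^-1.
  apply: cvgV; first by rewrite gt_eqF// addr_gt0.
  by apply: cvgD rc _; exact: cvg_cst.
pose proof (cvgM (cvgM (cvgM (cvgM rc rc) (cvg_cst (- (r t ^+ 2)))) hf) den) as lim.
rewrite /hasd (_ : - 2^-1 * _ * d = r t * r t * - r t ^+ 2 * d * (r t + r t)^-1); last first.
  by rewrite -/(r t); field; rewrite gt_eqF// addr_gt0.
apply: (cvg_trans _ lim); apply: near_eq_cvg.
apply/near01P; exists 1 => // s s01 st _; have [rs0 rs2] := rp s s01.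
change (r s * r s * - r t ^+ 2 * ((s - t)^-1 * (f s - f t)) * (r s + r t)^-1 =
  (s - t)^-1 * (r s - r t)).
have n1 : r s + r t != 0 by rewrite gt_eqF// addr_gt0.
have -> : f s = (r s ^+ 2)^-1 
  by rewrite -[LHS]mul1r -[1](mulVf (lt0r_neq0 (exprn_gt0 2 rs0))) -mulrA rs2 mulr1.
have -> : f t = (r t ^+ 2)^-1.
  by rewrite -[LHS]mul1r -[1](mulVf (lt0r_neq0 (exprn_gt0 2 rt0))) -mulrA rt2 mulr1.
have n2 := lt0r_neq0 rs0; have n3 := lt0r_neq0 rt0; have n4 : s - t != 0 by rewrite subr_eq0.
by field; rewrite n1 n2 n3 n4.
Qed.

(* k times differentiable on [0,1], one-sidedly at the end points. *)
Fixpoint sm (k : nat) f : Prop :=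
  if k is k'.+1 then exists2 g, sm k' g & forall t, 0 <= t <= 1 -> hasd f t (g t)
  else True.

Lemma sm_ext k f g : (forall t, 0 <= t <= 1 -> f t = g t) -> sm k f -> sm k g.
Proof.
move=> fg; case: k => //= k [f' sf df]; exists f' => // t t01.
by apply: hasd_ext (df t t01).
Qed.

Lemma smS k f : sm k.+1 f -> sm k f.
Proof.
elim: k f => // k IH f [g sg dg]; exists g => //; exact: IH.
Qed.

Lemma sm_cst k (x : R) : sm k (fun=> x).
Proof. by elim: k x => //= k IH x; exists (fun=> 0) => // t _; exact: hasd_cst. Qed.

Lemma smD k f g : sm k f -> sm k g -> sm k (fun s => f s + g s).
Proof.
elim: k f g => //= k IH f g [f' sf df] [g' sg dg]; exists (fun s => f' s + g' s).
  exact: IH.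
by move=> t t01; apply: hasdD; [exact: df|exact: dg].
Qed.

Lemma smN k f : sm k f -> sm k (fun s => - f s).
Proof.
elim: k f => //= k IH f [f' sf df]; exists (fun s => - f' s); first exact: IH.
by move=> t t01; apply: hasdN; exact: df.
Qed.

Lemma smM k f g : sm k f -> sm k g -> sm k (fun s => f s * g s).
Proof.
elim: k f g => // k IH f g sf sg; have [f' sf' df] := sf; have [g' sg' dg] := sg.
exists (fun s => f' s * g s + f s * g' s).
  by apply: smD; apply: IH => //; exact: smS.
by move=> t t01; apply: hasdM; [exact: df|exact: dg].
Qed.

(** The derivative of the inverse root is polynomial in the inverse root and f', so the induction
    closes; the root itself is later recovered as f times its inverse root. *)
Lemma sm_rsqrt k f : (forall s, 0 <= s <= 1 -> 0 < f s) -> sm k f ->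
  sm k (fun s => (Num.sqrt (f s))^-1).
Proof.
move=> fp; elim: k => // k IH sf; have [f' sf' df] := sf.
have sr := IH (smS sf).
exists (fun t => - 2^-1 * ((Num.sqrt (f t))^-1) ^+ 3 * f' t).
  apply: smM => //; apply: smM; first exact: sm_cst.
  exact (smM sr (smM sr sr)).
by move=> t t01; apply: hasd_rsqrt => //; exact: df.
Qed.

Lemma hasd_dv f t d : 0 < t < 1 -> hasd f t d -> dv f t d.
Proof.
move=> t01 /cvgrPdist_lt hf.
have c : h^-1 *: ((f \o shift t) (h *: 1) - f t) @[h --> (0 : R)^'] --> d.
  apply/cvgrPdist_lt => e e0; have /near01P[h h0 H] := hf e e0.
  have m0 : 0 < Num.min h (Num.min t (1 - t)).
    by rewrite !lt_min h0 /=; apply/andP; split; lra.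
  have m1 : Num.min h (Num.min t (1 - t)) <= h by rewrite !ge_min lexx.
  have m2 : Num.min h (Num.min t (1 - t)) <= t by rewrite !ge_min lexx !orbT.
  have m3 : Num.min h (Num.min t (1 - t)) <= 1 - t by rewrite !ge_min lexx !orbT.
  apply/nbhs_ballP; exists (Num.min h (Num.min t (1 - t))) => //= s /=.
  rewrite /ball /= sub0r normrN => sm s0; rewrite /shift /= [s *: 1]mulr1.
  have [s1 s2] : - Num.min h (Num.min t (1 - t)) < s /\ s < Num.min h (Num.min t (1 - t)).
    by move: sm; rewrite ltr_norml => /andP[].
  have := H (s + t); rewrite addrK; apply; first lra.
    by rewrite -subr_eq0 addrK.
  exact: lt_le_trans m1.
apply: DeriveDef; first by apply/cvg_ex; exists d.
by apply: cvg_lim c; exact: norm_hausdorff.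
Qed.

Definition clamp t : R := Num.min 1 (Num.max 0 t).

Lemma clamp01 t : 0 <= clamp t <= 1.
Proof. by rewrite /clamp le_min ge_min lexx le_max lexx ler01. Qed.

Lemma clamp_id t : 0 <= t <= 1 -> clamp t = t.
Proof. by move=> /andP[t0 t1]; rewrite /clamp max_r// min_r. Qed.

Lemma clamp_ct t : ct clamp t.
Proof. by apply: ct_min; [exact: ct_cst|apply: ct_max; [exact: ct_cst|exact: ct_id]]. Qed.

End Closed.

(** * Gram-Schmidt frames and Frenet equations *)

Section Vectors.
Context {R : realType} {n : nat}.
Implicit Types (h : R -> 'cV[R]_n.+1) (t : R) (u v q : 'cV[R]_n.+1).

Local Notation near01 t := (within `[0, 1]%classic ((t : R)^')).

Lemma derivable01_hasd h t : derivable01 h t ->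
  forall i, hasd (fun s => h s i 0) t (derive01 h t i 0).
Proof.
move=> dh i; have c := @coord_continuous R n.+1 1 i 0 (derive01 h t).
have lim : diffquot h t s i 0 @[s --> near01 t] --> derive01 h t i 0 by apply: (cvg_comp _ _ dh c).
apply: (cvg_trans _ lim); apply: near_eq_cvg.
by apply/near01P; exists 1 => // s _ _ _; rewrite /diffquot !mxE.
Qed.

Lemma hasd_derivable01 h t (d : 'I_n.+1 -> R) : 0 <= t <= 1 ->
  (forall i, hasd (fun s => h s i 0) t (d i)) ->
  derivable01 h t /\ forall i, derive01 h t i 0 = d i.
Proof.
move=> t01 hd; have PF := near01_proper t01.
have lim : diffquot h t s @[s --> near01 t] --> (\col_i d i : 'cV[R]_n.+1).
  apply/cvg_ballP => e e0.
  have near_i i : \forall s \near near01 t, `|d i - (s - t)^-1 * (h s i 0 - h t i 0)| < e.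
    by move: (hd i) => /cvgrPdist_lt; apply.
  pose proof (filter_forall _ near_i) as near_all; apply: filterS near_all => s hs; split => // i j.
  by rewrite ord1 /diffquot !mxE; exact: hs.
have dh : derivable01 h t by apply/cvg_ex; exists (\col_i d i).
split => // i; exact (hasd_uniq t01 (derivable01_hasd dh (i := i)) (hd i)).
Qed.

Definition smv k h := forall i, sm k (fun t => h t i 0).

Lemma smooth01_smv h k j : smooth01 h -> smv k (derive01n j h).
Proof.
move=> sh; elim: k j => // k IH j i; exists (fun t => derive01n j.+1 h t i 0); first exact: IH.
by move=> t t01; apply: derivable01_hasd; apply: sh; rewrite in_itv.
Qed.

Lemma smv_smooth01 h : (forall k, smv k h) -> smooth01 h.
Proof.
move=> sh; have main j k : smv k (derive01n j h).
  elim: j k => [|j IH] k i; first exact: sh.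
  have [g sg dg] := IH k.+1 i; apply: sm_ext sg => t t01.
  have /choice[f ff] : forall i, exists y : R, hasd (fun s => derive01n j h s i 0) t y.
    by move=> i'; have [g' _ dg'] := IH 1%N i'; exists (g' t); exact: dg'.
  have [_ ->] := hasd_derivable01 t01 ff.
  exact: hasd_uniq t01 (dg t t01) (ff i).
move=> k t; rewrite in_itv /= => t01.
have /choice[f ff] : forall i, exists y : R, hasd (fun s => derive01n k h s i 0) t y.
  by move=> i; have [g' _ dg'] := main k 1%N i; exists (g' t); exact: dg'.
by have [] := hasd_derivable01 t01 ff.
Qed.

Lemma sm_sum k (I : finType) (P : pred I) (f : I -> R -> R) : (forall i, sm k (f i)) ->
  sm k (fun t => \sum_(i | P i) f i t).
Proof.
move=> sf; have : forall r : seq I, sm k (fun t => \sum_(i <- r | P i) f i t); last exact.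
elim=> [|i r IH].
  by apply: sm_ext (sm_cst k 0) => t _; rewrite big_nil.
have [Pi|Pi] := boolP (P i).
  by apply: sm_ext (smD (sf i) IH) => t _; rewrite big_cons Pi.
by apply: sm_ext IH => t _; rewrite big_cons (negbTE Pi).
Qed.

Lemma sm_dot k (f g : R -> 'cV[R]_n.+1) : smv k f -> smv k g -> sm k (fun t => dot (f t) (g t)).
Proof. by move=> sf sg; apply: sm_sum => i; apply: smM; [exact: sf|exact: sg]. Qed.

Lemma dotC u v : dot u v = dot v u.
Proof. by rewrite /dot; apply: eq_bigr => i _; rewrite mulrC. Qed.

Lemma dotDr u v q : dot u (v + q) = dot u v + dot u q.
Proof. by rewrite /dot -big_split; apply: eq_bigr => i _; rewrite mxE mulrDr. Qed.

Lemma dotZr u v (x : R) : dot u (x *: v) = x * dot u v.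
Proof. by rewrite /dot mulr_sumr; apply: eq_bigr => i _; rewrite mxE; ring. Qed.

Lemma dot_sumr u (I : finType) (f : I -> 'cV[R]_n.+1) :
  dot u (\sum_i f i) = \sum_i dot u (f i).
Proof.
rewrite /dot exchange_big; apply: eq_bigr => i _.
by rewrite summxE mulr_sumr.
Qed.

Lemma dot_ge0 u : 0 <= dot u u.
Proof. by apply: sumr_ge0 => i _; rewrite -expr2 sqr_ge0. Qed.

Lemma dot_eq0 u : dot u u = 0 -> u = 0.
Proof.
move/psumr_eq0P => h; apply/matrixP => i j; rewrite ord1 mxE.
have /eqP : u i 0 * u i 0 = 0 by apply: h => // k _; rewrite -expr2 sqr_ge0.
by rewrite mulf_eq0 orbb => /eqP.
Qed.

(** True for the null vector too, so the triangular expansion below needs no linear independence. *)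
Lemma normalizeK u : l2norm u *: normalize u = u.
Proof.
rewrite /normalize scalerA; have [u0|u0] := eqVneq (l2norm u) 0.
  rewrite u0 mul0r scale0r; apply/esym/dot_eq0/eqP.
  by rewrite eq_le dot_ge0 andbT -sqrtr_eq0; apply/eqP.
by rewrite divff// scale1r.
Qed.

Implicit Types V : nat -> 'cV[R]_n.+1.

Lemma size_gram_schmidt V k : size (gram_schmidt V k) = k.
Proof. by elim: k => //= k IH; rewrite size_rcons IH. Qed.

Definition gs V j : 'cV[R]_n.+1 := (gram_schmidt V j.+1)`_j.

Lemma gram_schmidt_nth V k j : (j < k)%N -> (gram_schmidt V k)`_j = gs V j.
Proof.
elim: k => // k IH; rewrite ltnS leq_eqVlt => /predU1P[->//|jk].
by rewrite /= nth_rcons size_gram_schmidt jk IH.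
Qed.

Definition resid V j : 'cV[R]_n.+1 := V j - \sum_(m < j) dot (V j) (gs V m) *: gs V m.

Lemma gsE V j : gs V j = normalize (resid V j).
Proof.
rewrite {1}/gs /= nth_rcons size_gram_schmidt ltnn eqxx; congr (normalize (_ - _)).
rewrite (big_nth 0) size_gram_schmidt big_mkord; apply: eq_bigr => m _.
by rewrite gram_schmidt_nth.
Qed.

Lemma gs_expand V j :
  V j = l2norm (resid V j) *: gs V j + \sum_(m < j) dot (V j) (gs V m) *: gs V m.
Proof. by rewrite gsE normalizeK /resid subrK. Qed.

Lemma dot_gs_expand V j u : (forall m, (m < j)%N -> dot u (gs V m) = 0) ->
  dot u (V j) = l2norm (resid V j) * dot u (gs V j).
Proof.
move=> z; rewrite {1}gs_expand dotDr dotZr dot_sumr big1 ?addr0// => m _.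
by rewrite dotZr z ?mulr0.
Qed.

(** Uniqueness of the QR factorization with positive diagonal, by induction on the column. *)
Lemma gs_unique V (q : nat -> 'cV[R]_n.+1) (x : nat -> R) (y : nat -> nat -> R) N :
  (forall i j, (i < N)%N -> (j < N)%N -> dot (q i) (q j) = (i == j)%:R) ->
  (forall j, (j < N)%N -> 0 < x j /\ V j = x j *: q j + \sum_(m < j) y j m *: q m) ->
  forall j, (j < N)%N -> gs V j = q j /\ l2norm (resid V j) = x j.
Proof.
move=> oq Vq; suff main j : forall i, (i < j)%N -> (i < N)%N -> gs V i = q i /\
  l2norm (resid V i) = x i.
  by move=> j; apply: (main j.+1).
elim: j => // j IH i; rewrite ltnS leq_eqVlt => /predU1P[->|]; last exact: IH.
move=> jN; have [xj Vj] := Vq j jN.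
have r : resid V j = x j *: q j.
  rewrite /resid {1}Vj -addrA -sumrB big1 ?addr0// => m _.
  have mN : (m < N)%N by exact: ltn_trans jN.
  have [-> _] := IH m (ltn_ord m) mN.
  rewrite Vj dotC dotDr dotZr oq// (ltn_eqF (ltn_ord m)) mulr0 add0r dot_sumr (bigD1 m)//= big1 ?addr0.
    by rewrite dotZr oq// eqxx mulr1 subrr.
  move=> k km; rewrite dotZr oq ?(ltn_trans _ jN)//.
  have -> : (m == k :> nat) = false by apply/negbTE; rewrite eq_sym.
  by rewrite mulr0.
have nr : l2norm (resid V j) = x j.
  rewrite /l2norm r dotZr dotC dotZr oq// eqxx mulr1 -expr2 sqrtr_sqr.
  by rewrite gtr0_norm.
by split => //; rewrite gsE /normalize nr r scalerA mulVf ?scale1r// gt_eqF.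
Qed.

(** The change of basis of [gs_expand] is triangular. Since independence is not assumed, a nonzero
    determinant yields that all residual norms are positive. *)
Lemma det_gs V : \det (\matrix_(i < n.+1, j < n.+1) V j i 0) =
  \det (\matrix_(i < n.+1, j < n.+1) gs V j i 0) * \prod_(j < n.+1) l2norm (resid V j).
Proof.
pose U := \matrix_(m < n.+1, j < n.+1) (if m == j then l2norm (resid V j)
  else if (m < j)%N then dot (V j) (gs V m) else 0).
rewrite (_ : \matrix_(i, j) V j i 0 = (\matrix_(i < n.+1, j < n.+1) gs V j i 0) *m U).
  rewrite det_mulmx; congr (_ * _); rewrite -det_tr det_trig.
    by apply: eq_bigr => i _; rewrite !mxE eqxx.
  apply/is_trig_mxP => i j ij; rewrite !mxE.
  by rewrite (gtn_eqF ij : (j == i) = false) ltnNge ltnW.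
apply/matrixP => i j; rewrite !mxE {1}(gs_expand V j) mxE summxE.
rewrite [RHS](bigD1 j)//= !mxE eqxx; congr (_ + _); first by rewrite mulrC.
pose F m := dot (V j) (gs V m) * gs V m i 0.
have -> : \sum_(m < j) (dot (V j) (gs V m) *: gs V m) i 0 = \sum_(m < j) F m.
  by apply: eq_bigr => m _; rewrite mxE.
rewrite (big_ord_widen n.+1 F (ltnW (ltn_ord j))) [LHS]big_mkcond [RHS]big_mkcond.
apply: eq_bigr => m _; rewrite !mxE; have [->|mj] := eqVneq m j; first by rewrite ltnn.
by case: ifP => _; rewrite ?mulr0// mulrC.
Qed.

End Vectors.

Section Frenet.
Context {R : realType} {n : nat}.
Implicit Types (t : R).

Definition hasdv (f : R -> 'cV[R]_n.+1) t (d : 'cV[R]_n.+1) :=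
  forall i, hasd (fun s => f s i 0) t (d i 0).

Lemma hasd_sum t (I : finType) (f : I -> R -> R) (d : I -> R) :
  (forall i, hasd (f i) t (d i)) -> hasd (fun s => \sum_i f i s) t (\sum_i d i).
Proof.
move=> fd; have : forall r : seq I, hasd (fun s => \sum_(i <- r) f i s) t (\sum_(i <- r) d i);
  last exact.
elim=> [|i r IH].
  by rewrite big_nil; under eq_fun do rewrite big_nil; exact: hasd_cst.
rewrite big_cons; under eq_fun do rewrite big_cons.
by apply: hasdD.
Qed.

Lemma hasd_dot f g t d e : hasdv f t d -> hasdv g t e ->
  hasd (fun s => dot (f s) (g s)) t (dot d (g t) + dot (f t) e).
Proof.
move=> fd ge; rewrite /dot -big_split /=.
by apply: (@hasd_sum t _ (fun i s => f s i 0 * g s i 0) (fun i => d i 0 * g t i 0 +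
  f t i 0 * e i 0)) => i;
  exact: hasdM.
Qed.

Variable V : R -> nat -> 'cV[R]_n.+1.
Hypothesis V_smooth : forall j k, smv k (fun t => V t j).
Variable N : nat.
Hypothesis V_pos : forall t j, 0 <= t <= 1 -> (j < N)%N -> 0 < l2norm (resid (V t) j).

Lemma gs_smooth k j : (j < N)%N -> smv k (fun t => gs (V t) j) /\
  sm k (fun t => l2norm (resid (V t) j)) /\ sm k (fun t => (l2norm (resid (V t) j))^-1).
Proof.
elim/ltn_ind: j => j IH jN.
have sr : smv k (fun t => resid (V t) j).
  move=> i; have h (m : 'I_j) : sm k (fun t => dot (V t j) (gs (V t) m) * gs (V t) m i 0).
    have [sg _] := IH m (ltn_ord m) (ltn_trans (ltn_ord m) jN).
    by apply: smM; [apply: sm_dot => //; exact: V_smooth|exact: sg].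
  apply: sm_ext (smD (V_smooth j k i) (smN (sm_sum xpredT h))) => t _.
  by rewrite /resid !mxE summxE; congr (_ - _); apply: eq_bigr => m _; rewrite mxE.
have sd := sm_dot sr sr.
have pd t : 0 <= t <= 1 -> 0 < dot (resid (V t) j) (resid (V t) j).
  by move=> /V_pos/(_ jN); rewrite /l2norm sqrtr_gt0.
have si := sm_rsqrt pd sd; split; [|split] => //.
  by move=> i; apply: sm_ext (smM si (sr i)) => t _; rewrite gsE /normalize /l2norm [RHS]mxE.
apply: sm_ext (smM sd si) => t t01; rewrite /l2norm -{1}[dot _ _]sqr_sqrtr ?dot_ge0//.
by rewrite expr2 mulfK// sqrtr_eq0 -ltNge pd.
Qed.

Hypothesis V_next : forall t j, 0 <= t <= 1 -> hasdv (fun s => V s j) t (V t j.+1).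
Hypothesis V_orth : forall t i j, 0 <= t <= 1 -> (i < N)%N -> (j < N)%N ->
  dot (gs (V t) i) (gs (V t) j) = (i == j)%:R.

Lemma dot_gs_lower t m j : 0 <= t <= 1 -> (m < N)%N -> (j <= m)%N ->
  dot (gs (V t) m) (V t j) = if j == m then l2norm (resid (V t) m) else 0.
Proof.
move=> t01 mN jm; have jN : (j < N)%N by exact: leq_ltn_trans mN.
rewrite dot_gs_expand => [|l lj].
  by rewrite V_orth// eq_sym; case: eqP => [->|_]; rewrite /= ?mulr1 ?mulr0.
rewrite V_orth//; last exact: ltn_trans jN.
by rewrite gtn_eqF// (leq_trans lj).
Qed.

(** Differentiate <e_m, V_j> = 0 for j < m with V_j' = V_(j+1). As V_j is triangular in e_0, ...,
    e_j, the coordinates of e_m' come out one after the other. *)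
Lemma frenet_coords t m (d : 'cV[R]_n.+1) : 0 <= t <= 1 -> (m < N)%N ->
  hasdv (fun s => gs (V s) m) t d ->
  (forall j, (j.+1 < m)%N -> dot d (gs (V t) j) = 0) /\
  (forall j, j.+1 = m -> dot d (gs (V t) j) = - (l2norm (resid (V t) m) / l2norm (resid (V t) j))).
Proof.
move=> t01 mN hd.
have eqA j : (j < m)%N -> dot d (V t j) = - dot (gs (V t) m) (V t j.+1).
  move=> jm; have jN : (j < N)%N by exact: ltn_trans mN.
  apply/eqP; rewrite -subr_eq0 opprK; apply/eqP.
  apply: (@hasd_uniq _ (fun s => dot (gs (V s) m) (V s j)) t _ _ t01).
    by apply: hasd_dot => //; exact: V_next.
  apply: (hasd_ext t01 _ (hasd_cst 0 t)) => s s01.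
  by rewrite dot_gs_lower// 1?ltnW// ltn_eqF.
have lo j : (j.+1 < m)%N -> dot d (gs (V t) j) = 0.
  elim/ltn_ind: j => j IH jm.
  have jN : (j < N)%N := ltn_trans (ltnW jm) mN.
  have h l : (l < j)%N -> dot d (gs (V t) l) = 0.
    by move=> lj; apply: IH => //; apply: leq_trans jm; rewrite !ltnS ltnW.
  have := eqA j (ltnW jm); rewrite (dot_gs_expand h) (dot_gs_lower t01 mN (ltnW jm)).
  rewrite (ltn_eqF jm) oppr0 => /eqP; rewrite mulf_eq0 gt_eqF ?V_pos//= => /eqP.
  exact.
split => // j jm; have jm' : (j < m)%N by rewrite -jm.
have jN : (j < N)%N by exact: ltn_trans mN.
have h l : (l < j)%N -> dot d (gs (V t) l) = 0 by move=> lj; apply: lo; rewrite -jm.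
have := eqA j jm'; rewrite (dot_gs_expand h) (dot_gs_lower t01 mN jm') jm eqxx => e.
have U0 : l2norm (resid (V t) j) != 0 by rewrite gt_eqF ?V_pos.
by apply: (mulfI U0); rewrite e mulrN mulrCA divff// mulr1.
Qed.

Lemma frenet_table t m k (d d' : 'cV[R]_n.+1) : 0 <= t <= 1 -> (m < N)%N -> (k < N)%N ->
  hasdv (fun s => gs (V s) m) t d -> hasdv (fun s => gs (V s) k) t d' ->
  dot d (gs (V t) k) = - dot d' (gs (V t) m).
Proof.
move=> t01 mN kN hd hd'; rewrite [dot d' _]dotC.
apply/eqP; rewrite -subr_eq0 opprK; apply/eqP.
apply: (@hasd_uniq _ (fun s => dot (gs (V s) m) (gs (V s) k)) t _ _ t01).
  exact: hasd_dot.
by apply: (hasd_ext t01 _ (hasd_cst (m == k)%:R t)) => s s01; rewrite V_orth.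
Qed.

End Frenet.

Section Basis.
Context {R : realType}.

Lemma basis_expand n (e : nat -> 'cV[R]_n.+1) (u : 'cV[R]_n.+1) :
  (forall i j, (i < n.+1)%N -> (j < n.+1)%N -> dot (e i) (e j) = (i == j)%:R) ->
  u = \sum_(k < n.+1) dot u (e k) *: e k.
Proof.
move=> oe; pose Q := \matrix_(i < n.+1, j < n.+1) e j i 0.
have QQ : Q^T *m Q = 1%:M.
  apply/matrixP => i j; rewrite !mxE -oe ?ltn_ord//.
  by apply: eq_bigr => k _; rewrite !mxE.
have QQ1 := mulmx1C QQ.
rewrite -[LHS]mul1mx -QQ1 -mulmxA; apply/matrixP => i j; rewrite ord1 !mxE summxE.
apply: eq_bigr => k _; rewrite !mxE mulrC; congr (_ * _).
by apply: eq_bigr => l _; rewrite !mxE mulrC.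
Qed.

End Basis.

(** * Lifted frames *)

Section FrenetFour.
Context {R : realType}.
Variable V : R -> nat -> 'cV[R]_4.
Hypothesis V_smooth : forall j k, smv k (fun t => V t j).
Hypothesis V_pos : forall (t : R) j, 0 <= t <= 1 -> (j < 4)%N -> 0 < l2norm (resid (V t) j).
Hypothesis V_next : forall (t : R) j, 0 <= t <= 1 -> hasdv (fun s => V s j) t (V t j.+1).
Hypothesis V_orth : forall (t : R) i j, 0 <= t <= 1 -> (i < 4)%N -> (j < 4)%N ->
  dot (gs (V t) i) (gs (V t) j) = (i == j)%:R.

Local Notation e j t := (gs (V t) j).
Local Notation c j t := (l2norm (resid (V t) j) / l2norm (resid (V t) j.-1)).

Lemma frenet_four (t : R) : 0 <= t <= 1 -> [/\
  hasdv (fun s => e 0 s) t (c 1 t *: e 1 t),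
  hasdv (fun s => e 1 s) t (c 2 t *: e 2 t - c 1 t *: e 0 t),
  hasdv (fun s => e 2 s) t (c 3 t *: e 3 t - c 2 t *: e 1 t) &
  hasdv (fun s => e 3 s) t (- (c 3 t *: e 2 t))].
Proof.
move=> t01.
have der j : (j < 4)%N -> exists d : 'cV[R]_4, hasdv (fun s => e j s) t d.
  move=> j4; have [sg _] := gs_smooth V_smooth V_pos 1 j4.
  have /choice[f ff] : forall i, exists y : R, hasd (fun s => e j s i 0) t y.
    by move=> i; have [g _ dg] := sg i; exists (g t); exact: dg.
  by exists (\col_i f i) => i; rewrite mxE; exact: ff.
have [d0 h0] := der 0%N isT; have [d1 h1] := der 1%N isT.
have [d2 h2] := der 2%N isT; have [d3 h3] := der 3%N isT.
have F m d := @frenet_coords R 3 V 4 V_pos V_next V_orth t m d t01.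
have [_ _] := F 0%N d0 isT h0; have [_ b1] := F 1%N d1 isT h1.
have [a2 b2] := F 2%N d2 isT h2; have [a3 b3] := F 3%N d3 isT h3.
have q10 := b1 0%N erefl; have q21 := b2 1%N erefl; have q32 := b3 2%N erefl.
have q20 := a2 0%N isT; have q30 := a3 0%N isT; have q31 := a3 1%N isT.
have T m k d d' := @frenet_table R 3 V 4 V_orth t m k d d' t01.
have q01 : dot d0 (e 1 t) = c 1 t by rewrite (T 0%N 1%N d0 d1)// q10 opprK.
have q12 : dot d1 (e 2 t) = c 2 t by rewrite (T 1%N 2%N d1 d2)// q21 opprK.
have q23 : dot d2 (e 3 t) = c 3 t by rewrite (T 2%N 3%N d2 d3)// q32 opprK.
have q02 : dot d0 (e 2 t) = 0 by rewrite (T 0%N 2%N d0 d2)// q20 oppr0.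
have q03 : dot d0 (e 3 t) = 0 by rewrite (T 0%N 3%N d0 d3)// q30 oppr0.
have q13 : dot d1 (e 3 t) = 0 by rewrite (T 1%N 3%N d1 d3)// q31 oppr0.
have self m d : (m < 4)%N -> hasdv (fun s => e m s) t d -> dot d (e m t) = 0.
  by move=> m4 hd; have := T m m d d m4 m4 hd hd; lra.
have q00 := self 0%N d0 isT h0; have q11 := self 1%N d1 isT h1.
have q22 := self 2%N d2 isT h2; have q33 := self 3%N d3 isT h3.
have B d := basis_expand (e := fun j => e j t) d (fun i j hi hj => V_orth t01 hi hj).
have E d : d = dot d (e 0 t) *: e 0 t + dot d (e 1 t) *: e 1 t + dot d (e 2 t) *: e 2 t +
    dot d (e 3 t) *: e 3 t.
  by rewrite {1}(B d) !big_ord_recl big_ord0 addr0 !addrA.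
split.
- by rewrite (_ : _ *: _ = d0)// [RHS]E q00 q01 q02 q03 !scale0r !addr0 add0r.
- rewrite (_ : _ - _ = d1)// [RHS]E q10 q11 q12 q13 !scale0r !addr0 scaleNr.
  by rewrite addrC.
- rewrite (_ : _ - _ = d2)// [RHS]E q20 q21 q22 q23 !scale0r !addr0 add0r scaleNr.
  by rewrite addrC.
- by rewrite (_ : - _ = d3)// [RHS]E q30 q31 q32 q33 !scale0r !add0r addr0 scaleNr.
Qed.

End FrenetFour.

(** * Quaternion coordinates of the two covering maps *)

Section Bridge.
Context {R : realType}.

Definition toq (x : 'cV[R]_4) : @quatn R := Qn (qre x) (qi x) (qj x) (qk x).

Definition iot (k : nat) (z : @quatn R) :=
  match k with 0%N => z | 1%N => muli z | 2%N => mulj z | _ => mulk z end.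

Lemma inord_inj4 (i k m : nat) : (i <= m)%N -> (k <= m)%N ->
  (inord i == inord k :> 'I_m.+1) = (i == k).
Proof. by move=> im km; rewrite -val_eqE /= !inordK. Qed.

Lemma comp_toq (x : 'cV[R]_4) i : (i < 4)%N -> x (inord i) 0 = comp i (toq x).
Proof. by case: i => [|[|[|[|]]]]. Qed.

Lemma quat_comp (a b c d : R) i : (i < 4)%N -> quat a b c d (inord i) 0 = comp i (Qn a b c d).
Proof. by move=> i4; rewrite mxE inordK//; case: i i4 => [|[|[|[|]]]]. Qed.

Lemma toq_quat (a b c d : R) : toq (quat a b c d) = Qn a b c d.
Proof. by rewrite /toq /qre /qi /qj /qk !quat_comp. Qed.

Lemma toq_mulc x y : toq (qmul x (qconj y)) = mulc (toq x) (toq y).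
Proof.
have [e0 e1 e2 e3] := col_quat (qre y) (- qi y) (- qj y) (- qk y).
by rewrite /qmul /qconj toq_quat e0 e1 e2 e3 /mulc /toq /=; congr Qn; ring.
Qed.

Lemma toq_delta k : (k < 4)%N -> toq (delta_mx (inord k) 0) =
  Qn (k == 0%N)%:R (k == 1%N)%:R (k == 2%N)%:R (k == 3%N)%:R.
Proof.
move=> k4; rewrite /toq /qre /qi /qj /qk !mxE eqxx !andbT !inord_inj4//.
by rewrite ![_ == k]eq_sym.
Qed.

Lemma toq_iot x k : (k < 4)%N -> toq (qmul x (delta_mx (inord k) 0)) = iot k (toq x).
Proof.
move=> k4; have [e0 e1 e2 e3] : [/\ qre (delta_mx (inord k) 0) = (k == 0%N)%:R :> R,
   qi (delta_mx (inord k) 0) = (k == 1%N)%:R :> R, qj (delta_mx (inord k) 0) = (k == 2%N)%:R :> R &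
   qk (delta_mx (inord k) 0) = (k == 3%N)%:R :> R] by case: (toq_delta k4).
rewrite /qmul toq_quat e0 e1 e2 e3.
by case: k k4 {e0 e1 e2 e3} => [|[|[|[|]]]]// _; rewrite /toq /=; congr Qn => /=; ring.
Qed.

Lemma Pi4_comp (x : 'cV[R]_4 * 'cV[R]_4) i k : (i < 4)%N -> (k < 4)%N ->
  Pi4 x (inord i) (inord k) = comp i (mulc (iot k (toq x.1)) (toq x.2)).
Proof. by move=> i4 k4; rewrite mxE comp_toq// toq_mulc toq_iot. Qed.

Lemma Pi3_comp (x : 'cV[R]_4) i k : (i < 3)%N -> (k < 3)%N ->
  Pi3 x (inord i) (inord k) = comp i.+1 (mulc (iot k.+1 (toq x)) (toq x)).
Proof.
move=> i3 k3; have im y : im_part y (inord i) 0 = comp i.+1 (toq y).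
  by rewrite mxE inordK//; case: i i3 => [|[|[|]]].
rewrite mxE im toq_mulc; congr (comp _ (mulc _ _)).
rewrite -toq_iot//; congr (toq (qmul _ _)).
apply/matrixP => l j; rewrite ord1 -[l]inord_val; have l4 := ltn_ord l.
rewrite !quat_comp// !mxE eqxx !andbT !inord_inj4//.
by case: (nat_of_ord l) l4 => [|[|[|[|]]]]// _; case: k k3 => [|[|[|]]].
Qed.

Lemma dot_gram (x y : 'cV[R]_4) : dot x y = gram (toq x) (toq y).
Proof.
rewrite /dot (eq_bigr (fun i : 'I_4 => comp i (toq x) * comp i (toq y))).
  by rewrite !big_ord_recl big_ord0 /gram /= /bump /=; ring.
by move=> i _; rewrite -[i]inord_val !comp_toq// inordK.
Qed.

Lemma on_sphere_dot n (x : 'cV[R]_n.+1) : on_sphere x <-> dot x x = 1.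
Proof.
rewrite /on_sphere /l2norm; split => [h|->]; last exact: sqrtr1.
by rewrite -[LHS]sqr_sqrtr ?dot_ge0// h expr1n.
Qed.

Lemma on_sphere_nrm x : on_sphere x <-> nrm (toq x) = 1.
Proof. by rewrite on_sphere_dot dot_gram /gram /nrm !expr2. Qed.

Lemma gram_iot (z w : @quatn R) i j : (i < 4)%N -> (j < 4)%N ->
  gram (mulc (iot i z) w) (mulc (iot j z) w) = (i == j)%:R * (nrm z * nrm w).
Proof.
rewrite gram_mulc mulrA => i4 j4; congr (_ * _).
by case: i i4 => [|[|[|[|]]]]// _; case: j j4 => [|[|[|[|]]]]// _; rewrite /gram /nrm /=; ring.
Qed.

End Bridge.

Ltac hds := lazymatch goal with
  | |- hasd (fun s => @?f s + @?g s) _ _ => apply: hasdD; hds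
  | |- hasd (fun s => @?f s * @?g s) _ _ => apply: hasdM; hds
  | |- hasd (fun s => - @?f s) _ _ => apply: hasdN; hds
  | |- _ => first [match goal with H : hasd ?f _ _ |- hasd ?f _ _ => exact H end
                 | eassumption | apply: hasd_cst]
  end.

Section MulcDerivative.
Context {R : realType}.

Lemma hasd_eq (f : R -> R) t d d' : hasd f t d -> d = d' -> hasd f t d'.
Proof. by move=> h <-. Qed.

Lemma mulc_hasd i t (f0 f1 f2 f3 g0 g1 g2 g3 : R -> R) (a0 a1 a2 a3 b0 b1 b2 b3 : R) :
  hasd f0 t a0 -> hasd f1 t a1 -> hasd f2 t a2 -> hasd f3 t a3 ->
  hasd g0 t b0 -> hasd g1 t b1 -> hasd g2 t b2 -> hasd g3 t b3 ->
  hasd (fun s => comp i (mulc (Qn (f0 s) (f1 s) (f2 s) (f3 s)) (Qn (g0 s) (g1 s) (g2 s) (g3 s)))) t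
    (comp i (mulc (Qn a0 a1 a2 a3) (Qn (g0 t) (g1 t) (g2 t) (g3 t))) +
     comp i (mulc (Qn (f0 t) (f1 t) (f2 t) (f3 t)) (Qn b0 b1 b2 b3))).
Proof.
move=> *; case: i => [|[|[|i]]]; rewrite /=; (eapply hasd_eq; [hds|]); cbv beta; ring.
Qed.

End MulcDerivative.

(** * The frame of gamma in terms of its two spin factors *)

Section Curve.
Context {R : realType}.
Variables (gamma : R -> 'cV[R]_4) (G : R -> 'cV[R]_4 * 'cV[R]_4).
Hypotheses (LC : Defs.locally_convex gamma) (GL : lifted_frame4 gamma G).

Definition lq (t : R) := toq (G (clamp t)).1.
Definition rq (t : R) := toq (G (clamp t)).2.

Local Notation V t := (fun k => derive01n k gamma t).
Local Notation e j t := (gs (V t) j).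
Local Notation E i := (qrow i lq rq).

Definition curv : coef := Coef (fun t => l2norm (resid (V t) 1) / l2norm (resid (V t) 0))
  (fun t => l2norm (resid (V t) 2) / l2norm (resid (V t) 1))
  (fun t => l2norm (resid (V t) 3) / l2norm (resid (V t) 2)).

Let in01 (t : R) : 0 <= t <= 1 -> t \in `[0, 1].
Proof. by rewrite in_itv. Qed.

Lemma nrm_lq t : nrm (lq t) = 1.
Proof. by case: GL => _ h _ _; have [+ _] := h _ (in01 (clamp01 t)); move/on_sphere_nrm. Qed.

Lemma nrm_rq t : nrm (rq t) = 1.
Proof. by case: GL => _ h _ _; have [_ +] := h _ (in01 (clamp01 t)); move/on_sphere_nrm. Qed.

Lemma frame_comp t i j : 0 <= t <= 1 -> (i < 4)%N -> (j < 4)%N ->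
  e j t (inord i) 0 = comp i (mulc (iot j (lq t)) (rq t)).
Proof.
move=> t01 i4 j4; rewrite /lq /rq clamp_id// -Pi4_comp//.
have [_ _ h _] := GL; rewrite h ?in01//.
by rewrite mxE inordK// gram_schmidt_nth.
Qed.

Lemma frame_toq t j : 0 <= t <= 1 -> (j < 4)%N -> toq (e j t) = mulc (iot j (lq t)) (rq t).
Proof.
move=> t01 j4; rewrite /toq /qre /qi /qj /qk !frame_comp//.
Qed.

Lemma frame_orth t i j : 0 <= t <= 1 -> (i < 4)%N -> (j < 4)%N ->
  dot (e i t) (e j t) = (i == j)%:R.
Proof.
by move=> t01 i4 j4; rewrite dot_gram !frame_toq// gram_iot// nrm_lq nrm_rq !mulr1.
Qed.

Lemma frame_pos t j : 0 <= t <= 1 -> (j < 4)%N -> 0 < l2norm (resid (V t) j).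
Proof.
move=> t01 j4; rewrite lt_def sqrtr_ge0 andbT; case: LC => _ /(_ t (in01 t01)).
have e : \det (jet_mx gamma t) = _ := det_gs (V t).
rewrite e => d0.
have : \prod_(k < 4) l2norm (resid (V t) k) != 0.
  by apply: contraTneq d0 => ->; rewrite mulr0 ltxx.
by move=> /prodf_neq0/(_ (inord j) isT); rewrite inordK.
Qed.

Lemma frame_smooth j k : smv k (fun t => derive01n j gamma t).
Proof. by case: LC => -[sg _] _; exact: smooth01_smv. Qed.

Lemma frame_next t j : 0 <= t <= 1 ->
  hasdv (fun s => derive01n j gamma s) t (derive01n j.+1 gamma t).
Proof. by move=> t01 i; case: LC => -[sg _] _; apply: derivable01_hasd; apply: sg; exact: in01. Qed.

Lemma curv_pos t : 0 <= t <= 1 -> [/\ 0 < k1 curv t, 0 < k2 curv t & 0 < k3 curv t].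
Proof. by move=> t01; split; apply: divr_gt0; exact: frame_pos. Qed.

Lemma curv_sm k : [/\ sm k (k1 curv), sm k (k2 curv) & sm k (k3 curv)].
Proof.
have s j j4 := gs_smooth frame_smooth frame_pos k (j := j) j4.
by split; apply: smM; [have [_ []] := s 1%N isT|have [_ []] := s 0%N isT|
  have [_ []] := s 2%N isT|have [_ []] := s 1%N isT|have [_ []] := s 3%N isT|have [_ []] :=
    s 2%N isT].
Qed.

Lemma frame_hasd t i : 0 <= t <= 1 -> [/\ hasd (r0 (E i)) t (k1 curv t * r1 (E i) t),
  hasd (r1 (E i)) t (k2 curv t * r2 (E i) t - k1 curv t * r0 (E i) t),
  hasd (r2 (E i)) t (k3 curv t * r3 (E i) t - k2 curv t * r1 (E i) t) &
  hasd (r3 (E i)) t (- (k3 curv t * r2 (E i) t))].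
Proof.
(* Indices above 3 give the same row as 3, by the default case of [comp]. *)
wlog i4 : i / (i < 4)%N.
  move=> main; have [i4|i4] := leqP i 3; first exact: main.
  by have := main 3 isT; case: i i4 => [|[|[|[|i]]]].
move=> t01; have [f [fr [h0 h1 h2 h3]]] : exists f : nat -> R -> 'cV[R]_4,
    (forall j s, 0 <= s <= 1 -> (j < 4)%N ->
      f j s (inord i) 0 = comp i (mulc (iot j (lq s)) (rq s))) /\
    [/\ hasdv (f 0%N) t (k1 curv t *: f 1%N t),
      hasdv (f 1%N) t (k2 curv t *: f 2%N t - k1 curv t *: f 0%N t),
      hasdv (f 2%N) t (k3 curv t *: f 3%N t - k2 curv t *: f 1%N t) &
      hasdv (f 3%N) t (- (k3 curv t *: f 2%N t))].
  exists (fun j s => e j s); split=> [j s s01 j4|]; first exact: frame_comp.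
  exact: frenet_four frame_smooth frame_pos frame_next frame_orth _ t01.
have sc (x : R) (u : 'cV[R]_4) k : (x *: u) k 0 = x * u k 0 by rewrite mxE.
have lin (x y : R) (u v : 'cV[R]_4) k : (x *: u - y *: v) k 0 = x * u k 0 - y * v k 0.
  by rewrite !mxE.
have ng (x : R) (u : 'cV[R]_4) k : (- (x *: u)) k 0 = - (x * u k 0) by rewrite !mxE.
split.
- have := h0 (inord i); rewrite sc fr// => h.
  by apply: (hasd_ext t01 _ h) => s s01; rewrite fr.
- have := h1 (inord i); rewrite lin !fr// => h.
  by apply: (hasd_ext t01 _ h) => s s01; rewrite fr.
- have := h2 (inord i); rewrite lin !fr// => h.
  by apply: (hasd_ext t01 _ h) => s s01; rewrite fr.
- have := h3 (inord i); rewrite ng !fr// => h.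
  by apply: (hasd_ext t01 _ h) => s s01; rewrite fr.
Qed.

Lemma frame_row_dv t i : 0 < t < 1 -> row_dv curv (E i) t.
Proof.
move=> t01; have t01' : 0 <= t <= 1 by lra.
by have [? ? ? ?] := frame_hasd i t01'; split; exact: hasd_dv.
Qed.

Lemma lrow_frame (f : @row R -> R -> R) (j : nat) i t : (0 < j <= 3)%N ->
  comp i (mulc (iot j (lq t)) (lq t)) =
  comp i (mulc (mulc (iot j (lq t)) (rq t)) (mulc (lq t) (rq t))).
Proof.
move=> j3; have nw := nrm_rq t; transitivity (comp i (mulc (iot j (lq t)) (lq t)) * nrm (rq t)).
  by rewrite nw mulr1.
by case: j j3 => [|[|[|[|]]]]// _; case: i => [|[|[|i]]]; rewrite /nrm /=; ring.
Qed.

(** The factor z is not yet known to be differentiable, so z h conj(z) is written as the product of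
    z h conj(w) and conj(e_0), whose derivatives are given by the Frenet equations of gamma. *)
Lemma lrow_hasd t i : 0 <= t <= 1 -> (0 < i <= 3)%N -> let p := k1 curv t + k3 curv t in
  let q := k2 curv t in let L := lrow i lq in
  [/\ hasd (r0 L) t (q * r1 L t), hasd (r1 L) t (p * r2 L t - q * r0 L t) &
      hasd (r2 L) t (- (p * r1 L t))].
Proof.
move=> t01 i3 p q L.
have [a0 a1 a2 a3] := frame_hasd 0 t01; have [b0 b1 b2 b3] := frame_hasd 1 t01.
have [c0 c1 c2 c3] := frame_hasd 2 t01; have [d0 d1 d2 d3] := frame_hasd 3 t01.
have nw := nrm_rq t.
have key (f g : R -> R) d d' : hasd f t d -> (forall s, g s = f s) -> d = d' * nrm (rq t) ->
  hasd g t d'.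
  by move=> hf gf; rewrite nw mulr1 => <-; apply: (hasd_ext t01 _ hf) => s _; rewrite gf.
have e j s : (0 < j <= 3)%N -> comp i (mulc (iot j (lq s)) (lq s)) =
    comp i (mulc (mulc (iot j (lq s)) (rq s)) (mulc (lq s) (rq s))).
  by move=> j3; exact: lrow_frame.
split.
- apply: (key _ _ _ _ (mulc_hasd (i := i) a1 b1 c1 d1 a0 b0 c0 d0)) => [s|]; first exact: (e 1%N).
  by rewrite /q /L /nrm; case: i i3 @L {a0 a1 a2 a3 b0 b1 b2 b3 c0 c1 c2 c3 d0 d1 d2 d3 e} =>
    [|[|[|[|]]]]// _ L; rewrite /=; ring.
- apply: (key _ _ _ _ (mulc_hasd (i := i) a2 b2 c2 d2 a0 b0 c0 d0)) => [s|]; first exact: (e 2%N).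
  by rewrite /p /q /L /nrm; case: i i3 @L {a0 a1 a2 a3 b0 b1 b2 b3 c0 c1 c2 c3 d0 d1 d2 d3 e} =>
    [|[|[|[|]]]]// _ L; rewrite /=; ring.
- apply: (key _ _ _ _ (mulc_hasd (i := i) a3 b3 c3 d3 a0 b0 c0 d0)) => [s|]; first exact: (e 3%N).
  by rewrite /p /L /nrm; case: i i3 @L {a0 a1 a2 a3 b0 b1 b2 b3 c0 c1 c2 c3 d0 d1 d2 d3 e} =>
    [|[|[|[|]]]]// _ L; rewrite /=; ring.
Qed.

End Curve.

(** * Differentiability of the left factor *)

Section SquareRoot.
Context {R : realType}.

Lemma dv_of_sq (f : R -> R) t d : ct f t -> f t != 0 -> dv (fun s => f s * f s) t d ->
  dv f t (d / (2 * f t)).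
Proof.
have pos (g : R -> R) e : ct g t -> 0 < g t -> dv (fun s => g s * g s) t e ->
  dv g t (e / (2 * g t)).
  move=> cg g0 dg; have g2 : 0 < g t * g t by rewrite mulr_gt0.
  have sq (x : R) : 0 < x -> Num.sqrt (x * x) = x by move=> x0; rewrite -expr2 sqrtr_sqr gtr0_norm.
  have := dv_sqrt (f := fun s => g s * g s) g2 dg; rewrite sq//; apply: dv_ext.
  have [h h0 H] := nr_ct cg g0; apply/nbhs_ballP; exists h => //= s.
  by rewrite /ball /= distrC ltr_distl => sh; rewrite sq//; exact: H.
move=> cf; rewrite neq_lt => /orP[f0|f0] df; last exact: pos.
have df' : dv (fun s => - f s * - f s) t d by under eq_fun do rewrite mulrNN.
have := dvN (pos (fun s => - f s) d (ctN cf) (etrans (oppr_gt0 _) f0) df').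
by under eq_fun do rewrite opprK; move=> h; apply: dv_eq h _; field; rewrite lt_eqF.
Qed.

(** A unit quaternion has a nonzero coordinate. It is differentiable as a root of its square, and
    the others as products with it divided by it. *)
Lemma dv_of_products (z : R -> @quatn R) t s : ctq z t -> nrm (z t) = 1 ->
  (forall m n, (m < 4)%N -> (n < 4)%N -> dv (fun u => comp m (z u) * comp n (z u)) t
    (comp m s * comp n (z t) + comp m (z t) * comp n s)) -> dvq z t s.
Proof.
move=> cz nz dp; have [m m4 zm] : exists2 m, (m < 4)%N & comp m (z t) != 0.
  have [e0|] := eqVneq (comp 0 (z t)) 0; last by exists 0%N.
  have [e1|] := eqVneq (comp 1 (z t)) 0; last by exists 1%N.
  have [e2|] := eqVneq (comp 2 (z t)) 0; last by exists 2%N.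
  have [e3|] := eqVneq (comp 3 (z t)) 0; last by exists 3%N.
  move: nz; rewrite /= in e0 e1 e2 e3; rewrite /nrm e0 e1 e2 e3 !expr0n !addr0.
  by move/eqP; rewrite eq_sym oner_eq0.
have cm := comp_ct (i := m) cz; have dm := dv_of_sq cm zm (dp m m m4 m4).
have dn n : (n < 4)%N -> dv (fun u => comp n (z u)) t (comp n s).
  move=> n4; have [k k0 K] : nr t (fun u => comp m (z u) != 0).
    have [p|p] : 0 < comp m (z t) \/ 0 < - comp m (z t).
    - by move: zm; rewrite neq_lt oppr_gt0 => /orP[]; [right|left].
    - by apply: nr_imp (nr_ct cm p) => u; exact: lt0r_neq0.
    - by apply: nr_imp (nr_ct (ctN cm) p) => u; rewrite oppr_gt0 => h'; rewrite lt_eqF.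
  apply: (dv_ext (f := fun u => (comp n (z u) * comp m (z u)) / comp m (z u))).
    apply/nbhs_ballP; exists k => //= u.
    by rewrite /ball /= distrC ltr_distl => uk; rewrite mulfK//; exact: K.
  by apply: dv_eq (dv_div zm (dp n m n4 m4) dm) _; field.
by split; [exact: dn 0%N isT|exact: dn 1%N isT|exact: dn 2%N isT|exact: dn 3%N isT].
Qed.

End SquareRoot.

Section Clamp.
Context {R : realType}.

Lemma clamp_continuous (T : topologicalType) (F : R -> T) t :
  {within `[0, 1], continuous F} -> {for t, continuous (fun s => F (clamp s))}.
Proof.
move=> /subspace_continuousP cF.
have t01 s : `[0, 1]%classic (clamp s : R) by rewrite /= in_itv; exact: clamp01.
have c : clamp s @[s --> t] --> within `[0, 1]%classic (nbhs (clamp t)).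
  move=> P wP; change (\forall s \near t, P (clamp s)).
  have h : \forall s \near t, clamp s \in `[0, 1] -> P (clamp s) := @clamp_ct R t _ wP.
  by apply: filterS h => s; apply; rewrite in_itv; exact: clamp01.
exact: (cvg_comp _ _ c (cF _ (t01 t))).
Qed.

Lemma hasd_clamp_ct (f g : R -> R) t : (forall s, 0 <= s <= 1 -> hasd f s (g s)) ->
  ct (fun s => f (clamp s)) t.
Proof.
move=> hf; have := hasd_cvg (hf _ (clamp01 t)) => /cvgrPdist_lt cf.
apply/cvgrPdist_lt => e e0; have /near01P[h h0 H] := cf e e0.
have /cvgrPdist_lt/(_ h h0) := @clamp_ct R t.
apply: filterS => s; rewrite distrC => sh.
have [->|ne] := eqVneq (clamp s) (clamp t); first by rewrite subrr normr0.
by apply: H => //; exact: clamp01.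
Qed.

Lemma lift_ct (G : R -> 'cV[R]_4 * 'cV[R]_4) t : {within `[0, 1], continuous G} ->
  ctq (fun s => toq (G (clamp s)).1) t /\ ctq (fun s => toq (G (clamp s)).2) t.
Proof.
move=> cG; have c := clamp_continuous (t := t) cG.
have f1 : (fun p : 'cV[R]_4 * 'cV[R]_4 =>
  p.1) @ (G (clamp t)) --> (G (clamp t)).1 by exact: cvg_fst.
have f2 : (fun p : 'cV[R]_4 * 'cV[R]_4 =>
  p.2) @ (G (clamp t)) --> (G (clamp t)).2 by exact: cvg_snd.
have c1 i : ct (fun s => (G (clamp s)).1 i 0) t.
  exact: (cvg_comp _ _ (cvg_comp _ _ c f1) (@coord_continuous R 4 1 i 0 _)).
have c2 i : ct (fun s => (G (clamp s)).2 i 0) t.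
  exact: (cvg_comp _ _ (cvg_comp _ _ c f2) (@coord_continuous R 4 1 i 0 _)).
by split; split; first [exact: c1|exact: c2].
Qed.

End Clamp.

Section SpinOfRows.
Context {R : realType}.

Lemma lrow_spin (z : R -> @quatn R) (p q : R) t : ctq z t -> (forall s, nrm (z s) = 1) ->
  (forall i, (0 < i <= 3)%N -> row_dv3 (fun=> q) (fun=> p) (lrow i z) t) ->
  dvq z t (spin p q (z t)).
Proof.
move=> cz nz1 L.
have [a0 a1 a2] := L 1%N isT; have [b0 b1 b2] := L 2%N isT; have [d0 d1 d2] := L 3%N isT.
apply: dv_of_products; [exact: cz|exact: nz1|].
have key (h g : R -> R) x y : dv h t x -> (forall s, nrm (z s) = 1 -> g s = h s) -> x = y ->
  dv g t y.
  by move=> dh gh <-; rewrite (_ : g = h)//; apply/funext => s; apply: gh; exact: nz1.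
have sym m n : dv (fun u => comp m (z u) * comp n (z u)) t
    (comp m (spin p q (z t)) * comp n (z t) +
     comp m (z t) * comp n (spin p q (z t))) ->
  dv (fun u => comp n (z u) * comp m (z u)) t
    (comp n (spin p q (z t)) * comp m (z t) +
     comp n (z t) * comp m (spin p q (z t))).
  by move=> h; apply: (key _ _ _ _ h) => [s _|]; ring.
(* For a unit quaternion the ten products of coordinates are affine in the rotation matrix, for
   instance 4 a^2 = 1 + trace and 4 a b is a difference of two opposite entries. *)
pose r : R := 4^-1.
have q00 := dvM (dv_cst r t) (dvD (dvD (dvD (dv_cst 1 t) a0) b1) d2).
have q11 := dvM (dv_cst r t) (dvB (dvB (dvD (dv_cst 1 t) a0) b1) d2).
have q22 := dvM (dv_cst r t) (dvB (dvD (dvB (dv_cst 1 t) a0) b1) d2).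
have q33 := dvM (dv_cst r t) (dvD (dvB (dvB (dv_cst 1 t) a0) b1) d2).
have q01 := dvM (dv_cst r t) (dvB d1 b2).
have q02 := dvM (dv_cst r t) (dvB a2 d0).
have q03 := dvM (dv_cst r t) (dvB b0 a1).
have q12 := dvM (dv_cst r t) (dvD a1 b0).
have q13 := dvM (dv_cst r t) (dvD a2 d0).
have q23 := dvM (dv_cst r t) (dvD b2 d1).
have e00 := key _ _ _ _ q00; have e11 := key _ _ _ _ q11; have e22 := key _ _ _ _ q22.
have e33 := key _ _ _ _ q33; have e01 := key _ _ _ _ q01; have e02 := key _ _ _ _ q02.
have e03 := key _ _ _ _ q03; have e12 := key _ _ _ _ q12; have e13 := key _ _ _ _ q13.
have e23 := key _ _ _ _ q23.
clear a0 a1 a2 b0 b1 b2 d0 d1 d2 q00 q11 q22 q33 q01 q02 q03 q12 q13 q23 L.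
have fin (m n : nat) : (m <= n)%N -> (n < 4)%N -> dv (fun u => comp m (z u) * comp n (z u)) t
    (comp m (spin p q (z t)) * comp n (z t) +
     comp m (z t) * comp n (spin p q (z t))).
  case: n => [|[|[|[|]]]]//; case: m => [|[|[|[|]]]]// _ _; [apply: e00|apply: e01|apply: e11|
    apply: e02|apply: e12|apply: e22|apply: e03|apply: e13|apply: e23|apply: e33];
    rewrite /r; try (move=> s nz); rewrite /=; first [by field |
    by rewrite -[X in _ * (X + _ + _ + _)]nz /nrm; field].
move=> m n m4 n4; have [mn|nm] := leqP m n; first exact: fin.
by apply: sym; apply: fin => //; exact: ltnW.
Qed.


End SpinOfRows.

Section Curve.
Context {R : realType}.
Variables (gamma : R -> 'cV[R]_4) (G : R -> 'cV[R]_4 * 'cV[R]_4).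
Hypotheses (LC : Defs.locally_convex gamma) (GL : lifted_frame4 gamma G).

Local Notation z := (lq G).
Local Notation w := (rq G).
Local Notation c := (curv gamma).

Lemma lq_ct t : ctq z t.
Proof. by have [cG _ _ _] := GL; have [] := lift_ct t cG. Qed.

Lemma rq_ct t : ctq w t.
Proof. by have [cG _ _ _] := GL; have [] := lift_ct t cG. Qed.

Lemma lq_dv t : 0 < t < 1 -> dvq z t (spin (k1 c t + k3 c t) (k2 c t) (z t)).
Proof.
move=> t01; have t01' : 0 <= t <= 1 by lra.
apply: lrow_spin; [exact: lq_ct|exact: (nrm_lq GL)|] => i i3.
by have [? ? ?] := lrow_hasd LC GL t01' i3; split; exact: hasd_dv.
Qed.

End Curve.

(** * The angle function and uniqueness of the lift *)

Section Antiderivative.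
Context {R : realType}.

Lemma antiderivative01 (q : R -> R) : (forall t, ct q t) -> exists th : R -> R,
  [/\ forall t, ct th t, th 0 = 0 & forall t, 0 < t < 1 -> dv th t (q t)].
Proof.
move=> cq.
(* Integrating from -1 makes F differentiable, hence continuous, at 0 as well. *)
pose F (x : R) := \int[lebesgue_measure]_(t in [set` Interval (BLeft (-1)) (BRight x)]) q t.
have dF x : -1 < x -> dv F x (q x).
  move=> x1; have xu : x < x + 1 by rewrite ltrDl ltr01.
  have int : lebesgue_measure.-integrable [set` Interval (BLeft (-1)) (BRight (x + 1))] (EFin \o q).
    apply: continuous_compact_integrable; first exact: segment_compact.
    by apply: continuous_subspaceT => t; exact: cq.
  have [|d1 d2] := @continuous_FTC1 R q (BLeft (-1)) x (x + 1) xu int _ (cq x).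
    by rewrite /= lte_fin.
  by apply: DeriveDef => //; rewrite -derive1E.
exists (fun t => F (clamp t) - F 0); split.
- move=> t; apply: ctB; last exact: ct_cst.
  apply: (ct_comp (f := F) (clamp_ct (t := t))); apply: dv_ct (dF _ _).
  by have := clamp01 t; lra.
- by rewrite clamp_id ?subrr// lexx ler01.
- move=> t t01; have t1 : -1 < t by lra.
  apply: dv_eq (dv_ext _ (dvB (dF t t1) (dv_cst (F 0) t))) _; last by rewrite subr0.
  have [h h0 H] := nr_I (nr_itv t (proj1 (andP t01))) (nr_itv t (h := 1 - t) ltac:(lra)).
  apply/nbhs_ballP; exists h => //= s; rewrite /ball /= distrC ltr_distl => /H[s1 s2].
  by rewrite clamp_id//; lra.
Qed.

Lemma toq_inj : injective (@toq R).
Proof.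
move=> x y [e0 e1 e2 e3]; apply/matrixP => i j; rewrite ord1 -[i]inord_val.
by have := ltn_ord i; case: (nat_of_ord i) => [|[|[|[|]]]].
Qed.

Lemma gram_le1 (x y : @quatn R) : nrm x = 1 -> nrm y = 1 -> gram x y <= 1.
Proof.
move=> nx ny; have : 0 <= nrm (Qn (qa x - qa y) (qb x - qb y) (qc x - qc y) (qd x - qd y)).
  by rewrite /nrm !addr_ge0 ?sqr_ge0.
have -> : nrm (Qn (qa x - qa y) (qb x - qb y) (qc x - qc y) (qd x - qd y)) =
  nrm x + nrm y - 2 * gram x y by rewrite /nrm /gram /=; ring.
by rewrite nx ny; lra.
Qed.

Lemma gram_eq1 (x y : @quatn R) : nrm x = 1 -> nrm y = 1 -> gram x y = 1 -> x = y.
Proof.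
move=> nx ny xy.
have : nrm (Qn (qa x - qa y) (qb x - qb y) (qc x - qc y) (qd x - qd y)) =
  nrm x + nrm y - 2 * gram x y by rewrite /nrm /gram /=; ring.
rewrite nx ny xy (_ : 1 + 1 - 2 * 1 = 0 :> R); last by ring.
move/eqP; rewrite /nrm /= !paddr_eq0 ?addr_ge0 ?sqr_ge0// !expf_eq0 /= !subr_eq0.
by case: x y {nx ny xy} => [a b c d] [a' b' c' d'] /= /andP[/andP[/andP[/eqP-> /eqP->] /eqP->] /eqP->].
Qed.

(** Two lifts give the same rotation M, and the trace of M^T M yields <z, z'> <w, w'> = 1. So <z,
    z'> never vanishes and stays positive from its value 1 at time 0; both inner products are at
    most 1, hence equal to 1. This transfers the end value in [LS3], stated for some lift, to any
    given one. *)
Lemma lift_unique (gamma : R -> 'cV[R]_4) (G H : R -> 'cV[R]_4 * 'cV[R]_4) :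
  lifted_frame4 gamma G -> lifted_frame4 gamma H -> G 1 = H 1.
Proof.
move=> LG LH; have [_ _ PG G0] := LG; have [_ _ PH H0] := LH.
have in01 s : clamp s \in `[0 : R, 1] by rewrite in_itv; exact: clamp01.
have eqf s j : (j < 4)%N -> mulc (iot j (lq G s)) (rq G s) = mulc (iot j (lq H s)) (rq H s).
  move=> j4; have e i : (i < 4)%N -> comp i (mulc (iot j (lq G s)) (rq G s)) =
      comp i (mulc (iot j (lq H s)) (rq H s)).
    by move=> i4; rewrite -!Pi4_comp// PG// PH.
  move: (e 0%N isT) (e 1%N isT) (e 2%N isT) (e 3%N isT).
  by case: (mulc _ _) => [? ? ? ?]; case: (mulc _ _) => [? ? ? ?] /= -> -> -> ->.
pose f s := gram (lq G s) (lq H s); pose g s := gram (rq G s) (rq H s).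
have fg s : f s * g s = 1.
  have tr : \sum_(j < 4) gram (mulc (iot j (lq G s)) (rq G s)) (mulc (iot j (lq H s)) (rq H s)) =
      4 * (f s * g s).
    by rewrite !big_ord_recl big_ord0 /f /g /gram /=; ring.
  have tr1 : \sum_(j < 4) gram (mulc (iot j (lq G s)) (rq G s)) (mulc (iot j (lq H s)) (rq H s)) = 4.
    rewrite (eq_bigr (fun=> 1)); first by rewrite sumr_const card_ord.
    by move=> j _; rewrite -eqf// gram_iot// eqxx (nrm_lq LG) (nrm_rq LG) !mulr1.
  by apply: (@mulfI _ (4 : R)); rewrite ?pnatr_eq0// -tr tr1 mulr1.
have cf s : ct f s.
  have [? ? ? ?] := lq_ct LG s; have [? ? ? ?] := lq_ct LH s.
  by rewrite /f /gram; cts.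
have f0 : f 0 = 1.
  by rewrite /f /lq clamp_id ?lexx ?ler01// G0 H0 /= toq_quat /gram /=; ring.
have f1 : 0 < f 1.
  rewrite ltNge; apply/negP => f1.
  have [||| s _ /eqP] := @ivt_zero _ (fun s => - f s) 0 1 ler01.
  - by move=> s _; exact: ctN.
  - by rewrite f0 oppr_le0 ler01.
  - by rewrite oppr_ge0.
  by rewrite oppr_eq0 => /eqP fs; have := fg s; rewrite fs mul0r => /eqP; rewrite eq_sym oner_eq0.
have fl := gram_le1 (nrm_lq LG 1) (nrm_lq LH 1); rewrite -/(f 1) in fl.
have gl := gram_le1 (nrm_rq LG 1) (nrm_rq LH 1); rewrite -/(g 1) in gl.
have fe : f 1 = 1.
  have : f 1 * g 1 <= f 1 * 1 by rewrite ler_pM2l.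
  by rewrite fg mulr1 => fge; apply/eqP; rewrite eq_le fl fge.
have g1 : g 1 = 1 by have := fg 1; rewrite fe mul1r.
have e1 := gram_eq1 (nrm_lq LG 1) (nrm_lq LH 1) fe.
have e2 := gram_eq1 (nrm_rq LG 1) (nrm_rq LH 1) g1.
move: e1 e2; rewrite /lq /rq clamp_id ?lexx ?ler01// => /toq_inj e1 /toq_inj e2.
by case: (G 1) (H 1) e1 e2 => [? ?] [? ?] /= -> ->.
Qed.

End Antiderivative.

(** * The left part *)

Section LeftPart.
Context {R : realType}.
Variables (gamma : R -> 'cV[R]_4) (G : R -> 'cV[R]_4 * 'cV[R]_4).
Hypotheses (LC : Defs.locally_convex gamma) (GL : lifted_frame4 gamma G).

Local Notation z := (lq G).
Local Notation w := (rq G).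
Local Notation c := (curv gamma).
Local Notation p t := (k1 c t + k3 c t).
Local Notation q t := (k2 c t).

Definition lcol (j : nat) (t : R) : 'cV[R]_3 := \col_i (nth r0 [:: r0; r1; r2] j) (lrow i.+1 z) t.

(** Bootstrap: the frame equations express the derivatives through the entries and the smooth
    curvatures, so each round gains one derivative. *)
Lemma lrow_sm k i : (0 < i <= 3)%N ->
  [/\ sm k (r0 (lrow i z)), sm k (r1 (lrow i z)) & sm k (r2 (lrow i z))].
Proof.
move=> i3; elim: k => // k [s0 s1 s2]; have [c1 c2 c3] := curv_sm LC k.
have d t (t01 : 0 <= t <= 1) := lrow_hasd LC GL t01 i3.
split.
- exists (fun t => q t * r1 (lrow i z) t); first exact: smM.
  by move=> t /d[].
- exists (fun t => p t * r2 (lrow i z) t - q t * r0 (lrow i z) t).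
    by apply: smD; [apply: smM => //; exact: smD|apply: smN; exact: smM].
  by move=> t /d[].
- exists (fun t => - (p t * r1 (lrow i z) t)).
    by apply: smN; apply: smM => //; exact: smD.
  by move=> t /d[].
Qed.

Lemma Pi3_lrow t i j : 0 <= t <= 1 -> (j < 3)%N ->
  Pi3 (G t).1 i (inord j) = (nth r0 [:: r0; r1; r2] j) (lrow i.+1 z) t.
Proof.
move=> t01 j3; have e : z t = toq (G t).1 by rewrite /lq clamp_id.
rewrite -[i]inord_val Pi3_comp// !inordK// -e.
by case: j j3 => [|[|[|]]].
Qed.

Lemma left_part_comp t i : 0 <= t <= 1 -> left_part G t i 0 = r0 (lrow i.+1 z) t.
Proof.
move=> t01; rewrite /left_part -colE mxE.
have -> : (0 : 'I_3) = inord 0 by apply: val_inj; rewrite /= inordK.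
by rewrite Pi3_lrow.
Qed.

Lemma lcol_orth t i j : (i < 3)%N -> (j < 3)%N -> dot (lcol i t) (lcol j t) = (i == j)%:R.
Proof.
move=> i3 j3; rewrite /dot (eq_bigr (fun k : 'I_3 => nth r0 [:: r0; r1; r2] i (lrow k.+1 z) t *
  nth r0 [:: r0; r1; r2] j (lrow k.+1 z) t)); last by move=> k _; rewrite !mxE.
rewrite !big_ord_recl big_ord0 /bump /=.
have nz := nrm_lq GL t; transitivity ((i == j)%:R * nrm (z t) ^+ 2).
  by case: i i3 => [|[|[|]]]// _; case: j j3 => [|[|[|]]]// _; rewrite /nrm /=; ring.
by rewrite nz expr1n mulr1.
Qed.

Lemma left_smv k : smv k (left_part G).
Proof.
move=> i; have [s _ _] := lrow_sm k (i := i.+1) (ltn_ord i).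
by apply: sm_ext s => t t01; rewrite left_part_comp.
Qed.

Lemma left_derive1 t i : 0 <= t <= 1 ->
  derive01n 1 (left_part G) t i 0 = q t * r1 (lrow i.+1 z) t.
Proof.
move=> t01; have h (j : 'I_3) : hasd (fun s => left_part G s j 0) t (q t * r1 (lrow j.+1 z) t).
  have [d _ _] := lrow_hasd LC GL t01 (i := j.+1) (ltn_ord j).
  by apply: (hasd_ext t01 _ d) => s s01; rewrite left_part_comp.
by have [_ ->] := hasd_derivable01 t01 h.
Qed.

Lemma left_derive2 t : 0 <= t <= 1 -> exists g : R, forall i,
  derive01n 2 (left_part G) t i 0 =
  g * r1 (lrow i.+1 z) t + q t * (p t * r2 (lrow i.+1 z) t - q t * r0 (lrow i.+1 z) t).
Proof.
move=> t01; have [_ [g _ dg] _] := curv_sm LC 1; exists (g t).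
have h (j : 'I_3) : hasd (fun s => derive01n 1 (left_part G) s j 0) t
    (g t * r1 (lrow j.+1 z) t + q t * (p t * r2 (lrow j.+1 z) t - q t * r0 (lrow j.+1 z) t)).
  have [_ d _] := lrow_hasd LC GL t01 (i := j.+1) (ltn_ord j).
  by apply: (hasd_ext t01 _ (hasdM (dg t t01) d)) => s s01; rewrite left_derive1.
by have [_ h2] := hasd_derivable01 t01 h; exact: h2.
Qed.

Lemma left_gs t j : 0 <= t <= 1 -> (j < 3)%N ->
  gs (fun k => derive01n k (left_part G) t) j = lcol j t /\
  0 < l2norm (resid (fun k => derive01n k (left_part G) t) j).
Proof.
move=> t01 j3; have [c1 c2 c3] := curv_pos LC t01; have [g hg] := left_derive2 t01.
(* Triangular coordinates of the derivatives in the left frame: gamma_l' = q t_l and gamma_l'' = q'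
   t_l + q (p n_l - q gamma_l), with [g] the derivative of q. *)
pose x (k : nat) := nth (1 : R) [:: 1; q t; q t * p t] k.
pose y (k m : nat) := if k == 2 then if m == 0%N then - (q t * q t) else g else 0.
have xp k : 0 < x k.
  by case: k => [|[|[|k]]]; rewrite /x /= ?nth_nil ?ltr01// mulr_gt0 ?addr_gt0.
suff ex k : (k < 3)%N -> 0 < x k /\ derive01n k (left_part G) t =
    x k *: lcol k t + \sum_(m < k) y k m *: lcol m t.
  have oq i k : (i < 3)%N -> (k < 3)%N ->
    dot (lcol i t) (lcol k t) = (i == k)%:R by exact: lcol_orth.
  by have [-> ->] := gs_unique oq ex j3.
move=> k3; split; first exact: xp.
have col (m : nat) (i : 'I_3) : lcol m t i 0 = (nth r0 [:: r0; r1; r2] m) (lrow i.+1 z) t.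
  by rewrite mxE.
have sc (a : R) (u v : 'cV[R]_3) (i : 'I_3) : (a *: u + v) i 0 = a * u i 0 + v i 0 by rewrite !mxE.
apply/matrixP => i l; rewrite ord1 sc summxE col.
have sc' (a : R) (u : 'cV[R]_3) (j' : 'I_3) : (a *: u) j' 0 = a * u j' 0 by rewrite mxE.
case: k k3 => [|[|[|k]]] k3; last by exfalso.
- by rewrite big_ord0 addr0 mul1r [LHS]left_part_comp.
- rewrite big_ord_recl big_ord0 sc' col [LHS]left_derive1//.
  change (q t * r1 (lrow i.+1 z) t = q t * r1 (lrow i.+1 z) t + (0 * r0 (lrow i.+1 z) t + 0)); ring.
- rewrite !big_ord_recl big_ord0 !sc' !col [LHS]hg.
  change (g * r1 (lrow i.+1 z) t + q t * (p t * r2 (lrow i.+1 z) t - q t * r0 (lrow i.+1 z) t) =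
    q t * p t * r2 (lrow i.+1 z) t + (- (q t * q t) * r0 (lrow i.+1 z) t +
    (g * r1 (lrow i.+1 z) t + 0))); ring.
Qed.

End LeftPart.

Lemma lrow_one (R : realType) (z : R -> @quatn R) t k l : z t = qone' ->
  (k < 3)%N -> (l < 3)%N -> (nth r0 [:: r0; r1; r2] l) (lrow k.+1 z) t = (k == l)%:R.
Proof.
by move=> zt; case: k => [|[|[|]]]// _; case: l => [|[|[|]]]// _; rewrite /= zt /=; ring.
Qed.

(** * The left curve and the equivalence *)

Section Final.
Context {R : realType}.
Variables (gamma : R -> 'cV[R]_4) (G : R -> 'cV[R]_4 * 'cV[R]_4).
Hypotheses (LC : Defs.locally_convex gamma) (GL : lifted_frame4 gamma G).

Local Notation z := (lq G).
Local Notation w := (rq G).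
Local Notation c := (curv gamma).

Lemma lcol_det t : \det (\matrix_(i < 3, j < 3) lcol G j t i 0) = 1.
Proof.
transitivity (nrm (z t) ^+ 3); last by rewrite (nrm_lq GL) expr1n.
pose A (i j : 'I_3) := (nth r0 [:: r0; r1; r2] j) (lrow i.+1 z) t.
have -> : \matrix_(i < 3, j < 3) lcol G j t i 0 = \matrix_(i < 3, j < 3) A i j.
  by apply/matrixP => i j; rewrite !mxE.
rewrite (expand_det_row _ ord0) !big_ord_recl big_ord0 /cofactor.
rewrite !(expand_det_row _ ord0) !big_ord_recl !big_ord0 /cofactor !det_mx11 !mxE.
by rewrite /A /nrm /=; ring.
Qed.

Lemma left_locally_convex : Defs.locally_convex (left_part G).
Proof.
split; first split.
- by apply: smv_smooth01 => k; exact: (left_smv LC GL).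
- move=> t; rewrite in_itv /= => t01; apply/on_sphere_dot.
  have -> : left_part G t = lcol G 0 t.
    by apply/matrixP => i j; rewrite ord1 left_part_comp// [RHS]mxE.
  by rewrite (lcol_orth GL).
- move=> t; rewrite in_itv /= => t01.
  have e : \det (jet_mx (left_part G) t) = _ := det_gs (fun k => derive01n k (left_part G) t).
  rewrite e mulr_gt0//.
    have -> : \matrix_(i < 3, j < 3) gs (fun k => derive01n k (left_part G) t) j i 0 =
        \matrix_(i < 3, j < 3) lcol G j t i 0.
      apply/matrixP => i j; rewrite [LHS]mxE [RHS]mxE.
      by have [-> _] := left_gs LC GL t01 (ltn_ord j).
    by rewrite lcol_det ltr01.
  by apply: prodr_gt0 => j _; have [_] := left_gs LC GL t01 (ltn_ord j).
Qed.

Lemma left_frenet t : 0 <= t <= 1 -> frenet_frame (left_part G) t = Pi3 (G t).1.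
Proof.
move=> t01; apply/matrixP => i j; rewrite [LHS]mxE gram_schmidt_nth//.
have [-> _] := left_gs LC GL t01 (ltn_ord j).
by rewrite -[j in RHS]inord_val Pi3_lrow// [LHS]mxE.
Qed.

Lemma frame_vec (a : 'cV[R]_4) t m : 0 <= t <= 1 -> (m < 4)%N ->
  dot a (gs (fun k => derive01n k gamma t) m) = rvec (arow z w a) m t.
Proof.
move=> t01 m4; rewrite dot_gram (frame_toq GL)//.
by case: m m4 => [|[|[|[|]]]].
Qed.

Lemma jets_gamma a : jets (rvec (arow z w a)) a gamma.
Proof.
move=> t j t01 j3 low; have t01' : 0 <= t <= 1 by lra.
exists (l2norm (resid (fun k => derive01n k gamma t) j)); first exact: (frame_pos LC).
rewrite (dot_gs_expand (V := fun k => derive01n k gamma t)); first by rewrite frame_vec.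
by move=> m mj; rewrite frame_vec ?low// (leq_trans mj)// ltnW.
Qed.

Lemma left_vec (a : 'cV[R]_3) t m : (m < 3)%N -> dot a (lcol G m t) = lvec z a m t.
Proof.
move=> m3; rewrite /dot (eq_bigr (fun i : 'I_3 => a (inord i) 0 * (nth r0 [:: r0; r1;
  r2] m) (lrow i.+1 z) t)).
  by rewrite !big_ord_recl big_ord0 /lvec /lcomb /bump /= addr0 addrA.
by move=> i _; rewrite mxE inord_val.
Qed.

Lemma jets_left a : jets (lvec z a) a (left_part G).
Proof.
move=> t j t01 j3 low; have t01' : 0 <= t <= 1 by lra.
have [e pos] := left_gs LC GL t01' j3.
exists (l2norm (resid (fun k => derive01n k (left_part G) t) j)); first exact: pos.
rewrite (dot_gs_expand (V := fun k => derive01n k (left_part G) t)); first by rewrite e left_vec.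
move=> m mj; have m3 : (m < 3)%N by exact: leq_trans (ltnW mj) j3.
by have [-> _] := left_gs LC GL t01' m3; rewrite left_vec// low.
Qed.

Hypothesis G1 : G 1 = (- qone, qkk).

Lemma curve_frame_path : frame_path z w c.
Proof.
have [_ _ _ G0] := GL; split.
- exact: (lq_ct GL).
- exact: (rq_ct GL).
- exact: (nrm_lq GL).
- exact: (nrm_rq GL).
- by rewrite /lq clamp_id ?lexx ?ler01// G0 toq_quat.
- by rewrite /rq clamp_id ?lexx ?ler01// G0 toq_quat.
- rewrite /lq clamp_id ?lexx ?ler01// G1 /=.
  by rewrite /toq /qopp /qre /qi /qj /qk ![(- qone) _ _]mxE !quat_comp.
- by rewrite /rq clamp_id ?lexx ?ler01// G1 toq_quat.
- by move=> t t01; apply: (curv_pos LC); lra.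
- by move=> i t t01; exact: (frame_row_dv LC GL).
- exact: (lq_dv LC GL).
Qed.

Lemma left_LS2 : LS2 (- qone) (left_part G).
Proof.
have [cG sG _ G0] := GL; split.
- exact: left_locally_convex.
- have P := curve_frame_path; rewrite left_frenet ?lexx ?ler01//; apply/matrixP => i j.
  by rewrite -[j in LHS]inord_val Pi3_lrow ?lexx ?ler01// (lrow_one (fp_z0 P))// [RHS]mxE.
- exists (fun t => (G t).1); split; last by rewrite G1.
  split; last by rewrite G0.
  + apply/subspace_continuousP => x x01; move/subspace_continuousP : cG => /(_ x x01) cG.
    have f1 : (fun p : 'cV[R]_4 * 'cV[R]_4 => p.1) @ (G x) --> (G x).1 by exact: cvg_fst.
    exact: (cvg_comp _ _ cG f1).
  + by move=> t /sG[].
  + by move=> t; rewrite in_itv /= => t01; rewrite left_frenet.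
Qed.

Lemma convex_iff_left_convex : convex_curve gamma <-> convex_curve (left_part G).
Proof.
have P := curve_frame_path; have [sg _] := LC; have [sl _] := left_locally_convex.
split=> conv.
- have T := convex_two_point conv jets_gamma.
  apply: (left_convex (q := k2 c) (p := fun t => k1 c t +
    k3 c t) (nrm_lq GL) _ (fp_dz P) _ sl jets_left).
    by move=> t /(fp_c P)[? ? ?]; split => //; exact: addr_gt0.
  by move=> t; exact: (two_point_delta P T).
- have T := convex_three_point (nrm_lq GL) conv jets_left.
  have [_ [k2' _ dk2] _] := curv_sm LC 1.
  have [|th [th_ct th0 dth]] := @antiderivative01 R (fun t => k2 c (clamp t) / 2).
    by move=> t; apply: ctM; [exact: hasd_clamp_ct dk2|exact: ct_cst].
  have S : spin_path z w c th.
    apply: (SpinPath (fp_z P) (fp_w P) (fp_nz P) (fp_nw P) (fp_z0 P) (fp_w0 P) (fp_z1 P)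
      (fp_c P) (fp_row P) (fp_dz P) th_ct th0).
    + by move=> t t01; have := dth t t01; rewrite clamp_id//; lra.
    + move=> t t01; have [] := three_point_delta P T t01.
      by have [-> ->] := lrow_delta z t; lra.
  exact: spin_path_convex S sg jets_gamma.
Qed.

End Final.

Theorem theoremC (R : realType) (gamma : R -> 'cV[R]_4)
    (G : R -> 'cV[R]_4 * 'cV[R]_4)
    (gammaLS : LS3 (- qone) qkk gamma)
    (Glift : lifted_frame4 gamma G) :
  LS2 (- qone) (left_part G) /\
  (convex_curve gamma <-> convex_curve (left_part G)).
Proof.
have [LC _ [H [LH H1]]] := gammaLS.
have G1 : G 1 = (- qone, qkk) by rewrite (lift_unique Glift LH).
by split; [exact: left_LS2 LC Glift G1|exact: convex_iff_left_convex LC Glift G1].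
Qed.
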